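(* Let $J$ and $R$ be anti-commuting fundamental symmetries in a Hilbert space $\mathfrak{H}$, let $S$ be a closed, simple, densely defined symmetric operator in $\mathfrak{H}$ with defect numbers $\langle 2,2\rangle$ such that $[S,J]=[S,R]=0$, and assume that $\Upsilon\neq\emptyset$. Fix a boundary triplet $(\mathcal{H},\Gamma_0,\Gamma_1)$ for $S^*$ such that the formulas $\mathcal{J}\Gamma_j=\Gamma_jJ$, $\mathcal{R}\Gamma_j=\Gamma_jR$ ($j=0,1$) correctly define operators $\mathcal{J},\mathcal{R}$ in $\mathcal{H}$, and an orthonormal basis of the two-dimensional space $\mathcal{H}$ in which $\mathcal{J},\mathcal{R},i\mathcal{R}\mathcal{J}$ have the matrices $\sigma_3,\sigma_1,\sigma_2$, respectively. Let $A_0=S^*\upharpoonright\ker\Gamma_0$ and let $m(\cdot)$ be the scalar function on $\rho(A_0)$ with $M(\cdot)=m(\cdot)I$, where $M$ is the Weyl function of $S$ associated with $(\mathcal{H},\Gamma_0,\Gamma_1)$. For $\zeta\in\mathbb{R}$, $\phi\in[0,\pi]$, $\xi,\omega\in[0,2\pi)$ let $$\mathcal{K}=\mathcal{K}(\zeta,\phi,\xi,\omega)=e^{-i\xi}\begin{pmatrix}-e^{-i\phi}\cosh\zeta & e^{-i\omega}\sinh\zeta\\ -e^{i\omega}\sinh\zeta & e^{i\phi}\cosh\zeta\end{pmatrix},\qquad A_{\mathcal{K}}=S^*\upharpoonright\{f\in\mathcal{D}(S^* ) : \mathcal{K}(\Gamma_1+i\Gamma_0)f=(\Gamma_1-i\Gamma_0)f\},$$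 and assume that $A_{\mathcal{K}}\in\Sigma_J^{\mathsf{st}}$. Then the spectrum of $A_{\mathcal{K}}$ is real and, moreover, $r\in\rho(A_0)$ belongs to the discrete spectrum of $A_{\mathcal{K}(\zeta,\phi,\xi,\omega)}$ if and only if $$\left[\tan\frac{\xi+t}{2}+m(r)\right]\cdot\left[\cot\frac{\xi-t}{2}-m(r)\right]=0,$$ where: if $A_{\mathcal{K}}\in\Sigma_J^{\mathsf{st}}\setminus\Upsilon$, then $t=t(\zeta,\phi)\in[0,2\pi)$ is determined by $$e^{it}=\frac{\cos\phi+i\sin\phi\cosh\chi}{|\cos\phi+i\sin\phi\cosh\chi|},\qquad \cos\phi\,\tanh\chi=-\tanh\zeta,\ \chi\in\mathbb{R};$$ and if $A_{\mathcal{K}}\in\Upsilon$, then $t=\pi/2$. Furthermore, if $A_{\mathcal{K}}=A_{\mathcal{K}(0,\pi/2,\xi,\omega)}\in\Upsilon$ and $\xi\neq\frac{\pi}{2}$, then $r\in\rho(A_0)$ belongs to the discrete spectrum of $A_{\mathcal{K}}$ if and only if $$\tan\frac{\xi+\frac{\pi}{2}}{2}+m(r)=0,$$ and in this case $A_{\mathcal{K}}$ coincides with the self-adjoint operator $A_r=S^*\upharpoonright\mathcal{D}(A_r)$, $\mathcal{D}(A_r)=\mathcal{D}(S)\dot{+}\ker(S^*-rI)$.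
   Context: $\mathfrak{H}$ is a Hilbert space with inner product $(\cdot,\cdot)$. A fundamental symmetry is a bounded operator $J$ with $J=J^*$, $J^2=I$; $J,R$ anti-commute if $JR+RJ=0$. For a bounded operator $C$ and an operator $A$, $[A,C]=0$ means $AC=CA$ (including equality of domains). $\{C_\alpha\}_{\alpha\in D}$ denotes the set (indexed by a set $D$) of all bounded operators $C$ in $\mathfrak{H}$ with $C^2=I$, $JC>0$ (i.e. $JC$ is self-adjoint and $(JCx,x)>0$ for $x\neq0$) and $SC=CS$. An operator $A$ is $J$-self-adjoint if it is densely defined and $A^*J=JA$. $\Sigma_J$ is the set of $J$-self-adjoint extensions $A\supset S$; $\Sigma_J^{\mathsf{st}}$ is the set of $A\in\Sigma_J$ with $[A,C_\alpha]=0$ for at least one $\alpha\in D$; $\Upsilon$ is the set of $A\in\Sigma_J$ with $[A,C_\alpha]=0$ for all $\alpha\in D$. (In terms of the parameters, $A_{\mathcal{K}}\in\Sigma_J^{\mathsf{st}}\setminus\Upsilon$ iff $|\tanh\zeta|<|\cos\phi|$, and $A_{\mathcal{K}}\in\Upsilon$ iff $\zeta=0$, $\phi=\pi/2$.) $S$ is simple if the closed linear span of $\bigcup_{\mu\in\mathbb{C}\setminus\mathbb{R}}\ker(S^*-\mu I)$ is $\mathfrak{H}$. Defect numbers $\langle2,2\rangle$ means $\dim\ker(S^*-\mu I)=2$ for all $\mu\in\mathbb{C}\setminus\mathbb{R}$. A boundary triplet for $S^*$ is a triplet $(\mathcal{H},\Gamma_0,\Gamma_1)$, where $\mathcal{H}$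 is a Hilbert space and $\Gamma_0,\Gamma_1:\mathcal{D}(S^* )\to\mathcal{H}$ are linear, such that $(S^*x,y)-(x,S^*y)=(\Gamma_1x,\Gamma_0y)_{\mathcal{H}}-(\Gamma_0x,\Gamma_1y)_{\mathcal{H}}$ for all $x,y\in\mathcal{D}(S^* )$ and $(\Gamma_0,\Gamma_1):\mathcal{D}(S^* )\to\mathcal{H}\oplus\mathcal{H}$ is surjective. $A_0$ is then self-adjoint. Under the stated hypotheses a boundary triplet and basis as required exist, and $\mathcal{J},\mathcal{R}$ are anti-commuting fundamental symmetries in $\mathcal{H}$, $\dim\mathcal{H}=2$. The Weyl function is determined by $M(\mu)\Gamma_0f_\mu=\Gamma_1f_\mu$ for all $f_\mu\in\ker(S^*-\mu I)$, $\mu\in\rho(A_0)$; in the present setting it commutes with $\mathcal{J}$ and $\mathcal{R}$ and hence is of the form $m(\mu)I$. Pauli matrices: $\sigma_1=\begin{pmatrix}0&1\\1&0\end{pmatrix}$, $\sigma_2=\begin{pmatrix}0&-i\\i&0\end{pmatrix}$, $\sigma_3=\begin{pmatrix}1&0\\0&-1\end{pmatrix}$. The discrete spectrum consists of isolated eigenvalues of finite algebraic multiplicity. Convention: if $\tan\frac{\xi+t}{2}$ or $\cot\frac{\xi-t}{2}$ is infinite (undefined), the corresponding factor is regarded as non-vanishing for every $r\in\rho(A_0)$. *)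

(* Defs.v *)
From HB Require Import structures.
From mathcomp Require Import all_boot all_order all_algebra.
From mathcomp Require Import complex.
From mathcomp Require Import all_classical all_reals all_analysis.

Set Implicit Arguments.
Unset Strict Implicit.
Unset Printing Implicit Defensive.

Import Order.TTheory GRing.Theory Num.Theory.
Import numFieldNormedType.Exports.

Local Open Scope classical_set_scope.
Local Open Scope ring_scope.
Local Open Scope complex_scope.

(* A Hilbert space is given by a complete normed module over [R[i]] and a
   positive definite Hermitian form, linear in its first argument, that induces
   its norm. *)
Definition inner_product (R : realType) (H : completeNormedModType R[i])
    (ip : {dot H for (@Num.conj R[i])}) : Prop :=
  forall x : H, `|x| ^+ 2 = ip x x.

(* An unbounded operator [A] in [H] is identified with its graph, a set of pairs
   [(x, A x)]; thus equality of operators includes equality of domains, and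
   [`<=`] is the extension order. *)

Section LinearSpan.
Variables (R : realType) (H : completeNormedModType R[i]).
Implicit Types E : set H.

Definition linear_span E : set H :=
  [set x | exists (n : nat) (c : 'I_n -> R[i]) (v : 'I_n -> H),
     (forall i, E (v i)) /\ x = \sum_(i < n) c i *: v i].

Definition linearly_independent (n : nat) (v : 'I_n -> H) : Prop :=
  forall c : 'I_n -> R[i],
    \sum_(i < n) c i *: v i = 0 -> forall i, c i = 0.

Definition has_dim (n : nat) E : Prop :=
  exists v : 'I_n -> H,
    linearly_independent v /\ linear_span (range v) = E.

End LinearSpan.

Section Operators.
Variables (R : realType) (H : completeNormedModType R[i]).
Implicit Types (A B : set (H * H)) (mu : R[i]).

Definition is_operator A : Prop :=
  [/\ A (0, 0),
      forall (a : R[i]) (p q : H * H), A p -> A q ->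
        A (a *: p.1 + q.1, a *: p.2 + q.2)
    & forall x y z : H, A (x, y) -> A (x, z) -> y = z].

Definition op_domain A : set H := [set x | exists y, A (x, y)].

Definition densely_defined A : Prop := dense (op_domain A).

Definition op_graph (T : H -> H) : set (H * H) := [set p | p.2 = T p.1].

(* [opcomp A B] is the product [A B], i.e. [B] is applied first. *)
Definition opcomp A B : set (H * H) :=
  [set p | exists z, B (p.1, z) /\ A (z, p.2)].

Definition op_restrict A (D : set H) : set (H * H) := [set p | A p /\ D p.1].

(* [A - mu I] *)
Definition op_shift A mu : set (H * H) := [set p | A (p.1, p.2 + mu *: p.1)].

Definition op_kernel A : set H := [set x | A (x, 0)].

Definition op_inverse A : set (H * H) := [set p | A (p.2, p.1)].

Definition bounded_operator (T : {linear H -> H}) : Prop :=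
  exists c : R, forall x, `|T x| <= c%:C * `|x|.

(* [T] commutes with [A], domains included. *)
Definition commutes A (T : H -> H) : Prop :=
  opcomp A (op_graph T) = opcomp (op_graph T) A.

Definition resolvent_set A : set R[i] :=
  [set mu | exists T : {linear H -> H},
     bounded_operator T /\ op_inverse (op_shift A mu) = op_graph T].

Definition spectrum A : set R[i] := ~` resolvent_set A.

Definition eigenvalue A mu : Prop :=
  exists x, x != 0 /\ op_kernel (op_shift A mu) x.

(* The root subspace, whose dimension is the algebraic multiplicity of [mu]. *)
Definition root_subspace A mu : set H :=
  [set x | exists n : nat,
     op_kernel (iter n (opcomp (op_shift A mu)) (op_graph idfun)) x].

Definition discrete_spectrum A : set R[i] :=
  [set r | [/\ isolated (spectrum A : set R[i]^o) r, eigenvalue A r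
             & exists n, has_dim n (root_subspace A r)]].

End Operators.

Section HilbertOperators.
Variables (R : realType) (H : completeNormedModType R[i]).
Variable ip : {dot H for (@Num.conj R[i])}.
Implicit Types (A S : set (H * H)) (J C : {linear H -> H}).

Definition adjoint A : set (H * H) :=
  [set q | forall p, A p -> ip p.2 q.1 = ip p.1 q.2].

Definition symmetric_operator A : Prop := A `<=` adjoint A.

Definition selfadjoint A : Prop := adjoint A = A.

Definition fundamental_symmetry J : Prop :=
  [/\ bounded_operator J, selfadjoint (op_graph J) & forall x, J (J x) = x].

Definition anticommute J C : Prop := forall x, J (C x) + C (J x) = 0.

Definition simple_operator S : Prop :=
  closure (linear_span
    (\bigcup_(mu in [set mu : R[i] | mu \isn't Num.real])
       op_kernel (op_shift (adjoint S) mu))) = setT.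

Definition defect_numbers_2_2 S : Prop :=
  forall mu : R[i], mu \isn't Num.real ->
    has_dim 2 (op_kernel (op_shift (adjoint S) mu)).

Definition stable_C_symmetry J S : set {linear H -> H} :=
  [set C : {linear H -> H} |
    [/\ bounded_operator C,
        forall x, C (C x) = x,
        selfadjoint (op_graph (J \o C)),
        forall x, x != 0 -> 0 < ip (J (C x)) x
      & commutes S C]].

Definition J_selfadjoint J A : Prop :=
  densely_defined A /\ opcomp (adjoint A) (op_graph J) = opcomp (op_graph J) A.

Definition Sigma J S : set (set (H * H)) :=
  [set A | [/\ is_operator A, S `<=` A & J_selfadjoint J A]].

Definition Sigma_st J S : set (set (H * H)) :=
  [set A | Sigma J S A /\ exists C, stable_C_symmetry J S C /\ commutes A C].

Definition Upsilon J S : set (set (H * H)) :=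
  [set A | Sigma J S A /\ forall C, stable_C_symmetry J S C -> commutes A C].

(* [S^*] restricted to the direct sum of [D(S)] and [ker (S^* - r I)]. *)
Definition eigen_extension S (r : R[i]) : set (H * H) :=
  op_restrict (adjoint S)
    [set f | exists s k, [/\ op_domain S s, op_kernel (op_shift (adjoint S) r) k
                           & f = s + k]].

End HilbertOperators.

Section BoundaryTriplets.
Variables (R : realType) (H K : completeNormedModType R[i]).
Variables (ip : {dot H for (@Num.conj R[i])}) (ipK : {dot K for (@Num.conj R[i])}).
Implicit Types (S : set (H * H)) (Gamma : H -> K).

Definition linear_on (D : set H) Gamma : Prop :=
  forall (a : R[i]) x y, D x -> D y -> Gamma (a *: x + y) = a *: Gamma x + Gamma y.

(* Only the values of [Gamma0], [Gamma1] on the domain of [S^*] matter. *)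
Definition boundary_triplet S (Gamma0 Gamma1 : H -> K) : Prop :=
  [/\ linear_on (op_domain (adjoint ip S)) Gamma0,
      linear_on (op_domain (adjoint ip S)) Gamma1,
      forall p q, adjoint ip S p -> adjoint ip S q ->
        ip p.2 q.1 - ip p.1 q.2 =
        ipK (Gamma1 p.1) (Gamma0 q.1) - ipK (Gamma0 p.1) (Gamma1 q.1)
    & forall u v, exists x,
        [/\ op_domain (adjoint ip S) x, Gamma0 x = u & Gamma1 x = v]].

Definition boundary_image S Gamma (T : H -> H) (TK : K -> K) : Prop :=
  forall x, op_domain (adjoint ip S) x -> TK (Gamma x) = Gamma (T x).

Definition A0 S (Gamma0 : H -> K) : set (H * H) :=
  op_restrict (adjoint ip S) [set f | Gamma0 f = 0].

Definition weyl_function S (Gamma0 Gamma1 : H -> K)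
    (M : R[i] -> {linear K -> K}) : Prop :=
  forall mu, resolvent_set (A0 S Gamma0) mu ->
    bounded_operator (M mu) /\
    forall f, op_kernel (op_shift (adjoint ip S) mu) f ->
      M mu (Gamma0 f) = Gamma1 f.

End BoundaryTriplets.

Section Bases.
Variables (R : realType) (K : completeNormedModType R[i]).
Variables (ipK : {dot K for (@Num.conj R[i])}) (n : nat) (e : 'I_n -> K).

Definition orthonormal_basis : Prop :=
  (forall i j, ipK (e i) (e j) = (i == j)%:R) /\ linear_span (range e) = setT.

Definition has_matrix (T : K -> K) (X : 'M[R[i]]_n) : Prop :=
  forall j, T (e j) = \sum_(i < n) X i j *: e i.

Definition matrix_operator (X : 'M[R[i]]_n) (u : K) : K :=
  \sum_(i < n) (\sum_(j < n) X i j * ipK u (e j)) *: e i.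

End Bases.

Section MatrixFamily.
Variable R : realType.

Definition mx2 (a b c d : R[i]) : 'M[R[i]]_2 :=
  \matrix_(i, j) (if i == 0 then (if j == 0 then a else b)
                  else (if j == 0 then c else d)).

Definition sigma1 := mx2 0 1 1 0.
Definition sigma2 := mx2 0 (- 'i%C) 'i%C 0.
Definition sigma3 := mx2 1 0 0 (- 1).

Definition cosh (x : R) : R := (expR x + expR (- x)) / 2.
Definition sinh (x : R) : R := (expR x - expR (- x)) / 2.
Definition tanh (x : R) : R := sinh x / cosh x.

(* [exp (i x)] *)
Definition expi (x : R) : R[i] := cos x +i* sin x.

Definition calK (zeta phi xi omega : R) : 'M[R[i]]_2 :=
  expi (- xi) *:
  mx2 (- (expi (- phi) * (cosh zeta)%:C)) (expi (- omega) * (sinh zeta)%:C)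
      (- (expi omega * (sinh zeta)%:C)) (expi phi * (cosh zeta)%:C).

Definition cot (x : R) : R := cos x / sin x.

(* [tan x + z] and [cot x - z]; at a pole of [tan] or [cot] the factor is set
   to 1, so that it does not vanish for any [z]. *)
Definition tan_factor (x : R) (z : R[i]) : R[i] :=
  if cos x == 0 then 1 else (tan x)%:C + z.

Definition cot_factor (x : R) (z : R[i]) : R[i] :=
  if sin x == 0 then 1 else (cot x)%:C - z.

End MatrixFamily.

Section Extensions.
Variables (R : realType) (H K : completeNormedModType R[i]).
Variables (ip : {dot H for (@Num.conj R[i])}) (ipK : {dot K for (@Num.conj R[i])}).

Definition A_K (S : set (H * H)) (Gamma0 Gamma1 : H -> K) (e : 'I_2 -> K)
    (zeta phi xi omega : R) : set (H * H) :=
  op_restrict (adjoint ip S)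
    [set f | matrix_operator ipK e (calK zeta phi xi omega)
               (Gamma1 f + 'i%C *: Gamma0 f) = Gamma1 f - 'i%C *: Gamma0 f].

Definition is_angle (J : {linear H -> H}) (S A : set (H * H)) (zeta phi t : R)
    : Prop :=
  ((Sigma_st ip J S `\` Upsilon ip J S) A ->
     0 <= t < 2 * pi /\
     exists chi : R,
       cos phi * tanh chi = - tanh zeta /\
       let w := cos phi +i* (sin phi * cosh chi) in expi t = w / `|w|) /\
  (Upsilon ip J S A -> t = pi / 2).

End Extensions.

(* Main.v *)
(* By Krein's formula a point [z] of the resolvent set of [A0] is either an
   eigenvalue of [A_K] or a regular point, and it is an eigenvalue exactly when
   [det ((m z + i) K - (m z - i)) = 0]. Since [det K = - e^(- 2 i xi)] and
   [tr K = 2 i e^(- i xi) cosh zeta sin phi], this determinant splits into the tan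
   and cot factors as soon as [sin t = cosh zeta sin phi], which is what the
   definition of [t] amounts to. If [A_K] commutes with [C], it is symmetric for
   the inner product given by [JC]; hence its eigenvalues are real and their root
   subspaces are eigenspaces. They are isolated because [m] is locally injective
   at real points, by the identity
   [(z - r) (f_z, f_r) = (m z - m r) (Gamma0 f_z, Gamma0 f_r)].

   The existence of [chi] requires [|tanh zeta| < |cos phi|] (or [zeta = 0] and
   [phi = pi / 2]). When [m] takes two values on the upper half plane, an operator
   [C] commuting with [S] acts on the boundary values through a 2 x 2 matrix,
   which commutes with [K], and this gives the bound. When [m] is constant there,
   [C] may act differently on the defect spaces of the two half planes, and then
   no operator commutes with all the [C]: this contradicts the assumption that
   Upsilon is nonempty. *)

Require Import Defs.
From HB Require Import structures.
From mathcomp Require Import all_boot all_order all_algebra.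
From mathcomp Require Import complex.
From mathcomp Require Import all_classical all_reals all_analysis.
From mathcomp Require Import ring lra.

Set Implicit Arguments.
Unset Strict Implicit.
Unset Printing Implicit Defensive.

Import Order.TTheory GRing.Theory Num.Theory.
Import numFieldNormedType.Exports.

Local Open Scope classical_set_scope.
Local Open Scope ring_scope.
Local Open Scope complex_scope.

Local Notation Re := complex.Re.
Local Notation Im := complex.Im.

(** The bound on [zeta] and [phi] comes from the matrix [Y] of [C] on boundary values: [Y ^ 2 = 1]
    and positivity of [sigma3 Y] force the rows [(a, b)] and [(- b^*, - a)] with [a > 0] and
    [a ^ 2 = 1 + |b| ^ 2]. The off-diagonal entry of [K Y = Y K] reads, in modulus,
    [|b| cosh zeta |cos phi| = a |sinh zeta|], and [|b| < a].

    To exploit a member of Upsilon, enough symmetries [C] must be exhibited. For an orthogonal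
    projection [P] commuting with [S], [J] and [Rs] there is the hyperbolic rotation
    [C = J (1 + P / 4 + 3 Rs P / 4)]. The choices [P = 0] and [P = 1] show that members of Upsilon
    commute with [J] and [Rs], hence are self-adjoint; a Weyl function constant on the upper half
    plane supplies a nontrivial [P]. *)

Section ComplexFacts.
Variable R : realType.
Implicit Types z w : R[i].

Lemma conjE z : (z^*)%R = (Re z) -i* (Im z).
Proof. by case: z. Qed.

Lemma conjK z : ((z^*)^*)%R = z.
Proof. by case: z => a b; rewrite !conjE /= opprK. Qed.

Lemma conj_realE (x : R) : ((x%:C)^*)%R = x%:C.
Proof. by rewrite conjE /= oppr0. Qed.

Lemma conjN z : ((- z)^*)%R = (- (z^*))%R. Proof. exact: rmorphN. Qed.
Lemma conjM z w : ((z * w)^*)%R = ((z^*) * (w^*))%R. Proof. exact: rmorphM. Qed.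
Lemma conjV z : ((z^-1)^*)%R = ((z^*)^-1)%R. Proof. exact: fmorphV. Qed.

Lemma ImB z w : Im (z - w) = Im z - Im w. Proof. by case: z w => [? ?] [? ?]. Qed.
Lemma ImD z w : Im (z + w) = Im z + Im w. Proof. by case: z w => [? ?] [? ?]. Qed.

Lemma real_ImE z : (z \is Num.real) = (Im z == 0).
Proof. by case: z => a b; rewrite complex_real. Qed.

Lemma conj_eq_real z : (z^*)%R = z -> z \is Num.real.
Proof.
case: z => a b; rewrite conjE /= complex_real => -[] h.
by apply/eqP; lra.
Qed.

Lemma gt0_complexE z : (0 < z) = (Im z == 0) && (0 < Re z).
Proof. by rewrite ltcE. Qed.

End ComplexFacts.

Lemma linear_map_of (R : realType) (H : lmodType R[i]) (f : H -> H) :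
  (forall a x y, f (a *: x + y) = a *: f x + f y) ->
  exists T : {linear H -> H}, forall x, T x = f x.
Proof.
move=> lf.
pose L := HB.pack_for {linear H -> H} f (GRing.isLinear.Build _ _ _ _ f lf).
by exists L.
Qed.

(** * Geometry of the Hilbert space and self-adjoint operators *)

Section Hilbert.
Variables (R : realType) (H : completeNormedModType R[i]).
Variables (ip : {dot H for (@Num.conj R[i])}) (hip : inner_product ip).
Implicit Types (x y z : H) (a : R[i]).

Lemma ipC x y : ip y x = ((ip x y)^*)%R.
Proof. by rewrite hermC expr0 mul1r. Qed.
Lemma ipDl x y z : ip (x + y) z = ip x z + ip y z.
Proof. by rewrite linearDl. Qed.
Lemma ipDr x y z : ip z (x + y) = ip z x + ip z y.
Proof. by rewrite linearDr. Qed.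
Lemma ipNl x y : ip (- x) y = - ip x y.
Proof. by rewrite linearNl. Qed.
Lemma ipNr x y : ip x (- y) = - ip x y.
Proof. by rewrite linearNr. Qed.
Lemma ipBl x y z : ip (x - y) z = ip x z - ip y z.
Proof. by rewrite ipDl ipNl. Qed.
Lemma ipBr x y z : ip z (x - y) = ip z x - ip z y.
Proof. by rewrite ipDr ipNr. Qed.
Lemma ipZl a x y : ip (a *: x) y = a * ip x y.
Proof. by rewrite linearZl_LR. Qed.
Lemma ipZr a x y : ip x (a *: y) = (a^*)%R * ip x y.
Proof. by rewrite linearZr_LR. Qed.
Lemma ip0l x : ip 0 x = 0.
Proof. by rewrite linear0l. Qed.
Lemma ip0r x : ip x 0 = 0.
Proof. by rewrite linear0r. Qed.
Lemma ip_suml (n : nat) (F : 'I_n -> H) y :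
  ip (\sum_i F i) y = \sum_i ip (F i) y.
Proof. by rewrite (big_morph (fun x => ip x y) (fun u v => ipDl u v y) (ip0l y)). Qed.

Lemma ip_eq0 x : ip x x = 0 -> x = 0.
Proof. by move/eqP; rewrite dnorm_eq0 => /eqP. Qed.

Lemma ip_orthC x y : ip x y = 0 -> ip y x = 0.
Proof. by move=> h; rewrite ipC h rmorph0. Qed.

Lemma ip_ext x y : (forall z, ip x z = ip y z) -> x = y.
Proof.
move=> h; apply/eqP; rewrite -subr_eq0; apply/eqP/ip_eq0.
by rewrite ipBl h subrr.
Qed.

(** The norm of [H] takes values in [R[i]]; a real-valued version gives access to infima, square
    roots and [lra]. *)
Definition nrm x : R := Re `|x|.

Lemma nrmE x : `|x| = (nrm x)%:C.
Proof. by rewrite /nrm RRe_real // normr_real. Qed.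

Lemma nrm_ge0 x : 0 <= nrm x.
Proof. by rewrite -(ler0c (nrm x)) -nrmE. Qed.

Lemma nrm0 : nrm 0 = 0.
Proof. by rewrite /nrm normr0. Qed.

Lemma nrm_eq0 x : nrm x = 0 -> x = 0.
Proof. by move=> h; apply/normr0_eq0; rewrite nrmE h. Qed.

Lemma nrm_gt0 x : x != 0 -> 0 < nrm x.
Proof.
move=> h; rewrite lt_neqAle nrm_ge0 andbT eq_sym.
by apply: contraNneq h => /nrm_eq0 ->.
Qed.

Lemma nrmD x y : nrm (x + y) <= nrm x + nrm y.
Proof. by rewrite -lecR rmorphD /= -!nrmE ler_normD. Qed.

Lemma nrmN x : nrm (- x) = nrm x.
Proof. by rewrite /nrm normrN. Qed.

Lemma nrmBC x y : nrm (x - y) = nrm (y - x).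
Proof. by rewrite -nrmN opprB. Qed.

Lemma nrmZ a x : nrm (a *: x) = Re `|a| * nrm x.
Proof.
by apply: complexI; rewrite -nrmE normrZ rmorphM /= -nrmE.
Qed.

Lemma ip_nrm x : ip x x = (nrm x ^+ 2)%:C.
Proof. by rewrite -hip nrmE rmorphXn. Qed.

(** Used twice: nonnegativity of the left side is the Cauchy-Schwarz inequality, and in [projection]
    the amount of the decrease shows that a nearest point leaves an orthogonal remainder. *)
Lemma nrm_sub_proj x y : y != 0 ->
  nrm (x - (ip x y / ip y y) *: y) ^+ 2 =
  nrm x ^+ 2 - (Re (ip x y) ^+ 2 + Im (ip x y) ^+ 2) / nrm y ^+ 2.
Proof.
move=> y0; set a := ip x y.
have yy0 : ip y y != 0 by rewrite dnorm_eq0.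
have yyr : ((ip y y)^*)%R = ip y y by rewrite ip_nrm conj_realE.
apply: complexI; rewrite rmorphB /= -!ip_nrm.
rewrite ipBl !ipBr !ipZl !ipZr (ipC x y) -/a.
have -> : ((a / ip y y)^*)%R = (a^*)%R / ip y y by rewrite conjM conjV yyr.
rewrite rmorphM fmorphV /= add_Re2_Im2 sqr_normc -ip_nrm.
rewrite -[(a^*)%C]/((a^*)%R).
by field.
Qed.

Lemma CauchySchwarz_nrm x y : `|ip x y| <= (nrm x * nrm y)%:C.
Proof.
have [->|y0] := eqVneq y 0; first by rewrite ip0r normr0 nrm0 mulr0.
rewrite -(@ler_pXn2r _ 2) // ?nnegrE ?normr_ge0 //; last first.
  by rewrite ler0c mulr_ge0 ?nrm_ge0.
rewrite -add_Re2_Im2 -rmorphXn /= lecR exprMn.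
rewrite -ler_pdivrMr ?exprn_gt0 ?nrm_gt0 // -subr_ge0 -nrm_sub_proj //.
exact: sqr_ge0.
Qed.

(** * Sequential limits, closed subspaces and the projection theorem *)

Definition seq_lim (u : nat -> H) (l : H) : Prop :=
  forall e : R, 0 < e -> exists N, forall n, (N <= n)%N -> nrm (u n - l) < e.

Definition seq_cauchy (u : nat -> H) : Prop :=
  forall e : R, 0 < e -> exists N, forall n m, (N <= n)%N -> (N <= m)%N ->
    nrm (u n - u m) < e.

Definition seq_closed (E : set H) : Prop :=
  forall u l, (forall n, E (u n)) -> seq_lim u l -> E l.

Lemma seq_limP (u : nat -> H) l : seq_lim u l <-> u @ \oo --> l.
Proof.
split=> [h|h].
  apply/cvgrPdist_lt => e; rewrite gt0_complexE => /andP[/eqP ei er].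
  have [N hN] := h _ er; near=> n.
  rewrite distrC nrmE.
  have -> : e = (Re e)%:C by rewrite RRe_real // real_ImE ei.
  rewrite ltcR; apply: hN; near: n; exact: nbhs_infty_ge.
move=> e e0; move/cvgrPdist_lt: h => /(_ e%:C); rewrite ltcR => /(_ e0).
move=> [N _ hN]; exists N => n /hN /=; by rewrite distrC nrmE ltcR.
Unshelve. all: by end_near. Qed.

Lemma seq_complete (u : nat -> H) : seq_cauchy u -> exists l, seq_lim u l.
Proof.
move=> h; suff : cvg (u @ \oo) by move=> /cvg_ex[l hl]; exists l; apply/seq_limP.
apply: cauchy_cvg; apply/cauchy_ballP => e.
rewrite gt0_complexE => /andP[/eqP ei er].
have [N hN] := h _ er.
have eE : e = (Re e)%:C by rewrite RRe_real // real_ImE ei.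
exists (u @` [set n | (N <= n)%N], u @` [set n | (N <= n)%N]).
  by split; exists N => // n /= hn; exists n.
move=> [_ _] /= [[n hn <-] [m hm <-]].
rewrite -ball_normE /= eE nrmE ltcR; exact: hN.
Qed.

Definition linear_subspace (E : set H) : Prop :=
  E 0 /\ forall a x y, E x -> E y -> E (a *: x + y).

Lemma linear_subspaceZ E a x : linear_subspace E -> E x -> E (a *: x).
Proof. by move=> [E0 EL] Ex; rewrite -[_ *: _]addr0; exact: EL. Qed.
Lemma linear_subspaceD E x y : linear_subspace E -> E x -> E y -> E (x + y).
Proof. by move=> [E0 EL] Ex Ey; rewrite -(scale1r x); exact: EL. Qed.
Lemma linear_subspaceB E x y : linear_subspace E -> E x -> E y -> E (x - y).
Proof.
by move=> [E0 EL] Ex Ey; rewrite addrC -scaleN1r; exact: EL.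
Qed.

Lemma parallelogram x y :
  nrm (x + y) ^+ 2 + nrm (x - y) ^+ 2 = 2 * nrm x ^+ 2 + 2 * nrm y ^+ 2.
Proof.
have : ip (x + y) (x + y) + ip (x - y) (x - y) =
       ip x x + ip x x + (ip y y + ip y y).
  by rewrite ipDl ipBl !ipDr !ipNr; ring.
by rewrite !ip_nrm -!rmorphD => /complexI ->; ring.
Qed.

Lemma projection (E : set H) : linear_subspace E -> seq_closed E ->
  forall x, exists p, E p /\ forall y, E y -> ip (x - p) y = 0.
Proof.
move=> Esub Ecl x; have [E0 EL] := Esub.
pose D := [set nrm (x - y) ^+ 2 | y in E].
have hD : has_inf D.
  split; first by exists (nrm (x - 0) ^+ 2); exists 0.
  by exists 0 => _ [y _ <-]; rewrite sqr_ge0.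
pose d := inf D.
have dle y : E y -> d <= nrm (x - y) ^+ 2.
  by move=> Ey; apply: ge_inf => //; [case: hD|exists y].
have /choice[u hu] : forall n : nat, exists y, E y /\
    nrm (x - y) ^+ 2 < d + n.+1%:R^-1.
  move=> n; have n0 : 0 < n.+1%:R^-1 :> R by rewrite invr_gt0 ltr0n.
  by have [_ [y Ey <-] hy] := inf_adherent n0 hD; exists y.
have cau : seq_cauchy u.
  move=> e e0.
  have e20 : 0 < e ^+ 2 / 4 by rewrite divr_gt0 ?exprn_gt0.
  (* Beyond this index the excess [1 / (k + 1)] over [d] is below [e ^ 2 / 4]; the midpoint of [u n]
     and [u m] has squared distance at least [d], so the parallelogram law bounds the squared gap by
     [e ^ 2]. *)
  exists (Num.truncn ((e ^+ 2 / 4)^-1)).+1 => n m hn hm.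
  have key k : (Num.truncn ((e ^+ 2 / 4)^-1) < k)%N ->
      k.+1%:R^-1 < e ^+ 2 / 4 :> R.
    move=> hk; rewrite -[ltRHS]invrK ltf_pV2 ?posrE ?invr_gt0 ?ltr0n //.
    apply: (lt_le_trans (truncnS_gt _)).
    by rewrite ler_nat ltnW.
  have mid : E (2^-1 *: (u n + u m)).
    by apply: linear_subspaceZ => //; apply: linear_subspaceD => //; [case: (hu n)|case: (hu m)].
  have hmid := dle _ mid.
  have [_ hn2] := hu n; have [_ hm2] := hu m.
  have := parallelogram (x - u n) (x - u m).
  have -> : x - u n + (x - u m) = 2 *: (x - 2^-1 *: (u n + u m)).
    rewrite scalerBr scalerA divff ?scale1r; last by rewrite pnatr_eq0.
    rewrite scaler_nat mulr2n opprD !addrA; congr (_ + _).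
    by rewrite -!addrA; congr (_ + _); rewrite addrC.
  have -> : x - u n - (x - u m) = u m - u n.
    by rewrite opprB addrC addrA subrK.
  rewrite nrmZ (_ : Re `|2| = 2); last by rewrite normr_nat.
  rewrite (nrmBC (u m)) => par.
  have kn := key _ hn; have km := key _ hm.
  have h0 := nrm_ge0 (u n - u m).
  rewrite -(@ltr_pXn2r _ 2) ?nnegrE // ?ltW //.
  rewrite exprMn (_ : 2 ^+ 2 = 4 :> R) in par; last by rewrite -natrX.
  move: par kn km hn2 hm2 hmid; clear.
  set a1 := nrm _ ^+ 2; set a2 := nrm _ ^+ 2; set a3 := nrm _ ^+ 2; set a4 := nrm _ ^+ 2.
  set k1 := n.+1%:R^-1; set k2 := m.+1%:R^-1; set e2 := e ^+ 2.
  by move=> *; lra.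
have [p hp] := seq_complete cau.
have Ep : E p by apply: Ecl hp => n; case: (hu n).
exists p; split => // y Ey.
have [->|y0] := eqVneq y 0; first by rewrite ip0r.
have pmin : nrm (x - p) ^+ 2 <= d.
  apply/ler_addgt0Pr => e e0.
  set c := nrm (x - p).
  have c0 : 0 <= c by exact: nrm_ge0.
  have d0 : 0 <= d by apply: lb_le_inf; [case: hD|move=> _ [z _ <-]; rewrite sqr_ge0].
  rewrite leNgt; apply/negP => hlt.
  (* A radius strictly between the square root of [d] and [c]: far terms of the sequence are within
     [s] of [x] and within [c - s] of [p], against the triangle inequality. *)
  pose s := Num.sqrt (d + e / 2).
  have s2 : s ^+ 2 = d + e / 2 by rewrite sqr_sqrtr //; lra.
  have s0 : 0 <= s by exact: sqrtr_ge0.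
  have sc : s < c by rewrite -(@ltr_pXn2r _ 2) ?nnegrE // s2; lra.
  have cs : 0 < c - s by lra.
  have [N hN] := hp _ cs.
  pose k := maxn N (Num.truncn ((e / 2)^-1)).+1.
  have [_ hk] := hu k.
  have ke : k.+1%:R^-1 < e / 2 :> R.
    rewrite -[ltRHS]invrK ltf_pV2 ?posrE ?invr_gt0 ?ltr0n //; last by lra.
    apply: (lt_le_trans (truncnS_gt _)).
    by rewrite ler_nat /k ltnW // ltnS leq_maxr.
  have h1 : nrm (x - u k) < s.
    by rewrite -(@ltr_pXn2r _ 2) ?nnegrE ?nrm_ge0 // s2 (lt_trans hk) // ltrD2l.
  have h2 := hN k (leq_maxl _ _).
  have h3 := nrmD (x - u k) (u k - p).
  have e3 : x - u k + (u k - p) = x - p by rewrite addrA subrK.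
  by rewrite e3 -/c in h3; lra.
set a := ip (x - p) y.
(* Moving [p] by [b *: y] stays in [E] and would lower the squared distance by [|a| ^ 2 / |y| ^ 2],
   so [a = 0]. *)
pose b := a / ip y y.
have hb := dle _ (EL b _ _ Ey Ep).
have e1 : nrm (x - (b *: y + p)) ^+ 2 =
    nrm (x - p) ^+ 2 - (Re a ^+ 2 + Im a ^+ 2) / nrm y ^+ 2.
  by rewrite -nrm_sub_proj //; congr (nrm _ ^+ 2); rewrite opprD addrCA addrC.
have : (Re a ^+ 2 + Im a ^+ 2) / nrm y ^+ 2 <= 0 by lra.
have y2 : 0 < nrm y ^+ 2 by rewrite exprn_gt0 // nrm_gt0.
rewrite pmulr_lle0 ?invr_gt0 // => h.
have h1 := sqr_ge0 (Re a); have h2 := sqr_ge0 (Im a).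
have /eqP : Re a ^+ 2 = 0 by lra.
have /eqP : Im a ^+ 2 = 0 by lra.
rewrite !sqrf_eq0 => /eqP i0 /eqP r0.
by rewrite (complexE a) i0 r0 rmorph0 mulr0 addr0.
Qed.

Lemma Re_norm_ge0 a : 0 <= Re `|a|.
Proof. by rewrite -ler0c RRe_real ?normr_real. Qed.

Lemma Re_norm_eq0 a : Re `|a| = 0 -> a = 0.
Proof. by move=> h; apply/normr0_eq0; rewrite -[LHS]RRe_real ?normr_real // h. Qed.

Lemma CauchySchwarz_Re x y : Re `|ip x y| <= nrm x * nrm y.
Proof. by rewrite -lecR RRe_real ?normr_real // CauchySchwarz_nrm. Qed.

Lemma Re_normD (a b : R[i]) : Re `|a + b| <= Re `|a| + Re `|b|.
Proof. exact: le_normcD. Qed.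

Lemma Re_normN a : Re `|- a| = Re `|a|.
Proof. by rewrite normrN. Qed.

Lemma Im_le_norm a : `|Im a| <= Re `|a|.
Proof.
rewrite normc_def /= -[leLHS]sqrtr_sqr ler_sqrt ?addr_ge0 ?sqr_ge0 //.
by rewrite lerDr sqr_ge0.
Qed.

Lemma eq0_approx a : (forall e : R, 0 < e -> Re `|a| <= e) -> a = 0.
Proof.
move=> h; apply: Re_norm_eq0; apply/eqP; rewrite eq_le Re_norm_ge0 andbT.
by apply/ler_addgt0Pr => e e0; rewrite add0r; exact: h.
Qed.

(** [|(z, z)| = |(x - z, z)|] for every [x] in [E], and the right side can be made arbitrarily
    small. Serves both dense domains and dense spans. *)
Lemma approx_orth (E : set H) z :
  (forall e : R, 0 < e -> exists x, E x /\ nrm (x - z) < e) ->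
  (forall x, E x -> ip x z = 0) -> z = 0.
Proof.
move=> h E0; apply: ip_eq0; apply: eq0_approx => e e0.
have k0 : 0 < nrm z + 1 by rewrite ltr_wpDl ?nrm_ge0.
have [x [Ex hx]] := h (e / (nrm z + 1)) (divr_gt0 e0 k0).
have -> : ip z z = - ip (x - z) z by rewrite ipBl (E0 _ Ex) add0r opprK.
rewrite Re_normN; apply: le_trans (CauchySchwarz_Re _ _) _.
apply: (@le_trans _ _ (e / (nrm z + 1) * (nrm z + 1))).
  by apply: ler_pM; rewrite ?nrm_ge0 ?lerDl // ltW.
by rewrite divfK // gt_eqF.
Qed.

Lemma nbhs_nrm z (e : R) : 0 < e -> nbhs z [set x | nrm (x - z) < e].
Proof.
move=> e0; apply/nbhs_ballP; exists e%:C => /=; first by rewrite ltcR.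
by move=> x; rewrite -ball_normE /= distrC nrmE ltcR.
Qed.

Lemma densely_defined_orth (A : set (H * H)) z :
  densely_defined A -> (forall p, A p -> ip p.1 z = 0) -> z = 0.
Proof.
move=> dA h; apply: (@approx_orth (op_domain A)) => [e e0|x [y /h //]].
have hn := nbhs_nrm z e0.
have [x [hx dx]] := dA (interior [set x | nrm (x - z) < e])
  (ex_intro _ z hn) (@open_interior _ _).
by exists x; split=> //; exact: interior_subset hx.
Qed.

Lemma dense_span_orth (E : set H) z :
  closure (linear_span E) = setT -> (forall x, E x -> ip x z = 0) -> z = 0.
Proof.
move=> hE h; apply: (@approx_orth (linear_span E)) => [e e0|_ [n [c [v [hv ->]]]]].
  have : closure (linear_span E) z by rewrite hE.
  by move=> /(_ _ (nbhs_nrm z e0)) [x [sx hx]]; exists x.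
by rewrite ip_suml big1 // => i _; rewrite ipZl h ?mulr0.
Qed.

(** * Adjoints, closed graphs and resolvents *)

Implicit Types (A B : set (H * H)) (T : {linear H -> H}).

Lemma adjointE A x y : adjoint ip A (x, y) <-> forall s t, A (s, t) -> ip t x = ip s y.
Proof. by split=> [h s t /h //|h [s t] /h]. Qed.

Lemma adjoint_graph A x y s t : adjoint ip A (x, y) -> A (s, t) -> ip t x = ip s y.
Proof. by move=> /adjointE h /h. Qed.

Lemma adjoint0 A : adjoint ip A (0, 0).
Proof. by move=> p _; rewrite !ip0r. Qed.

Lemma adjoint_lin A a p q : adjoint ip A p -> adjoint ip A q ->
  adjoint ip A (a *: p.1 + q.1, a *: p.2 + q.2).
Proof. by move=> hp hq s As; rewrite /= !ipDr !ipZr hp ?hq. Qed.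

Lemma adjoint_operator A : densely_defined A -> is_operator (adjoint ip A).
Proof.
move=> dA; split; [exact: adjoint0|by move=> *; exact: adjoint_lin|].
move=> x y z hy hz; apply/eqP; rewrite -subr_eq0; apply/eqP.
apply: (densely_defined_orth dA) => p Ap; rewrite ipBr.
by rewrite -(hy _ Ap) -(hz _ Ap) subrr.
Qed.

Lemma operator_sub A x y s t : is_operator A -> A (x, y) -> A (s, t) ->
  A (x - s, y - t).
Proof.
move=> [_ lA _] h k; have := lA (-1) _ _ k h.
by rewrite /= !scaleN1r ![- _ + _]addrC.
Qed.

Lemma operator_add A x y s t : is_operator A -> A (x, y) -> A (s, t) ->
  A (x + s, y + t).
Proof. by move=> [_ lA _] h k; have := lA 1 _ _ h k; rewrite /= !scale1r. Qed.

Lemma operator_scale A a x y : is_operator A -> A (x, y) -> A (a *: x, a *: y).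
Proof. by move=> [A0 lA _] h; have := lA a _ _ h A0; rewrite /= !addr0. Qed.

Lemma operator_sum A n (c : 'I_n -> R[i]) (v w : 'I_n -> H) : is_operator A ->
  (forall i, A (v i, w i)) -> A (\sum_i c i *: v i, \sum_i c i *: w i).
Proof.
move=> hA h; elim: n c v w h => [|n IH] c v w h.
  by rewrite !big_ord0; case: hA.
rewrite !big_ord_recl; apply: operator_add => //; first exact: operator_scale.
by apply: (IH (fun i => c (lift ord0 i))) => i; exact: h.
Qed.

Definition graph_closed A : Prop :=
  forall u v x y, (forall n, A (u n, v n)) -> seq_lim u x -> seq_lim v y ->
  A (x, y).

Lemma closed_graph_closed A : closed A -> graph_closed A.
Proof.
move=> cA u v x y h /seq_limP hu /seq_limP hv.
have hc : (fun n => (u n, v n)) @ \oo --> (x, y) by exact: cvg_pair.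
refine (@closed_cvg _ _ _ _ (fun n => (u n, v n)) A cA _ (x, y) hc).
exact: nearW.
Qed.

Lemma ip_lim_eq (a b : H) u v x y : (forall n, ip a (u n) = ip b (v n)) ->
  seq_lim u x -> seq_lim v y -> ip a x = ip b y.
Proof.
move=> h hu hv; apply/eqP; rewrite -subr_eq0; apply/eqP.
apply: eq0_approx => e e0.
pose k := nrm a + nrm b + 1.
have k0 : 0 < k by rewrite ltr_wpDl ?addr_ge0 ?nrm_ge0.
have [N hN] := hu _ (divr_gt0 e0 k0).
have [M hM] := hv _ (divr_gt0 e0 k0).
have h1 := hN (maxn N M) (leq_maxl _ _).
have h2 := hM (maxn N M) (leq_maxr _ _).
set n := maxn N M in h1 h2.
have -> : ip a x - ip b y = - ip a (u n - x) + ip b (v n - y).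
  by rewrite !ipBr h; ring.
apply: le_trans (Re_normD _ _) _; rewrite Re_normN.
apply: (@le_trans _ _ (nrm a * (e / k) + nrm b * (e / k))).
  apply: lerD; apply: le_trans (CauchySchwarz_Re _ _) _;
    by rewrite ler_wpM2l ?nrm_ge0 // ltW.
by rewrite -mulrDl mulrA ler_pdivrMr // mulrC ler_wpM2l ?(ltW e0) // /k lerDl.
Qed.

Lemma adjoint_graph_closed A : graph_closed (adjoint ip A).
Proof.
move=> u v x y h hu hv; apply/adjointE => s t Ast.
by apply: ip_lim_eq hu hv => n; have /adjointE := h n; exact.
Qed.

Lemma bounded_nrm T : bounded_operator T <->
  exists c : R, forall x, nrm (T x) <= c * nrm x.
Proof.
split=> [[c h]|[c h]]; exists c => x.
  by have := h x; rewrite !nrmE -rmorphM /= lecR.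
by rewrite !nrmE -rmorphM /= lecR.
Qed.

Lemma bounded_nrm_pos T : bounded_operator T ->
  exists2 c : R, 0 < c & forall x, nrm (T x) <= c * nrm x.
Proof.
move=> /bounded_nrm[c hc]; exists (`|c| + 1); first by rewrite ltr_wpDl.
move=> x; apply: (le_trans (hc x)); rewrite ler_wpM2r ?nrm_ge0 //.
by rewrite ler_wpDr // ler_norm.
Qed.

Lemma resolvent_setP A mu : is_operator A -> resolvent_set A mu <->
  exists T, [/\ bounded_operator T,
    forall h, A (T h, h + mu *: T h) &
    forall x, A (x, mu *: x) -> x = 0].
Proof.
move=> oA; split=> [[T [bT eT]]|[T [bT h1 h2]]]; exists T.
  have e x y : A (y, x + mu *: y) <-> y = T x.
    have := congr1 (fun E : set (H * H) => E (x, y)) eT.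
    by rewrite /op_inverse /op_shift /op_graph /= => ->.
  split=> // [h|x hx]; first by apply/e.
  by rewrite -[RHS](linear0 T); apply/e; rewrite add0r.
split=> //; apply/seteqP; split=> [[x y]|[x y]];
  rewrite /op_inverse /op_shift /op_graph /=; last by move=> ->.
move=> h; apply/eqP; rewrite -subr_eq0; apply/eqP/h2.
have := operator_sub oA h (h1 x).
by rewrite opprD addrACA subrr add0r -scalerBr.
Qed.

Definition shift_range A mu : set H := [set h | exists x, A (x, h + mu *: x)].

Lemma shift_range_subspace A mu : is_operator A -> linear_subspace (shift_range A mu).
Proof.
move=> oA; have [A0 lA _] := oA; split.
  by exists 0; rewrite scaler0 addr0.
move=> a x y [s hs] [t ht]; exists (a *: s + t).
have := lA a _ _ hs ht => /=; congr (A (_, _)).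
by rewrite !scalerDr !scalerA (mulrC mu) addrACA.
Qed.

(** The lower bound turns a convergent sequence in the range into a Cauchy sequence of preimages;
    the closed graph then contains the limit pair. *)
Lemma shift_range_closed A mu (c : R) : is_operator A -> graph_closed A -> 0 < c ->
  (forall x y, A (x, y) -> c * nrm x <= nrm (y - mu *: x)) ->
  seq_closed (shift_range A mu).
Proof.
move=> oA cA c0 hc u l hu hl.
have /choice[s hs] : forall n, exists x, A (x, u n + mu *: x) by [].
have cs : seq_cauchy s.
  move=> e e0.
  have [N hN] := hl (c * e / 2) (divr_gt0 (mulr_gt0 c0 e0) (ltr0Sn _ 1)).
  exists N => n m hn hm.
  have := hc _ _ (operator_sub oA (hs n) (hs m)).
  rewrite scalerBr opprD addrACA addrK => h.
  have h3 := nrmD (u n - l) (l - u m); rewrite addrA subrK in h3.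
  have h1 := hN n hn; have h2 := hN m hm; rewrite (nrmBC l) in h3.
  rewrite -(ltr_pM2l c0) //; lra.
have [x hx] := seq_complete cs; exists x.
apply: (cA s (fun n => u n + mu *: s n)) => //.
move=> e e0.
have k0 : 0 < Re `|mu| + 1 by rewrite ltr_wpDl // Re_norm_ge0.
have [N hN] := hl (e / 2) (divr_gt0 e0 (ltr0Sn _ 1)).
have [M hM] := hx (e / 2 / (Re `|mu| + 1)) (divr_gt0 (divr_gt0 e0 (ltr0Sn _ 1)) k0).
exists (maxn N M) => n; rewrite geq_max => /andP[/hN h1 /hM h2].
rewrite opprD addrACA -scalerBr.
apply: le_lt_trans (nrmD _ _) _; rewrite nrmZ.
rewrite [ltRHS](_ : e = e / 2 + e / 2); last by field.
apply: ltr_leD => //; apply: (@le_trans _ _ ((Re `|mu| + 1) * (e / 2 / (Re `|mu| + 1)))).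
  by apply: ler_pM; rewrite ?nrm_ge0 ?Re_norm_ge0 ?lerDl // ltW.
by rewrite mulrC divfK // gt_eqF.
Qed.

(** As [(A x, x)] is real, the imaginary part of [((A - mu) x, x)] is [- Im mu |x| ^ 2];
    Cauchy-Schwarz bounds it. *)
Lemma symmetric_nonreal_bound A mu x y : A `<=` adjoint ip A -> A (x, y) ->
  `|Im mu| * nrm x <= nrm (y - mu *: x).
Proof.
move=> sA Axy.
have e : ip y x = ip x y by apply: (adjoint_graph (sA _ Axy)).
have r : Im (ip y x) = 0.
  by apply/eqP; rewrite -real_ImE; apply: conj_eq_real; rewrite -ipC.
have h : `|Im mu| * nrm x ^+ 2 <= nrm (y - mu *: x) * nrm x.
  apply: le_trans (CauchySchwarz_Re _ _); apply: le_trans (Im_le_norm _).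
  rewrite ipBl ipZl ip_nrm ImB r sub0r normrN.
  case: (mu) => p q /=; rewrite mulr0 add0r normrM.
  by rewrite (ger0_norm (sqr_ge0 _)).
have [->|x0] := eqVneq x 0; first by rewrite nrm0 mulr0 nrm_ge0.
by rewrite -(ler_pM2r (nrm_gt0 x0)) -mulrA -expr2.
Qed.

(** The range of [A - mu] is closed by the lower bound, and its orthogonal complement lies in the
    kernel of [A - mu^*], which is trivial. The explicit bound [c^-1] is kept because later limits
    need it uniformly. *)
Lemma selfadjoint_resolvent A mu (c : R) : is_operator A -> selfadjoint ip A ->
  0 < c -> (forall x y, A (x, y) -> c * nrm x <= nrm (y - mu *: x)) ->
  (forall x, A (x, (mu^*)%R *: x) -> x = 0) ->
  exists T, [/\ forall h, nrm (T h) <= c^-1 * nrm h,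
    forall h, A (T h, h + mu *: T h) &
    forall x, A (x, mu *: x) -> x = 0].
Proof.
move=> oA saA c0 hc hk.
have cA : graph_closed A by rewrite -saA; exact: adjoint_graph_closed.
have inj x : A (x, mu *: x) -> x = 0.
  move=> /hc; rewrite subrr nrm0 pmulr_rle0 // => h.
  by apply: nrm_eq0; apply/eqP; rewrite eq_le h nrm_ge0.
have surj h : shift_range A mu h.
  have [p [Rp hp]] := projection (shift_range_subspace mu oA)
    (shift_range_closed oA cA c0 hc) h.
  suff -> : h = p by [].
  apply/eqP; rewrite -subr_eq0; apply/eqP; apply: hk.
  rewrite -{1}saA; apply/adjointE => s t Ast; rewrite ipZr conjK.
  have Rst : shift_range A mu (t - mu *: s) by exists s; rewrite subrK.
  have := ip_orthC (hp _ Rst); rewrite ipBl ipZl => /eqP.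
  by rewrite subr_eq0 => /eqP.
have /choice[t ht] := surj.
have lt a x y : t (a *: x + y) = a *: t x + t y.
  apply/eqP; rewrite -subr_eq0; apply/eqP/inj.
  have [_ lA _] := oA.
  have := operator_sub oA (ht (a *: x + y)) (lA a _ _ (ht x) (ht y)).
  congr (A (_, _)) => /=.
  by apply: ip_ext => z; rewrite !(ipDl, ipNl, ipZl); ring.
have [T hT] := linear_map_of lt; exists T.
split=> // h; rewrite hT //.
rewrite ler_pdivlMl //; apply: le_trans (hc _ _ (ht h)) _.
by rewrite addrK.
Qed.

End Hilbert.

(* A vector identity can be tested against the inner product, which turns it
   into a scalar one. *)
Ltac vec ip := apply: (ip_ext (ip := ip)) => ?;
  rewrite ?(ipDl, ipNl, ipZl, ip0l); ring.

Section Bounded.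
Variables (R : realType) (H : completeNormedModType R[i]).
Variables (ip : {dot H for (@Num.conj R[i])}) (hip : inner_product ip).

Definition bounded_map (F : H -> H) : Prop :=
  exists c : R, forall x, nrm (F x) <= c * nrm x.

Lemma bounded_mapD F F' : bounded_map F -> bounded_map F' ->
  bounded_map (fun x => F x + F' x).
Proof.
move=> [c h] [c' h']; exists (c + c') => x.
by apply: le_trans (nrmD _ _) _; rewrite mulrDl lerD.
Qed.

Lemma bounded_map_comp F F' : bounded_map F -> bounded_map F' ->
  bounded_map (F \o F').
Proof.
move=> [c h] [c' h']; exists (`|c| * c') => x /=.
apply: le_trans (h _) _; apply: (@le_trans _ _ (`|c| * nrm (F' x))).
  by rewrite ler_wpM2r ?nrm_ge0 // ler_norm.
by rewrite -mulrA ler_wpM2l.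
Qed.

Lemma bounded_mapZ (a : R[i]) F : bounded_map F -> bounded_map (fun x => a *: F x).
Proof.
move=> [c h]; exists (Re `|a| * c) => x.
by rewrite nrmZ -mulrA ler_wpM2l // Re_norm_ge0.
Qed.

Lemma bounded_map_rank1 (g f : H) : bounded_map (fun x => ip x g *: f).
Proof.
exists (nrm g * nrm f) => x; rewrite nrmZ mulrAC ler_wpM2r ?nrm_ge0 //.
by rewrite mulrC (CauchySchwarz_Re hip).
Qed.

End Bounded.

Lemma op_kernel_shift (R : realType) (H : completeNormedModType R[i])
  (A : set (H * H)) (z : R[i]) (x : H) :
  op_kernel (op_shift A z) x <-> A (x, z *: x).
Proof. by rewrite /op_kernel /op_shift /= add0r. Qed.

(** * Quadratic polynomials and determinants of size two *)

Section Quadratic.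
Variable R : realType.

Lemma Re_normM (a b : R[i]) : Re `|a * b| = Re `|a| * Re `|b|.
Proof.
rewrite normrM -[`|a|]RRe_real ?normr_real // -[`|b|]RRe_real ?normr_real //.
by rewrite -rmorphM.
Qed.

(** The polynomial is [(w - w0) (al (w - w0) + b)] with [b] its derivative at [w0]. For [b = 0] the
    coefficient [al] cannot vanish; otherwise the second factor is nonzero while
    [|al| |w - w0| < |b|]. *)
Lemma quadratic_root_isolated (al be ga w0 : R[i]) :
  (exists w, al * w ^+ 2 + be * w + ga != 0) ->
  al * w0 ^+ 2 + be * w0 + ga = 0 ->
  exists2 d : R, 0 < d & forall w, w != w0 -> Re `|w - w0| < d ->
    al * w ^+ 2 + be * w + ga != 0.
Proof.
move=> [w1 hw1] h0.
have e w : al * w ^+ 2 + be * w + ga =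
    (w - w0) * (al * (w - w0) + (2 * al * w0 + be)).
  by rewrite -[LHS]subr0 -h0; ring.
set b := 2 * al * w0 + be in e.
have [b0|b0] := eqVneq b 0.
  exists 1 => // w ww0 _; rewrite e b0 addr0 mulf_neq0 ?subr_eq0 // mulf_neq0 ?subr_eq0 //.
  by apply: contraNneq hw1 => al0; rewrite e b0 al0 mul0r addr0 mulr0.
have k0 : 0 < Re `|al| + 1 by rewrite ltr_wpDl // Re_norm_ge0.
have bp : 0 < Re `|b|.
  rewrite lt_neqAle Re_norm_ge0 andbT eq_sym; apply: contraNneq b0.
  by move=> /Re_norm_eq0 ->.
exists (Re `|b| / (Re `|al| + 1)); first exact: divr_gt0.
move=> w ww0; rewrite ltr_pdivlMr // => hd.
rewrite e mulf_neq0 ?subr_eq0 //; apply/eqP => h.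
have {}h : b = - (al * (w - w0)) by apply/eqP; rewrite -addr_eq0 addrC; apply/eqP.
move: hd; apply/negP; rewrite -leNgt h Re_normN Re_normM mulrC.
by rewrite ler_wpM2l ?Re_norm_ge0 // lerDl.
Qed.

Lemma det_mx2 (A : 'M[R[i]]_2) : \det A = A 0 0 * A 1 1 - A 0 1 * A 1 0.
Proof.
rewrite (expand_det_row _ 0) !big_ord_recl big_ord0 addr0 /cofactor !det_mx11 !mxE /=.
rewrite expr0 mul1r expr1 mulN1r mulrN.
by congr (_ * A _ _ - A _ _ * A _ _); apply/val_inj.
Qed.

End Quadratic.

(** With [a] and [b] two values of the Weyl function, any pair of boundary values is realized by a
    sum of elements of two kernels of [S^* - z]; this decomposes the domain of [S^*] modulo that of
    [S]. *)
Lemma two_point_decomposition (R : realType) (K : lmodType R[i]) (a b : R[i])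
  (u v : K) : a != b -> exists w1 w2, u = w1 + w2 /\ v = a *: w1 + b *: w2.
Proof.
rewrite eq_sym -subr_eq0 => ba.
exists (u - (b - a)^-1 *: (v - a *: u)), ((b - a)^-1 *: (v - a *: u)).
rewrite subrK; split=> //.
rewrite scalerBr addrAC -addrA -scalerBl scalerA divff // scale1r addrC subrK //.
Qed.

(** * Operators commuting with a given one *)

Section Intertwining.
Variables (R : realType) (H : completeNormedModType R[i]).
Variables (ip : {dot H for (@Num.conj R[i])}).
Implicit Types (A S : set (H * H)) (T J C : {linear H -> H}).

(** Only the inclusion of [T A] in [A T], which passes easily to compositions and adjoints; for an
    involution it amounts to [commutes]. *)
Definition intertwines A (T : H -> H) : Prop :=
  forall x y, A (x, y) -> A (T x, T y).

Lemma commutes_intertwines A (T : H -> H) : commutes A T -> intertwines A T.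
Proof.
move=> h x y Axy.
have : opcomp (op_graph T) A (x, T y) by exists y.
by rewrite -h => -[z []]; rewrite /op_graph /= => ->.
Qed.

Lemma intertwines_commutes A (T : H -> H) : (forall x, T (T x) = x) ->
  intertwines A T -> commutes A T.
Proof.
move=> TT h; apply/seteqP; split=> [[x y] [z []]|[x y] [z []]].
  rewrite /op_graph /= => -> Ay.
  by exists (T y); split; [have := h _ _ Ay; rewrite TT|rewrite /op_graph /= TT].
rewrite /op_graph /= => Axz ->.
by exists (T x); split=> //; exact: h.
Qed.

Lemma intertwines_comp A (T T' : H -> H) : intertwines A T -> intertwines A T' ->
  intertwines A (fun x => T (T' x)).
Proof. by move=> h h' x y /h'/h. Qed.

Lemma intertwines_adjoint A (T T' : H -> H) :
  (forall x y, ip (T x) y = ip x (T' y)) -> intertwines A T ->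
  intertwines (adjoint ip A) T'.
Proof.
move=> TT h x y /adjointE hx; apply/adjointE => s t Ast.
by rewrite -!TT; apply: hx; exact: h.
Qed.

Lemma selfadjoint_graphP T : selfadjoint ip (op_graph T) <->
  forall x y, ip (T x) y = ip x (T y).
Proof.
split=> [h x y|h].
  have : op_graph T (y, T y) by [].
  by rewrite -h => /(_ (x, T x)); apply.
apply/seteqP; split=> [[x y] hq|[x y]]; rewrite /op_graph /=.
  apply: (ip_ext (ip := ip)) => z; rewrite (ipC ip z) (ipC ip z (T x)).
  congr (_^*)%R; rewrite -h; symmetry.
  exact: (hq (z, T z)).
by move=> -> [s t] /= ->; rewrite h.
Qed.

(** Since [J C] is self-adjoint, [C] is the adjoint of [J C J]; the latter preserves the graph of
    [S], so [C] preserves that of the adjoint of [S]. *)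
Lemma stable_C_symmetryP J S C : fundamental_symmetry ip J -> intertwines S J ->
  stable_C_symmetry ip J S C ->
  [/\ forall x, C (C x) = x, forall x y, ip (J (C x)) y = ip x (J (C y)),
      forall x, x != 0 -> 0 < ip (J (C x)) x, intertwines S C &
      intertwines (adjoint ip S) C].
Proof.
move=> [_ /selfadjoint_graphP Js JJ] SJ [_ CC /selfadjoint_graphP JCs Cp /commutes_intertwines SC].
split=> //.
apply: (@intertwines_adjoint _ (fun x => J (C (J x)))) => [x y|].
  by rewrite (JCs (J x) y) Js JJ.
by apply: intertwines_comp => //; exact: intertwines_comp.
Qed.

(* [JC] is the inner product in which the operators commuting with [C] become
   symmetric. *)
Lemma Sigma_C_symmetric J S A C : fundamental_symmetry ip J ->
  Sigma ip J S A -> commutes A C -> forall x y x' y', A (x, y) -> A (x', y') ->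
  ip y (J (C x')) = ip x (J (C y')).
Proof.
move=> [_ _ JJ] [_ _ [_ hA]] /commutes_intertwines AC x y x' y' Axy /AC ACC.
have : opcomp (op_graph J) A (C x', J (C y')) by exists (C y').
by rewrite -hA => -[z []]; rewrite /op_graph /= => -> /adjointE h; exact: h.
Qed.

End Intertwining.

(** * Orthogonal projections and the symmetries built from them *)

Section ProjectedSymmetry.
Variables (R : realType) (H : completeNormedModType R[i]).
Variables (ip : {dot H for (@Num.conj R[i])}) (hip : inner_product ip).

Lemma orthogonal_projection (E : set H) : linear_subspace E -> seq_closed E ->
  exists P : {linear H -> H}, [/\ bounded_map P, forall x, E (P x),
    forall x y, E y -> ip (x - P x) y = 0,
    forall x y, ip (P x) y = ip x (P y) & forall x, P (P x) = P x].
Proof.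
move=> Es Ec.
have /choice[p hp] := projection hip Es Ec.
have pE x : E (p x) by case: (hp x).
have po x y : E y -> ip (x - p x) y = 0 by case: (hp x) => _; exact.
(* The orthogonality of the remainder characterizes the projected point; linearity and idempotence
   are read off from this. *)
have uniq x y : E y -> (forall t, E t -> ip (x - y) t = 0) -> p x = y.
  move=> Ey hy; apply/eqP; rewrite -subr_eq0; apply/eqP/(ip_eq0 (ip := ip)).
  have Ed : E (p x - y) by exact: linear_subspaceB.
  rewrite {1}(_ : p x - y = (x - y) - (x - p x)); last by vec ip.
  by rewrite ipBl hy // po // subrr.
have lp a x y : p (a *: x + y) = a *: p x + p y.
  apply: uniq; first by case: Es => _; apply.
  move=> t Et; rewrite (_ : _ - _ = a *: (x - p x) + (y - p y)); last by vec ip.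
  by rewrite ipDl ipZl !po // mulr0 addr0.
have [P hP] := linear_map_of lp.
have sym x y : ip (P x) y = ip x (P y).
  have l s t : ip (P s) t = ip (P s) (P t).
    apply/eqP; rewrite -subr_eq0 -ipBr !hP; apply/eqP/ip_orthC; exact: po.
  by rewrite [RHS]ipC (l y x) -ipC; exact: l.
have idem x : P (P x) = P x.
  by rewrite !hP; apply: uniq => // t Et; rewrite subrr ip0l.
exists P; split=> // [|x|x y Ey]; [|by rewrite hP|by rewrite hP; exact: po].
exists 1 => x; rewrite mul1r.
have [->|Px0] := eqVneq (P x) 0; first by rewrite nrm0 nrm_ge0.
have h := CauchySchwarz_Re hip x (P x).
have e2 : ip x (P x) = (nrm (P x) ^+ 2)%:C by rewrite -(ip_nrm hip) sym idem.
rewrite e2 normc_def /= expr0n addr0 sqrtr_sqr ger0_norm ?sqr_ge0 // in h.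
by rewrite -(ler_pM2r (nrm_gt0 Px0)) -expr2.
Qed.

Variables (J Rs : {linear H -> H}) (S : set (H * H)).
Hypotheses (hJ : fundamental_symmetry ip J) (hRs : fundamental_symmetry ip Rs).
Hypotheses (hJRs : anticommute J Rs) (oS : is_operator S).
Hypotheses (SJ : intertwines S J) (SR : intertwines S Rs).

Lemma symmetry_sym (T : {linear H -> H}) x y : fundamental_symmetry ip T ->
  ip (T x) y = ip x (T y).
Proof. by case=> _ /selfadjoint_graphP h _; exact: h. Qed.

Lemma symmetry_invol (T : {linear H -> H}) x : fundamental_symmetry ip T ->
  T (T x) = x.
Proof. by case. Qed.

Lemma anticommuteE x : J (Rs x) = - Rs (J x).
Proof. by apply/eqP; rewrite -addr_eq0; apply/eqP; exact: hJRs. Qed.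

(* [C] is [5/4 J + 3/4 J R] on the range of [P]; as [5/4 = cosh (ln 2)] and
   [3/4 = sinh (ln 2)], its square is the identity. *)
Lemma projected_C_stable (P : {linear H -> H}) : bounded_map P ->
  (forall x, P (P x) = P x) -> (forall x y, ip (P x) y = ip x (P y)) ->
  (forall x, P (J x) = J (P x)) -> (forall x, P (Rs x) = Rs (P x)) ->
  intertwines S P ->
  exists C, stable_C_symmetry ip J S C /\
    forall x, C x = J x + 4^-1 *: J (P x) + (3 / 4) *: J (Rs (P x)).
Proof.
move=> Pb Pi Ps PJ PR SP.
pose F x := J x + 4^-1 *: J (P x) + (3 / 4) *: J (Rs (P x)).
have lF a x y : F (a *: x + y) = a *: F x + F y.
  by rewrite /F !linearD !linearZ; vec ip.
have [C hC] := linear_map_of lF; exists C; split; last exact: hC.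
have JJ x := symmetry_invol x hJ; have RR x := symmetry_invol x hRs.
have Js x y := symmetry_sym x y hJ; have Rsy x y := symmetry_sym x y hRs.
have JC x : J (C x) = x + 4^-1 *: P x + (3 / 4) *: Rs (P x).
  by rewrite hC /F !(linearD J, linearZ_LR J) !JJ.
have CC x : C (C x) = x.
  have PC : P (C x) = J (P x) + 4^-1 *: J (P x) + (3 / 4) *: J (Rs (P x)).
    by rewrite hC /F !(linearD P, linearZ_LR P) !PJ !PR !Pi.
  have JRJ y : J (Rs (J y)) = - Rs y by rewrite anticommuteE JJ.
  rewrite hC /F PC JC !(linearD J, linearZ_LR J, linearD Rs, linearZ_LR Rs).
  rewrite !JRJ !JJ !RR.
  by apply: (ip_ext (ip := ip)) => z; rewrite !(ipDl, ipNl, ipZl); field.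
have sym x y : ip (J (C x)) y = ip x (J (C y)).
  rewrite !JC !ipDl !ipDr !ipZl !ipZr !Ps Rsy -PR Ps.
  have -> : ((4^-1 : R[i])^*)%R = 4^-1 by rewrite conjV (@rmorph_nat _ _ Num.conj).
  have -> : ((3 / 4 : R[i])^*)%R = 3 / 4.
    by rewrite conjM conjV !(@rmorph_nat _ _ Num.conj).
  by [].
split=> //.
- apply/bounded_nrm.
  suff [c hc] : bounded_map F by exists c => x; rewrite hC.
  have Jb : bounded_map J by case: hJ => /bounded_nrm.
  have Rb : bounded_map Rs by case: hRs => /bounded_nrm.
  apply: bounded_mapD; first apply: bounded_mapD => //.
    by apply: bounded_mapZ; exact: bounded_map_comp.
  apply: bounded_mapZ; apply: (bounded_map_comp (F' := Rs \o P)) => //.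
  exact: bounded_map_comp.
- exact/selfadjoint_graphP.
- move=> x x0; set y := P x.
  have yx : ip y x = ip y y by rewrite /y -Ps Pi.
  have xy : ip x y = ip y y by rewrite -[in RHS]Ps Pi.
  have Ryx : ip (Rs y) x = ip (Rs y) y.
    by rewrite /y -PR -[in LHS](Pi (Rs x)) Ps.
  have yR : ip y (Rs y) = ip (Rs y) y by rewrite Rsy.
  have RyRy : ip (Rs y) (Rs y) = ip y y by rewrite Rsy RR.
  (* On the range of [P] the operator [J C] is [5/4 + 3/4 Rs], whose eigenvalues are among 2 and
     1/2; the identity isolates the lower bound 1/2 there and leaves squares. *)
  have -> : ip (J (C x)) x = ip (x - y) (x - y) + 2^-1 * ip y y
      + 3 / 8 * ip (y + Rs y) (y + Rs y).
    rewrite JC -/y !(ipDl, ipNl, ipZl, ipDr, ipNr) Ryx xy yx yR RyRy.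
    by field.
  have p8 : 0 <= 3 / 8 * ip (y + Rs y) (y + Rs y).
    by rewrite mulr_ge0 ?dnorm_ge0 // divr_ge0.
  apply: ltr_wpDr => //.
  have [y0|y0] := eqVneq y 0.
    rewrite y0 subr0 ip0l mulr0 addr0; exact: neq0_dnorm_gt0.
  apply: ltr_wpDl; first exact: dnorm_ge0.
  by rewrite mulr_gt0 ?invr_gt0 ?ltr0n //; exact: neq0_dnorm_gt0.
apply: intertwines_commutes => // x y Sxy; rewrite !hC.
have h := SP _ _ Sxy.
apply: operator_add => //; last first.
  by apply: operator_scale => //; apply: SJ; exact: SR.
by apply: operator_add => //; [exact: SJ|apply: operator_scale => //; exact: SJ].
Qed.

(** [P = 0] gives [J], then [P = 1] gives [Rs], and a general [P] is recovered because
    [1/4 + 3/4 Rs] is invertible. *)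
Lemma Upsilon_intertwines A : Upsilon ip J S A ->
  [/\ intertwines A J, intertwines A Rs & forall P : {linear H -> H},
    bounded_map P -> (forall x, P (P x) = P x) ->
    (forall x y, ip (P x) y = ip x (P y)) ->
    (forall x, P (J x) = J (P x)) -> (forall x, P (Rs x) = Rs (P x)) ->
    intertwines S P -> intertwines A P].
Proof.
move=> [[oA _ _] AC].
have JJ x := symmetry_invol x hJ; have RR x := symmetry_invol x hRs.
have hP (P : {linear H -> H}) : bounded_map P -> (forall x, P (P x) = P x) ->
    (forall x y, ip (P x) y = ip x (P y)) ->
    (forall x, P (J x) = J (P x)) -> (forall x, P (Rs x) = Rs (P x)) ->
    intertwines S P ->
    intertwines A (fun x => J x + 4^-1 *: J (P x) + (3 / 4) *: J (Rs (P x))).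
  move=> h1 h2 h3 h4 h5 h6.
  have [C [/AC/commutes_intertwines hC CE]] := projected_C_stable h1 h2 h3 h4 h5 h6.
  by move=> x y /hC; rewrite !CE.
have AJ : intertwines A J.
  have [T hT] : exists T : {linear H -> H}, forall x, T x = 0.
    by apply: linear_map_of => a x y; rewrite scaler0 addr0.
  have := hP T; move=> h x y Axy.
  suff /(_ _ _ Axy) : intertwines A (fun x => J x + 4^-1 *: J (T x) + (3 / 4) *: J (Rs (T x))).
    by rewrite !hT !linear0 !addr0.
  apply: h => *; rewrite ?hT ?linear0 ?ip0l ?ip0r //.
    by exists 0 => t; rewrite hT nrm0 mul0r.
  by move=> ? ? _; rewrite !hT; case: oS.
have AR : intertwines A Rs.
  have [T hT] : exists T : {linear H -> H}, forall x, T x = x.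
    exact: linear_map_of.
  have := hP T; move=> h x y Axy.
  have /(_ _ _ Axy) hA : intertwines A (fun x => J x + 4^-1 *: J (T x) + (3 / 4) *: J (Rs (T x))).
    apply: h => *; rewrite ?hT //.
      by exists 1 => t; rewrite hT mul1r.
    by move=> ? ? ?; rewrite !hT.
  (* For [P = 1], [J C = 5/4 + 3/4 Rs], so [Rs = 4/3 J C - 5/3]. *)
  have := operator_sub oA (operator_scale (4 / 3) oA (AJ _ _ hA))
            (operator_scale (5 / 3) oA Axy).
  rewrite !hT !(linearD J, linearZ_LR J) !JJ; congr (A (_, _)).
    by apply: (ip_ext (ip := ip)) => z; rewrite !(ipDl, ipNl, ipZl); field.
  by apply: (ip_ext (ip := ip)) => z; rewrite !(ipDl, ipNl, ipZl); field.
split=> // P h1 h2 h3 h4 h5 h6 x y Axy.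
have hA := hP P h1 h2 h3 h4 h5 h6 _ _ Axy.
(* [J (C - J)] equals [(1/4 + 3/4 Rs) P], and the inverse of [1/4 + 3/4 Rs] is [3/2 Rs - 1/2]. *)
have hW := AJ _ _ (operator_sub oA hA (AJ _ _ Axy)).
have := operator_sub oA (operator_scale (3 / 2) oA (AR _ _ hW)) (operator_scale 2^-1 oA hW).
rewrite !(linearB J, linearD J, linearZ_LR J) !JJ.
rewrite !(linearB Rs, linearD Rs, linearZ_LR Rs) !RR; congr (A (_, _)).
  by apply: (ip_ext (ip := ip)) => z; rewrite !(ipDl, ipNl, ipZl); field.
by apply: (ip_ext (ip := ip)) => z; rewrite !(ipDl, ipNl, ipZl); field.
Qed.

End ProjectedSymmetry.

(** * The matrix K and the angle t *)

Section Trigonometry.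
Variable R : realType.
Implicit Types (x t zeta phi xi omega chi : R) (w : R[i]).

Lemma cosh_gt0 x : 0 < cosh x.
Proof. by rewrite /cosh divr_gt0 // addr_gt0 ?expR_gt0. Qed.

Lemma cosh_sinh x : cosh x ^+ 2 - sinh x ^+ 2 = 1.
Proof.
rewrite /cosh /sinh expRN; have := expR_gt0 x => h.
by field; rewrite gt_eqF.
Qed.

Lemma tanh_surj (s : R) : -1 < s < 1 -> exists chi : R, tanh chi = s.
Proof.
move=> /andP[s1 s2].
(* [k] is [exp chi], found by solving [(k ^ 2 - 1) / (k ^ 2 + 1) = s]. *)
pose k := Num.sqrt ((1 + s) / (1 - s)).
have q0 : 0 < (1 + s) / (1 - s) by rewrite divr_gt0 ?subr_gt0 // -ltrBlDl sub0r.
have k2 : k ^+ 2 = (1 + s) / (1 - s) by rewrite sqr_sqrtr // ltW.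
have k0 : 0 < k by rewrite sqrtr_gt0.
exists (ln k); rewrite /tanh /sinh /cosh expRN lnK ?posrE //.
have kn : k != 0 by rewrite gt_eqF.
have kk : k ^+ 2 + 1 != 0 by rewrite gt_eqF // addr_gt0 // exprn_gt0.
have -> : (k - k^-1) / 2 / ((k + k^-1) / 2) = (k ^+ 2 - 1) / (k ^+ 2 + 1).
  by field; rewrite kn kk.
apply: (mulIf kk); rewrite divfK // k2; field.
by rewrite gt_eqF // subr_gt0.
Qed.

Lemma expiN_mul x : expi (- x) * expi x = 1.
Proof.
rewrite /expi cosN sinN; apply/eqP; rewrite eq_complex /=; apply/andP; split; apply/eqP.
  by rewrite mulNr opprK -!expr2 cos2Dsin2.
by ring.
Qed.

Lemma expi_neq0 x : expi x != 0.
Proof.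
apply/eqP => h; have := expiN_mul x; rewrite h mulr0 => /esym/eqP.
by rewrite oner_eq0.
Qed.

Lemma calK_entries zeta phi xi omega (X := calK zeta phi xi omega) :
  [/\ X 0 0 = expi (- xi) * - (expi (- phi) * (cosh zeta)%:C),
      X 0 1 = expi (- xi) * (expi (- omega) * (sinh zeta)%:C),
      X 1 0 = expi (- xi) * - (expi omega * (sinh zeta)%:C) &
      X 1 1 = expi (- xi) * (expi phi * (cosh zeta)%:C)].
Proof. by split; rewrite !mxE /=. Qed.

Lemma det_calK zeta phi xi omega :
  \det (calK zeta phi xi omega) = - expi (- xi) ^+ 2.
Proof.
have [e00 e01 e10 e11] := calK_entries zeta phi xi omega.
rewrite det_mx2 e00 e01 e10 e11.
have h1 := expiN_mul phi; have h2 := expiN_mul omega.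
have h3 : (sinh zeta)%:C * (sinh zeta)%:C = (cosh zeta)%:C * (cosh zeta)%:C - 1 :> R[i].
  rewrite -!rmorphM -(rmorph1 (real_complex R)) -rmorphB /=; congr (_%:C).
  by rewrite -(cosh_sinh zeta); ring.
transitivity (expi (- xi) ^+ 2 * ((expi (- omega) * expi omega) * ((sinh zeta)%:C * (sinh zeta)%:C)
  - (expi (- phi) * expi phi) * ((cosh zeta)%:C * (cosh zeta)%:C))).
  by ring.
by rewrite h1 h2 h3; ring.
Qed.

Lemma tr_calK zeta phi xi omega : \tr (calK zeta phi xi omega) =
  expi (- xi) * (2 * 'i%C * (cosh zeta * sin phi)%:C).
Proof.
have [e00 _ _ e11] := calK_entries zeta phi xi omega.
rewrite /mxtrace !big_ord_recl big_ord0 (_ : lift ord0 ord0 = 1); last exact/val_inj.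
rewrite (_ : ord0 = 0) // e00 e11 addr0 -mulrDr; congr (_ * _).
rewrite /expi cosN sinN; apply/eqP; rewrite eq_complex /=.
by apply/andP; split; apply/eqP; ring.
Qed.

(** The quadratic is [det ((w + i) X - (w - i))]. It involves only the determinant and the trace of
    [X], so [zeta] and [phi] are felt through [cosh zeta * sin phi] alone. The factors on the right
    are the tan and cot factors with denominators cleared, hence without poles. *)
Lemma calK_quadratic zeta phi xi omega t w (X := calK zeta phi xi omega)
    (th := (xi - t) / 2) (ps := (xi + t) / 2) :
  cosh zeta * sin phi = sin t ->
  expi xi * ((\det X - \tr X + 1) * w ^+ 2 + (2 * 'i%C * (\det X - 1)) * w
    + (- \det X - \tr X - 1)) =
  4 * 'i%C * ((w * (sin th)%:C - (cos th)%:C) * (w * (cos ps)%:C + (sin ps)%:C)).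
Proof.
move=> ht; rewrite /X det_calK tr_calK ht.
set E := expi (- xi); set F := expi xi.
have EF : E * F = 1 by exact: expiN_mul.
transitivity ((- E * (E * F) - (E * F) * (2 * 'i%C * (sin t)%:C) + F) * w ^+ 2 +
  2 * 'i%C * (- E * (E * F) - F) * w + (E * (E * F) - (E * F) * (2 * 'i%C * (sin t)%:C) - F)).
  by ring.
rewrite EF !mulr1 !mul1r.
have xE : xi = th + ps by rewrite /th /ps; field.
have tE : t = ps - th by rewrite /th /ps; field.
rewrite /E /F /expi cosN sinN xE tE sinD cosD sinB.
case: w => a b; apply/eqP; rewrite eq_complex /=.
by apply/andP; split; apply/eqP; ring.
Qed.

(** At a zero of [sin x] the cosine does not vanish, so the right side is nonzero there, in
    accordance with the value 1 chosen at poles. *)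
Lemma cot_factor_eq0 x w : (cot_factor x w = 0) <-> w * (sin x)%:C - (cos x)%:C = 0.
Proof.
have inj (a : R) : (a%:C == 0 :> R[i]) = (a == 0).
  by rewrite -(rmorph0 (real_complex R)) (inj_eq (@complexI R)).
rewrite /cot_factor; have [s0|s0] := eqVneq (sin x) 0.
  rewrite s0 mulr0 sub0r; split=> /eqP; first by rewrite oner_eq0.
  rewrite oppr_eq0 inj => /eqP c0; have := cos2Dsin2 x.
  by rewrite s0 c0 expr0n addr0 => /esym/eqP; rewrite oner_eq0.
have -> : w * (sin x)%:C - (cos x)%:C = - ((sin x)%:C * ((cot x)%:C - w)).
  rewrite mulrBr -rmorphM /= /cot mulrCA mulfV // mulr1; ring.
by split=> [->|/eqP]; rewrite ?mulr0 ?oppr0 // oppr_eq0 mulf_eq0 inj (negPf s0) => /eqP.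
Qed.

Lemma tan_factor_eq0 x w : (tan_factor x w = 0) <-> w * (cos x)%:C + (sin x)%:C = 0.
Proof.
have inj (a : R) : (a%:C == 0 :> R[i]) = (a == 0).
  by rewrite -(rmorph0 (real_complex R)) (inj_eq (@complexI R)).
rewrite /tan_factor; have [c0|c0] := eqVneq (cos x) 0.
  rewrite c0 mulr0 add0r; split=> /eqP; first by rewrite oner_eq0.
  rewrite inj => /eqP s0; have := cos2Dsin2 x.
  by rewrite s0 c0 expr0n addr0 => /esym/eqP; rewrite oner_eq0.
have -> : w * (cos x)%:C + (sin x)%:C = (cos x)%:C * ((tan x)%:C + w).
  rewrite mulrDr -rmorphM /= /tan mulrCA mulfV // mulr1; ring.
by split=> [->|/eqP]; rewrite ?mulr0 // mulf_eq0 inj (negPf c0) => /eqP.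
Qed.

Lemma calK_quadratic_eq0 zeta phi xi omega t w (X := calK zeta phi xi omega) :
  cosh zeta * sin phi = sin t ->
  ((\det X - \tr X + 1) * w ^+ 2 + (2 * 'i%C * (\det X - 1)) * w
    + (- \det X - \tr X - 1) = 0 <->
   tan_factor ((xi + t) / 2) w * cot_factor ((xi - t) / 2) w = 0).
Proof.
move=> ht; have := calK_quadratic xi omega w ht; rewrite -/X.
set q := _ + _ + _; set a := _ - (cos _)%:C; set b := _ + (sin _)%:C => h.
have k0 : 4 * 'i%C != 0 :> R[i].
  by rewrite mulf_neq0 ?pnatr_eq0 // eq_complex /= oner_eq0 andbF.
have hab : q = 0 <-> a * b = 0.
  split=> [q0|ab0].
    by move: h; rewrite q0 mulr0 => /esym/eqP; rewrite mulf_eq0 (negPf k0) => /eqP.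
  by move: h; rewrite ab0 mulr0 => /eqP; rewrite mulf_eq0 (negPf (expi_neq0 _)) => /eqP.
rewrite hab; split=> /eqP; rewrite mulf_eq0 => /orP[]/eqP.
- by move=> /cot_factor_eq0 ->; rewrite mulr0.
- by move=> /tan_factor_eq0 ->; rewrite mul0r.
- by move=> /tan_factor_eq0; rewrite -/b => ->; rewrite mulr0.
- by move=> /cot_factor_eq0; rewrite -/a => ->; rewrite mul0r.
Qed.

(* Indeed [|w| = cosh chi / cosh zeta]. *)
Lemma angle_direction zeta phi chi (w := cos phi +i* (sin phi * cosh chi)) :
  cos phi * tanh chi = - tanh zeta ->
  w / `|w| = (cos phi * cosh zeta / cosh chi) +i* (sin phi * cosh zeta).
Proof.
move=> h; have z0 := cosh_gt0 zeta; have c0 := cosh_gt0 chi.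
have zn : cosh zeta != 0 by rewrite gt_eqF.
have cn : cosh chi != 0 by rewrite gt_eqF.
have hz := cosh_sinh zeta; have hc := cosh_sinh chi; have hp := cos2Dsin2 phi.
have sE : cos phi * sinh chi * cosh zeta = - sinh zeta * cosh chi.
  have := congr1 (fun y => y * cosh zeta * cosh chi) h.
  rewrite /tanh => e.
  transitivity (cos phi * (sinh chi / cosh chi) * cosh zeta * cosh chi); first by field.
  by rewrite e; field.
have nE : `|w| = (cosh chi / cosh zeta)%:C.
  rewrite normc_def /w /=; congr (_%:C).
  have d0 : 0 <= cosh chi / cosh zeta by rewrite divr_ge0 // ltW.
  rewrite -[RHS](ger0_norm d0) -sqrtr_sqr; congr Num.sqrt.
  apply: (mulIf (expf_neq0 2 zn)).
  rewrite [RHS](_ : _ = cosh chi ^+ 2); last by field.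
  have e2 := congr1 (fun y => y ^+ 2) sE.
  have hs : sinh zeta ^+ 2 = cosh zeta ^+ 2 - 1 by rewrite -hz; ring.
  have ht : sinh chi ^+ 2 = cosh chi ^+ 2 - 1 by rewrite -hc; ring.
  have hq : sin phi ^+ 2 = 1 - cos phi ^+ 2 by rewrite -hp; ring.
  have {}e2 : cos phi ^+ 2 * (cosh chi ^+ 2 - 1) * cosh zeta ^+ 2 =
      (cosh zeta ^+ 2 - 1) * cosh chi ^+ 2.
    by rewrite -hs -ht; move: e2 => /= e2; transitivity ((cos phi * sinh chi * cosh zeta) ^+ 2);
      [ring|rewrite e2; ring].
  rewrite [LHS](_ : _ = cos phi ^+ 2 * cosh zeta ^+ 2 +
     sin phi ^+ 2 * cosh chi ^+ 2 * cosh zeta ^+ 2); last by ring.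
  rewrite hq; apply/eqP; rewrite -subr_eq0; apply/eqP.
  transitivity ((cosh zeta ^+ 2 - 1) * cosh chi ^+ 2 -
     cos phi ^+ 2 * (cosh chi ^+ 2 - 1) * cosh zeta ^+ 2); first by ring.
  by rewrite e2 subrr.
rewrite nE -fmorphV /= invf_div.
apply/eqP; rewrite eq_complex /w /=; apply/andP; split; apply/eqP; field; exact: cn.
Qed.

(** The sign of the sine confines both angles to [[0, pi]], where the cosine is injective. *)
Lemma angle_unique t t' : 0 <= t < 2 * pi -> 0 <= t' < 2 * pi ->
  0 <= sin t -> sin t = sin t' -> cos t = cos t' -> t = t'.
Proof.
move=> /andP[t0 t2] /andP[t'0 t'2] s0 ss cc.
have le x : 0 <= x -> x < 2 * pi -> 0 <= sin x -> x <= pi.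
  move=> x0 x2 sx; rewrite leNgt; apply/negP => xp.
  have : 0 < sin (x - pi) by apply: sin_gt0_pi; rewrite subr_gt0 xp /=; lra.
  have := sinDpi (x - pi); rewrite subrK => h.
  by move: sx; rewrite h; lra.
apply: cos_inj => //; rewrite in_itv /=.
  by rewrite t0 le.
by rewrite t'0 le // -ss.
Qed.

Lemma angle_exists (x y : R) : x ^+ 2 + y ^+ 2 = 1 -> 0 <= y ->
  exists2 t, 0 <= t < 2 * pi & expi t = x +i* y.
Proof.
move=> xy y0.
have xb : -1 <= x <= 1.
  rewrite -ler_norml -(@ler_pXn2r _ 2) ?nnegrE // real_normK ?num_real // expr1n.
  by rewrite -xy lerDl sqr_ge0.
exists (acos x).
  rewrite acos_ge0 //=; apply: le_lt_trans (acos_lepi xb) _.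
  by have := pi_gt0 R; lra.
rewrite /expi acosK ?in_itv // sin_acos // -xy addrC addKr.
by rewrite sqrtr_sqr ger0_norm.
Qed.

Lemma cosh_tanh_inj chi chi' : tanh chi = tanh chi' -> cosh chi = cosh chi'.
Proof.
move=> h.
have z0 := cosh_gt0 chi; have c0 := cosh_gt0 chi'.
have hz := cosh_sinh chi; have hc := cosh_sinh chi'.
have e (x : R) : cosh x ^+ 2 = (1 - tanh x ^+ 2)^-1.
  have x0 := cosh_gt0 x; have hx := cosh_sinh x.
  have xn : cosh x != 0 by rewrite gt_eqF.
  rewrite /tanh (_ : 1 - _ = (cosh x ^+ 2 - sinh x ^+ 2) / cosh x ^+ 2).
    by rewrite hx div1r invrK.
  by field.
by apply/eqP; rewrite -(@eqrXn2 _ 2) ?ltW // !e h.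
Qed.

Lemma direction_angle zeta phi chi (w := cos phi +i* (sin phi * cosh chi)) :
  0 <= phi <= pi -> cos phi * tanh chi = - tanh zeta ->
  exists2 t, 0 <= t < 2 * pi & expi t = w / `|w|.
Proof.
move=> hphi hchi; have dirE := angle_direction hchi; rewrite -/w in dirE.
have s0 : 0 <= sin phi * cosh zeta.
  by rewrite mulr_ge0 ?sin_ge0_pi // ltW // cosh_gt0.
have cn : cosh chi != 0 by rewrite gt_eqF // cosh_gt0.
have w0 : w != 0.
  apply/eqP => /eqP; rewrite eq_complex /= => /andP[/eqP c1 /eqP sc].
  have s1 : sin phi = 0 by apply: (mulIf cn); rewrite sc mul0r.
  by have := cos2Dsin2 phi; rewrite c1 s1 expr0n addr0 => /esym/eqP; rewrite oner_eq0.
have norm1 : (cos phi * cosh zeta / cosh chi) ^+ 2 + (sin phi * cosh zeta) ^+ 2 = 1.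
  apply: complexI; rewrite (add_Re2_Im2 (_ +i* _)) -dirE.
  by rewrite normrM normfV normr_id divff ?expr1n // normr_eq0.
by have [t ht et] := angle_exists norm1 s0; exists t; rewrite // dirE.
Qed.

(** The equation determines [cosh chi] when [cos phi] is nonzero. If [cos phi = 0], the real part of
    the direction vanishes whatever [chi] is, so [t] is unique all the same. *)
Lemma direction_angle_unique zeta phi chi chi' t t'
    (w := cos phi +i* (sin phi * cosh chi)) (w' := cos phi +i* (sin phi * cosh chi')) :
  0 <= phi <= pi -> cos phi * tanh chi = - tanh zeta ->
  cos phi * tanh chi' = - tanh zeta -> 0 <= t < 2 * pi -> 0 <= t' < 2 * pi ->
  expi t = w / `|w| -> expi t' = w' / `|w'| -> t = t'.
Proof.
move=> hphi hchi hchi' ht ht' et et'.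
move: (etrans et (angle_direction hchi)) (etrans et' (angle_direction hchi')).
move=> [ct st] [ct' st'].
have s0 : 0 <= sin phi * cosh zeta.
  by rewrite mulr_ge0 ?sin_ge0_pi // ltW // cosh_gt0.
apply: angle_unique => //; rewrite ?st ?st' // ct ct'.
have [->|cphi] := eqVneq (cos phi) 0; first by rewrite !mul0r.
have -> // : cosh chi = cosh chi'.
by apply: cosh_tanh_inj; apply: (mulfI cphi); rewrite hchi hchi'.
Qed.

(* The hypotheses on [Y] hold for the boundary matrix of an operator [C] that
   commutes with the extension. *)
Lemma calK_commute_dichotomy zeta phi xi omega (X := calK zeta phi xi omega)
    (a : R) (b : R[i]) (Y : 'M[R[i]]_2) :
  X *m Y = Y *m X -> 0 < a -> a ^+ 2 = 1 + (Re b ^+ 2 + Im b ^+ 2) ->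
  Y 0 0 = a%:C -> Y 0 1 = b -> Y 1 1 = - a%:C ->
  sinh zeta ^+ 2 < cosh zeta ^+ 2 * cos phi ^+ 2 \/ (sinh zeta = 0 /\ cos phi = 0).
Proof.
move=> XY a0 a2 Y0 Y1 Y3.
have [e00 e01 _ e11] := calK_entries zeta phi xi omega.
have := congr1 (fun Z : 'M[R[i]]_2 => Z 0 1) XY.
rewrite !mxE !big_ord_recl !big_ord0 !addr0.
rewrite (_ : lift ord0 ord0 = 1); last exact/val_inj.
rewrite (_ : ord0 = 0) // e00 e01 e11 Y0 Y1 Y3 => h.
have {}h : expi (- xi) * (b * ((expi phi + expi (- phi)) * (cosh zeta)%:C)
    + 2 * a%:C * (expi (- omega) * (sinh zeta)%:C)) = 0.
  by apply/eqP; move/eqP: h; rewrite -subr_eq0 => /eqP h; rewrite -oppr_eq0 -[X in _ == X]h; apply/eqP; ring.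
move/eqP: h; rewrite mulf_eq0 (negPf (expi_neq0 _)) /= => /eqP h.
have hb : (Re b * (2 * cos phi * cosh zeta) = - 2 * a * (cos omega * sinh zeta)) /\
    (Im b * (2 * cos phi * cosh zeta) = 2 * a * (sin omega * sinh zeta)).
  move: h; rewrite /expi !cosN !sinN; case: (b) => b1 b2 /= [h1 h2].
  split; apply/eqP; rewrite -subr_eq0; apply/eqP.
    by rewrite -[RHS]h1; ring.
  by rewrite -[RHS]h2; ring.
have [h1 h2] := hb.
set n := Re b ^+ 2 + Im b ^+ 2 in a2.
(* The off-diagonal entry of [X Y = Y X] in squared modulus, as the sum of the squares of [h1] and
   [h2]. *)
have key : n * (cosh zeta ^+ 2 * cos phi ^+ 2) = a ^+ 2 * sinh zeta ^+ 2.
  have e1 := congr1 (fun y => y ^+ 2) h1; have e2 := congr1 (fun y => y ^+ 2) h2.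
  have e3 := cos2Dsin2 omega.
  have n4 : 4 != 0 :> R by rewrite pnatr_eq0.
  apply: (mulfI n4).
  transitivity ((Re b * (2 * cos phi * cosh zeta)) ^+ 2 + (Im b * (2 * cos phi * cosh zeta)) ^+ 2).
    by rewrite /n; ring.
  rewrite e1 e2.
  transitivity (4 * (a ^+ 2 * sinh zeta ^+ 2) * (cos omega ^+ 2 + sin omega ^+ 2)).
    by ring.
  by rewrite e3 mulr1.
have n0 : 0 <= n by rewrite addr_ge0 ?sqr_ge0.
have [s0|s0] := eqVneq (sinh zeta) 0.
  have [c0|c0] := eqVneq (cos phi) 0; first by right.
  left; rewrite s0 expr0n -exprMn exprn_even_gt0 //= mulf_neq0 //.
  by rewrite gt_eqF // cosh_gt0.
left; have s2 : 0 < sinh zeta ^+ 2 by rewrite exprn_even_gt0.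
have np : 0 < n.
  rewrite lt_neqAle n0 andbT eq_sym; apply/eqP => nz.
  by move: key; rewrite nz mul0r => /esym/eqP; rewrite mulf_eq0 !expf_eq0 /= (negPf s0) (gt_eqF a0).
rewrite -(ltr_pM2l np) key a2; move: (sinh zeta ^+ 2) s2 => s hs.
by rewrite ltr_pM2r // ltrDr.
Qed.

(** The first alternative is [|tanh zeta| < |cos phi|], so that [- tanh zeta / cos phi] is a value
    of [tanh]; in the second both sides vanish for any [chi]. *)
Lemma tanh_dichotomy_chi zeta phi :
  sinh zeta ^+ 2 < cosh zeta ^+ 2 * cos phi ^+ 2 \/ (sinh zeta = 0 /\ cos phi = 0) ->
  exists chi : R, cos phi * tanh chi = - tanh zeta.
Proof.
have z0 := cosh_gt0 zeta.
have zn : cosh zeta != 0 by rewrite gt_eqF.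
case=> [h|[s0 c0]]; last by exists 0; rewrite c0 /tanh s0 !mul0r oppr0.
have c0 : cos phi != 0.
  apply/eqP => c0; move: h; rewrite c0 expr0n mulr0 ltNge sqr_ge0 //.
have [chi hchi] : exists chi, tanh chi = - tanh zeta / cos phi.
  apply: tanh_surj; rewrite -ltr_norml -(@ltr_pXn2r _ 2) ?nnegrE //.
  rewrite real_normK ?num_real // expr1n.
  rewrite (_ : _ ^+ 2 = sinh zeta ^+ 2 / (cosh zeta ^+ 2 * cos phi ^+ 2)).
    by rewrite ltr_pdivrMr ?mul1r // -exprMn exprn_even_gt0 //= mulf_neq0.
  by rewrite /tanh; field; rewrite zn c0.
by exists chi; rewrite hchi mulrC divfK.
Qed.

(** Commuting with [sigma3] kills the off-diagonal entries, that is [sinh zeta]; commuting with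
    [sigma1] equates the diagonal ones, which makes [exp (i phi)] purely imaginary. *)
Lemma calK_commute_sigma zeta phi xi omega (X := calK zeta phi xi omega) :
  X *m sigma3 R = sigma3 R *m X -> X *m sigma1 R = sigma1 R *m X ->
  sinh zeta = 0 /\ cos phi = 0.
Proof.
have [e00 e01 e10 e11] := calK_entries zeta phi xi omega.
move=> /(congr1 (fun Z : 'M[R[i]]_2 => Z 0 1)) h3 /(congr1 (fun Z : 'M[R[i]]_2 => Z 0 1)) h1.
move: h3 h1; rewrite !mxE !big_ord_recl !big_ord0 !addr0.
rewrite (_ : lift ord0 ord0 = 1); last exact/val_inj.
rewrite (_ : ord0 = 0) // e00 e01 e11 !mxE /= !mulr0 !mul0r !mulr1 !mul1r !add0r !addr0.
move=> h3 /(mulfI (expi_neq0 _)) h1.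
have cn : cosh zeta != 0 by rewrite gt_eqF // cosh_gt0.
split.
  have : 2 * expi (- xi) * expi (- omega) * (sinh zeta)%:C = 0.
    by move/eqP: h3; rewrite -subr_eq0 => /eqP h; rewrite -[RHS]oppr0 -h; ring.
  move=> /eqP; rewrite !mulf_eq0 pnatr_eq0 !(negPf (expi_neq0 _)) /=.
  by rewrite -(rmorph0 (real_complex R)) (inj_eq (@complexI R)) => /eqP.
move: h1; rewrite /expi cosN sinN => -[h _].
by apply: (mulIf cn); rewrite mul0r; move: h; rewrite !mulr0 !subr0; lra.
Qed.

Lemma cosh_eq1 zeta : sinh zeta = 0 -> cosh zeta = 1.
Proof.
move=> s0; have := cosh_sinh zeta; rewrite s0 expr0n subr0 => h.
by apply/eqP; rewrite -(@eqrXn2 _ 2) ?ltW ?cosh_gt0 // h expr1n.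
Qed.

Lemma sin_eq1 phi : 0 <= phi <= pi -> cos phi = 0 -> sin phi = 1.
Proof.
move=> /sin_ge0_pi s0 c0; have := cos2Dsin2 phi; rewrite c0 expr0n add0r => h.
by apply/eqP; rewrite -(@eqrXn2 _ 2) // h expr1n.
Qed.

Lemma sinh0 : sinh (0 : R) = 0.
Proof. by rewrite /sinh oppr0 subrr mul0r. Qed.

(* For [zeta = 0] and [phi = pi / 2] the matrix is the scalar [i e^(- i xi)]. *)
Lemma calK_scalar_boundary xi omega (a b : 'cV[R[i]]_2) (ps := (xi + pi / 2) / 2) :
  cos ps != 0 ->
  (calK 0 (pi / 2) xi omega *m (b + 'i%C *: a) = b - 'i%C *: a <->
   b = - (tan ps)%:C *: a).
Proof.
move=> c0.
have -> : calK 0 (pi / 2) xi omega = (expi (- xi) * 'i%C)%:M.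
  have [e00 e01 e10 e11] := calK_entries 0 (pi / 2) xi omega.
  have ep : expi (pi / 2) = 'i%C :> R[i] by rewrite /expi cos_pihalf sin_pihalf.
  have en : expi (- (pi / 2)) = - 'i%C :> R[i].
    by rewrite /expi cosN sinN cos_pihalf sin_pihalf; apply/eqP; rewrite eq_complex /= oppr0 !eqxx.
  rewrite sinh0 rmorph0 !mulr0 oppr0 mulr0 in e01 e10.
  rewrite (cosh_eq1 sinh0) rmorph1 !mulr1 in e00 e11; rewrite en opprK in e00.
  rewrite ep in e11; apply/matrixP => i j.
  have o2 (k : 'I_2) : k = 0 \/ k = 1.
    by case: k => [[|[|//]] hk]; [left|right]; exact/val_inj.
  have [->|->] := o2 i; have [->|->] := o2 j; rewrite ?e00 ?e01 ?e10 ?e11 !mxE /= ?mulr1n ?mulr0n //.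
have xE : xi = ps + ps - pi / 2 by rewrite /ps; field.
(* The coefficients of [b] and [a] in the boundary condition share the factor [2 exp (- i ps)]; what
   remains is [cos ps] and [sin ps], whence the tangent. *)
have E1 : expi (- xi) * 'i%C - 1 = - (2 * expi (- ps) * (cos ps)%:C).
  rewrite xE /expi !cosN !sinN sinBpihalf cosBpihalf sinD cosD.
  have := cos2Dsin2 ps => h.
  have h' : sin ps ^+ 2 = 1 - cos ps ^+ 2 by rewrite -h; ring.
  apply/eqP; rewrite eq_complex /=; apply/andP; split; apply/eqP; last by ring.
  by transitivity (cos ps ^+ 2 * -1 + sin ps ^+ 2 - 1 : R); [ring|rewrite h'; ring].
have E2 : expi (- xi) - 'i%C = 2 * expi (- ps) * (sin ps)%:C.
  rewrite xE /expi !cosN !sinN sinBpihalf cosBpihalf sinD cosD.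
  have := cos2Dsin2 ps => h.
  have h' : cos ps ^+ 2 = 1 - sin ps ^+ 2 by rewrite -h; ring.
  apply/eqP; rewrite eq_complex /=; apply/andP; split; apply/eqP; first by ring.
  by transitivity (cos ps ^+ 2 - sin ps ^+ 2 - 1 : R); [ring|rewrite h'; ring].
have i2 : 'i%C * 'i%C = -1 :> R[i] by rewrite -expr2 sqr_i.
have U0 : 2 * expi (- ps) != 0 by rewrite mulf_neq0 ?pnatr_eq0 // expi_neq0.
have cC : (cos ps)%:C != 0 :> R[i].
  by rewrite -(rmorph0 (real_complex R)) (inj_eq (@complexI R)).
have key : (expi (- xi) * 'i%C)%:M *m (b + 'i%C *: a) - (b - 'i%C *: a) =
    - (2 * expi (- ps) * (cos ps)%:C) *: (b - - (tan ps)%:C *: a).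
  rewrite mul_scalar_mx.
  transitivity ((expi (- xi) * 'i%C - 1) *: b - (expi (- xi) - 'i%C) *: a).
    apply/matrixP => i j; rewrite !mxE; move: (a i j) (b i j) => p q.
    transitivity (expi (- xi) * 'i%C * q + expi (- xi) * ('i%C * 'i%C) * p - q + 'i%C * p); first by ring.
    by rewrite i2; ring.
  rewrite E1 E2; apply/matrixP => i j; rewrite !mxE; move: (a i j) (b i j) => p q.
  rewrite /tan rmorphM fmorphV /=; field; exact: cC.
split=> [/eqP|/eqP]; rewrite -subr_eq0.
  rewrite key scaler_eq0 oppr_eq0 mulf_eq0 (negPf U0) (negPf cC) /=.
  by rewrite subr_eq0 => /eqP.
by move=> /eqP h; apply/eqP; rewrite -subr_eq0 key h scaler0.
Qed.

(** A zero of this cosine is a zero of the sine of [(xi - pi / 2) / 2], an angle strictly between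
    [- pi] and [pi]. *)
Lemma cos_half_neq0 xi : 0 <= xi < 2 * pi -> xi != pi / 2 ->
  cos ((xi + pi / 2) / 2) != 0.
Proof.
move=> /andP[x0 x2]; apply: contraNneq => h.
have pp := pi_gt0 R.
have h2 : sin ((xi - pi / 2) / 2) = 0.
  have -> : (xi - pi / 2) / 2 = (xi + pi / 2) / 2 - pi / 2 by field.
  by rewrite sinBpihalf h oppr0.
have [xl|xl|//] := ltgtP xi (pi / 2).
  have : 0 < sin (- ((xi - pi / 2) / 2)) by apply: sin_gt0_pi; apply/andP; split; lra.
  by rewrite sinN h2 oppr0 ltxx.
have : 0 < sin ((xi - pi / 2) / 2) by apply: sin_gt0_pi; apply/andP; split; lra.
by rewrite h2 ltxx.
Qed.

(** The two arguments differ by [pi / 2] and [cot (x - pi / 2) = - tan x]: the factors agree up to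
    sign. *)
Lemma half_angle_factors xi w (ps := (xi + pi / 2) / 2) : cos ps != 0 ->
  (tan_factor ps w * cot_factor ((xi - pi / 2) / 2) w = 0 <-> (tan ps)%:C + w = 0).
Proof.
move=> c0; have -> : (xi - pi / 2) / 2 = ps - pi / 2 by rewrite /ps; field.
have cC : (cos ps)%:C != 0 :> R[i].
  by rewrite -(rmorph0 (real_complex R)) (inj_eq (@complexI R)).
rewrite /tan_factor (negPf c0) /cot_factor sinBpihalf oppr_eq0 (negPf c0).
have -> : (cot (ps - pi / 2))%:C - w = - ((tan ps)%:C + w).
  by rewrite /cot sinBpihalf cosBpihalf invrN mulrN rmorphN /= -/(tan ps) opprD.
split=> [/eqP|->]; last by rewrite mul0r.
by rewrite mulf_eq0 oppr_eq0 orbb => /eqP.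
Qed.

End Trigonometry.

(** * Boundary triplets, Weyl function and extensions *)

Section BoundaryTriplet.
Variables (R : realType) (H K : completeNormedModType R[i]).
Variables (ip : {dot H for (@Num.conj R[i])}) (hip : inner_product ip).
Variables (ipK : {dot K for (@Num.conj R[i])}).
Variable S : set (H * H).
Hypotheses (hSop : is_operator S) (hSclosed : closed S).
Hypotheses (hSdense : densely_defined S) (hSsym : symmetric_operator ip S).
Variables (Gamma0 Gamma1 : H -> K).
Hypothesis hGamma : boundary_triplet ip ipK S Gamma0 Gamma1.

Local Notation Ss := (adjoint ip S).
Local Notation B0 := (A0 ip S Gamma0).
Implicit Types (x y s t f g : H) (u v : K) (z w a : R[i]).

Lemma adjoint_S_operator : is_operator Ss.
Proof. exact: adjoint_operator. Qed.
Let oSs := adjoint_S_operator.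

Lemma Ss00 : Ss (0, 0).
Proof. by case: oSs. Qed.

Lemma S_adjoint x y : S (x, y) -> Ss (x, y).
Proof. exact: hSsym. Qed.

Lemma green x x' y y' : Ss (x, x') -> Ss (y, y') ->
  ip x' y - ip x y' = ipK (Gamma1 x) (Gamma0 y) - ipK (Gamma0 x) (Gamma1 y).
Proof. by case: hGamma => _ _ h _ hx hy; exact: (h _ _ hx hy). Qed.

Lemma Gamma0_lin a x x' y y' : Ss (x, x') -> Ss (y, y') ->
  Gamma0 (a *: x + y) = a *: Gamma0 x + Gamma0 y.
Proof. by case: hGamma => h _ _ _ hx hy; apply: h; [exists x'|exists y']. Qed.

Lemma Gamma1_lin a x x' y y' : Ss (x, x') -> Ss (y, y') ->
  Gamma1 (a *: x + y) = a *: Gamma1 x + Gamma1 y.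
Proof. by case: hGamma => _ h _ _ hx hy; apply: h; [exists x'|exists y']. Qed.

Lemma Gamma00 : Gamma0 0 = 0.
Proof.
have h := Gamma0_lin 1 Ss00 Ss00.
by move: h; rewrite scaler0 addr0 scale1r -[LHS]addr0 => /addrI.
Qed.

Lemma Gamma10 : Gamma1 0 = 0.
Proof.
have h := Gamma1_lin 1 Ss00 Ss00.
by move: h; rewrite scaler0 addr0 scale1r -[LHS]addr0 => /addrI.
Qed.

Lemma Gamma0Z a x x' : Ss (x, x') -> Gamma0 (a *: x) = a *: Gamma0 x.
Proof.
move=> h; have := Gamma0_lin a h Ss00.
by rewrite Gamma00 !addr0.
Qed.

Lemma Gamma1Z a x x' : Ss (x, x') -> Gamma1 (a *: x) = a *: Gamma1 x.
Proof.
move=> h; have := Gamma1_lin a h Ss00.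
by rewrite Gamma10 !addr0.
Qed.

Lemma Gamma0D x x' y y' : Ss (x, x') -> Ss (y, y') ->
  Gamma0 (x + y) = Gamma0 x + Gamma0 y.
Proof. by move=> hx hy; have := Gamma0_lin 1 hx hy; rewrite !scale1r. Qed.

Lemma Gamma1D x x' y y' : Ss (x, x') -> Ss (y, y') ->
  Gamma1 (x + y) = Gamma1 x + Gamma1 y.
Proof. by move=> hx hy; have := Gamma1_lin 1 hx hy; rewrite !scale1r. Qed.

Lemma Gamma0B x x' y y' : Ss (x, x') -> Ss (y, y') ->
  Gamma0 (x - y) = Gamma0 x - Gamma0 y.
Proof.
move=> hx hy; have := Gamma0_lin (-1) hy hx.
by rewrite !scaleN1r ![- _ + _]addrC.
Qed.

Lemma Gamma1B x x' y y' : Ss (x, x') -> Ss (y, y') ->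
  Gamma1 (x - y) = Gamma1 x - Gamma1 y.
Proof.
move=> hx hy; have := Gamma1_lin (-1) hy hx.
by rewrite !scaleN1r ![- _ + _]addrC.
Qed.

Lemma Gamma_surj u v : exists x x', [/\ Ss (x, x'), Gamma0 x = u & Gamma1 x = v].
Proof.
by case: hGamma => _ _ _ /(_ u v)[x [[x' h] h0 h1]]; exists x, x'.
Qed.

Lemma S_shift_closed : seq_closed (shift_range S 'i%C).
Proof.
apply: (@shift_range_closed _ _ _ _ 1) => //; first exact: closed_graph_closed.
move=> x y Sxy; have := symmetric_nonreal_bound hip 'i%C hSsym Sxy.
by rewrite /= normr1.
Qed.

(** Between an element of [S] and one of [S^*] the left side of Green's identity vanishes, while the
    boundary values of [S^*] fill all pairs. *)
Lemma S_Gamma_eq0 x y : S (x, y) -> Gamma0 x = 0 /\ Gamma1 x = 0.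
Proof.
move=> h; have hS := S_adjoint h.
have e s s' : Ss (s, s') ->
    ipK (Gamma1 x) (Gamma0 s) = ipK (Gamma0 x) (Gamma1 s).
  move=> hs; have := green hS hs.
  rewrite (adjoint_graph hs h) subrr => /esym/eqP.
  by rewrite subr_eq0 => /eqP.
split.
  have [s [s' [hs e0 e1]]] := Gamma_surj 0 (Gamma0 x).
  by have := e _ _ hs; rewrite e0 e1 ip0r => /esym/ip_eq0.
have [s [s' [hs e0 e1]]] := Gamma_surj (Gamma1 x) 0.
by have := e _ _ hs; rewrite e0 e1 ip0r => /ip_eq0.
Qed.

(** The range of [S - i] is closed and its orthogonal complement is contained in the kernel of
    [S^* + i]. *)
Lemma shift_range_orth h : (forall f, Ss (f, - 'i%C *: f) -> ip h f = 0) ->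
  exists s, S (s, h + 'i%C *: s).
Proof.
move=> ho.
have [p [[s hs] hp]] := projection hip (shift_range_subspace 'i%C hSop)
  S_shift_closed h.
have g0 : Ss (h - p, - 'i%C *: (h - p)).
  apply/adjointE => a b Sab; have := hp (b - 'i%C *: a).
  have Rb : shift_range S 'i%C (b - 'i%C *: a) by exists a; rewrite subrK.
  move=> /(_ Rb) /ip_orthC; rewrite ipBl ipZl ipZr conjN => /eqP.
  rewrite subr_eq0 => /eqP ->; congr (_ * _).
  by apply/eqP; rewrite eq_complex /= oppr0 opprK !eqxx.
suff -> : h = p by exists s.
apply/eqP; rewrite -subr_eq0; apply/eqP/(ip_eq0 (ip := ip)).
have Rp : shift_range S 'i%C p by exists s.
by rewrite {1}ipBl (ho _ g0) (ip_orthC (hp _ Rp)) subr0.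
Qed.

Lemma S_GammaP x y : S (x, y) <-> [/\ Ss (x, y), Gamma0 x = 0 & Gamma1 x = 0].
Proof.
split=> [h|[h h0 h1]].
  by have [] := S_Gamma_eq0 h; split=> //; exact: S_adjoint.
(* [y - i x] is orthogonal to [ker (S^* + i)], hence in the range of [S - i];
   the preimage differs from [x] by an element of [ker (S^* - i)] that has
   vanishing boundary values. *)
pose w := y - 'i%C *: x.
have [s hs] : exists s, S (s, w + 'i%C *: s).
  apply: shift_range_orth => f hf; have := green h hf.
  rewrite h0 h1 !ip0l subrr ipZr /w ipBl ipZl => e; rewrite -[RHS]e.
  by congr (_ - _ * _); apply/eqP; rewrite eq_complex /= oppr0 opprK !eqxx.
have hd : Ss (x - s, 'i%C *: (x - s)).
  have := operator_sub oSs h (S_adjoint hs); congr (Ss (_, _)).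
  by rewrite /w; vec ip.
have hSs := S_adjoint hs; have [s0 s1] := S_Gamma_eq0 hs.
have d0 : Gamma0 (x - s) = 0 by rewrite (Gamma0B h hSs) h0 s0 subr0.
have d1 : Gamma1 (x - s) = 0 by rewrite (Gamma1B h hSs) h1 s1 subr0.
have := green hd hd; rewrite d0 d1 !ip0l subrr ipZl ipZr -mulrBl.
move=> /eqP; rewrite mulf_eq0 => /orP[|/eqP/ip_eq0/eqP].
  by rewrite eq_complex /= => /andP[_]; rewrite opprK -mulr2n mulrn_eq0 oner_eq0.
rewrite subr_eq0 => /eqP xs; have [_ _ fS] := oSs.
by move: h; rewrite xs => h; rewrite (fS _ _ _ h hSs).
Qed.

Lemma A0_operator : is_operator B0.
Proof.
have [h0 hl hf] := oSs; split.
- by split=> //=; exact: Gamma00.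
- move=> a [x x'] [y y'] [/= hx x0] [/= hy y0]; split; first exact: (hl a _ _ hx hy).
  by rewrite /= (Gamma0_lin a hx hy) x0 y0 scaler0 addr0.
- by move=> x y t [/= hy _] [/= ht _]; exact: hf hy ht.
Qed.

(** An element [x] of the adjoint's domain lies in that of [S^*]; Green's identity against [s] with
    boundary values [(0, Gamma0 x)] forces [Gamma0 x = 0]. *)
Lemma A0_selfadjoint : selfadjoint ip B0.
Proof.
apply/seteqP; split=> [[x y] h|[x y] [/= hx x0]].
  have hS : Ss (x, y).
    by apply/adjointE => s t /S_GammaP[Sst s0 _]; apply: (adjoint_graph h).
  split=> //=.
  have [s [s' [hs e0 e1]]] := Gamma_surj 0 (Gamma0 x).
  have := green hs hS; rewrite e0 e1 ip0l subr0.
  have B0s : B0 (s, s') by [].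
  by rewrite (adjoint_graph h B0s) subrr => /esym/ip_eq0.
apply/adjointE => s t [/= hs s0]; have := green hs hx.
by rewrite s0 x0 ip0l ip0r subrr => /eqP; rewrite subr_eq0 => /eqP.
Qed.

Lemma A0_symmetric : B0 `<=` adjoint ip B0.
Proof. by rewrite A0_selfadjoint. Qed.

(** * The resolvent of [A0] and the kernels of [S^* - z] *)

Local Notation rho0 := (resolvent_set B0).

Lemma A0_bound_resolvent z (c : R) : 0 < c ->
  (forall x y, B0 (x, y) -> c * nrm x <= nrm (y - z *: x)) ->
  (forall x y, B0 (x, y) -> c * nrm x <= nrm (y - (z^*)%R *: x)) ->
  exists T : {linear H -> H}, [/\ forall h, nrm (T h) <= c^-1 * nrm h,
    forall h, B0 (T h, h + z *: T h) &
    forall x, B0 (x, z *: x) -> x = 0].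
Proof.
move=> c0 h1 h2.
apply: (selfadjoint_resolvent hip A0_operator A0_selfadjoint c0 h1).
move=> x /h2; rewrite subrr nrm0 pmulr_rle0 // => h.
by apply: nrm_eq0; apply/eqP; rewrite eq_le h nrm_ge0.
Qed.

Lemma A0_nonreal z : Im z != 0 ->
  exists T : {linear H -> H}, [/\ forall h, nrm (T h) <= `|Im z|^-1 * nrm h,
    forall h, B0 (T h, h + z *: T h) &
    forall x, B0 (x, z *: x) -> x = 0].
Proof.
move=> z0; apply: A0_bound_resolvent; first by rewrite normr_gt0.
  by move=> x y /(symmetric_nonreal_bound hip z A0_symmetric).
move=> x y /(symmetric_nonreal_bound hip (z^*)%R A0_symmetric).
by rewrite conjE /= normrN.
Qed.

Lemma nonreal_rho0 z : Im z != 0 -> rho0 z.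
Proof.
move=> /A0_nonreal[T [h1 h2 h3]]; apply/(resolvent_setP _ A0_operator); exists T.
by split=> //; apply/bounded_nrm; exists `|Im z|^-1.
Qed.

Lemma rho0_conj z : rho0 z -> rho0 (z^*)%R.
Proof.
have [z0|z0] := eqVneq (Im z) 0; last first.
  by move=> _; apply: nonreal_rho0; rewrite conjE /= oppr_eq0.
by rewrite conjE z0 oppr0; case: z z0 => a b /= ->.
Qed.

(** A resolvent bound [c] at [r] gives the bound [2 c] at distance less than [1 / (2 c)]. Its
    uniformity yields the Lipschitz estimate for [m]. *)
Lemma rho0_open (r : R) : rho0 r%:C -> exists d C : R, [/\ 0 < d, 0 < C &
  forall p : R, `|p - r| < d -> exists T : {linear H -> H},
    [/\ forall h, nrm (T h) <= C * nrm h,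
    forall h, B0 (T h, h + p%:C *: T h) &
    forall x, B0 (x, p%:C *: x) -> x = 0]].
Proof.
move=> /(resolvent_setP _ A0_operator)[T [/bounded_nrm_pos[c c0 hc] h1 h2]].
exists (2 * c)^-1, (2 * c); split; [by rewrite invr_gt0 mulr_gt0|by rewrite mulr_gt0|].
move=> p hp.
have key x y : B0 (x, y) -> (2 * c)^-1 * nrm x <= nrm (y - p%:C *: x).
  move=> hx; rewrite ler_pdivrMl ?mulr_gt0 //.
  have e : x = T (y - r%:C *: x).
    apply/eqP; rewrite -subr_eq0; apply/eqP/h2.
    have := operator_sub A0_operator hx (h1 (y - r%:C *: x)).
    by congr (B0 (_, _)); vec ip.
  have h3 := hc (y - r%:C *: x); rewrite -e in h3.
  have h4 : nrm (y - r%:C *: x) <= nrm (y - p%:C *: x) + `|p - r| * nrm x.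
    have -> : y - r%:C *: x = (y - p%:C *: x) + (p - r)%:C *: x.
      by rewrite rmorphB; vec ip.
    apply: le_trans (nrmD _ _) _; rewrite lerD2l nrmZ.
    by rewrite normc_def /= expr0n addr0 sqrtr_sqr.
  have h5 : `|p - r| * nrm x <= (2 * c)^-1 * nrm x.
    by rewrite ler_wpM2r ?nrm_ge0 // ltW.
  have h6 : c * ((2 * c)^-1 * nrm x) = nrm x / 2 by field; rewrite gt_eqF.
  have h7 : c * nrm (y - r%:C *: x) <= c * nrm (y - p%:C *: x) + nrm x / 2.
    by rewrite -h6 -mulrDr ler_wpM2l ?(ltW c0) // (le_trans h4) // lerD2l.
  by rewrite -mulrA; lra.
have := A0_bound_resolvent (z := p%:C) (c := (2 * c)^-1).
rewrite invr_gt0 mulr_gt0 // => /(_ isT key); rewrite conj_realE => /(_ key).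
by rewrite invrK.
Qed.

Lemma ker_rho0_inj z x : rho0 z -> Ss (x, z *: x) -> Gamma0 x = 0 -> x = 0.
Proof. by move=> /(resolvent_setP _ A0_operator)[T [_ _ h]] hx x0; apply: h. Qed.

(** Any [g] with [Gamma0 g = u] is corrected by the resolvent of [A0], which leaves [Gamma0]
    unchanged. With [ker_rho0_inj], [Gamma0] is a bijection from the kernel of [S^* - z] onto
    [K]. *)
Lemma ker_rho0_surj z u : rho0 z -> exists f, Ss (f, z *: f) /\ Gamma0 f = u.
Proof.
move=> /(resolvent_setP _ A0_operator)[T [_ h _]].
have [g [g' [hg e0 _]]] := Gamma_surj u 0.
have [hT T0] := h (g' - z *: g).
exists (g - T (g' - z *: g)); split; last by rewrite (Gamma0B hg hT) T0 subr0.
have := operator_sub oSs hg hT; congr (Ss (_, _)) => /=.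
by vec ip.
Qed.

(** * The Weyl function and Krein's determinant *)

Variable m : R[i] -> R[i].
Hypothesis hm : forall z f, rho0 z -> Ss (f, z *: f) -> Gamma1 f = m z *: Gamma0 f.

Lemma weyl_green z w f g : rho0 z -> rho0 w -> Ss (f, z *: f) -> Ss (g, w *: g) ->
  (z - (w^*)%R) * ip f g = (m z - ((m w)^*)%R) * ipK (Gamma0 f) (Gamma0 g).
Proof.
move=> hz hw hf hg; have := green hf hg.
by rewrite (hm hz hf) (hm hw hg) !ipZl !ipZr -!mulrBl.
Qed.

Variable e : 'I_2 -> K.
Hypothesis he : orthonormal_basis ipK e.

Definition coord u : 'cV[R[i]]_2 := \col_j ipK u (e j).
Definition of_coord (c : 'cV[R[i]]_2) : K := \sum_i c i 0 *: e i.

Lemma coordD u v : coord (u + v) = coord u + coord v.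
Proof. by apply/colP => j; rewrite !mxE ipDl. Qed.
Lemma coordZ a u : coord (a *: u) = a *: coord u.
Proof. by apply/colP => j; rewrite !mxE ipZl. Qed.
Lemma coordN u : coord (- u) = - coord u.
Proof. by apply/colP => j; rewrite !mxE ipNl. Qed.
Lemma coord0 : coord 0 = 0.
Proof. by apply/colP => j; rewrite !mxE ip0l. Qed.

Lemma of_coordK c : coord (of_coord c) = c.
Proof.
apply/colP => j; rewrite !mxE ip_suml (bigD1 j) //= big1 ?addr0.
  by rewrite ipZl he.1 eqxx mulr1.
by move=> i ij; rewrite ipZl he.1 (negPf ij) mulr0.
Qed.

Lemma coord_inj u v : coord u = coord v -> u = v.
Proof.
move=> h; apply/eqP; rewrite -subr_eq0; apply/eqP.
have o i : ipK (e i) (u - v) = 0.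
  have /colP/(_ i) := h; rewrite !mxE => hi; apply: ip_orthC.
  by rewrite ipBl hi subrr.
apply: (ip_eq0 (ip := ipK)).
have : linear_span (range e) (u - v) by rewrite he.2.
move=> [n [c [k [hk E]]]]; rewrite {1}E ip_suml big1 // => i _.
by have [j _ <-] := hk i; rewrite ipZl o mulr0.
Qed.

Lemma coordK u : of_coord (coord u) = u.
Proof. by apply: coord_inj; rewrite of_coordK. Qed.

Lemma coord_matrix_operator X u : coord (matrix_operator ipK e X u) = X *m coord u.
Proof.
rewrite -[RHS]of_coordK; congr coord; apply: eq_bigr => i _; congr (_ *: _).
by rewrite mxE; apply: eq_bigr => j _; rewrite mxE.
Qed.

Variable X : 'M[R[i]]_2.

Definition matrix_extension : set (H * H) :=
  op_restrict Ss [set f | matrix_operator ipK e X (Gamma1 f + 'i%C *: Gamma0 f) =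
                          Gamma1 f - 'i%C *: Gamma0 f].
Local Notation A := matrix_extension.

Lemma matrix_extensionP x y : A (x, y) <-> Ss (x, y) /\
  X *m (coord (Gamma1 x) + 'i%C *: coord (Gamma0 x)) =
  coord (Gamma1 x) - 'i%C *: coord (Gamma0 x).
Proof.
rewrite -!coordZ -coordD -coordN -coordD -coord_matrix_operator.
split=> [[h /= ->] //|[h /coord_inj h']]; by split.
Qed.

(** On the kernel of [S^* - z], where [Gamma1 = m z Gamma0], the boundary condition says that this
    matrix at [w = m z] annihilates [Gamma0]. *)
Definition krein_mx w : 'M[R[i]]_2 := (w + 'i%C) *: X - (w - 'i%C)%:M.

Lemma eigenvectorP z f : rho0 z -> Ss (f, z *: f) ->
  (A (f, z *: f) <-> krein_mx (m z) *m coord (Gamma0 f) = 0).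
Proof.
move=> hz hf; rewrite matrix_extensionP (hm hz hf) coordZ -scalerDl -scalerBl.
rewrite -scalemxAr mulmxBl -scalemxAl mul_scalar_mx.
split=> [[_ ->]|/eqP]; first by rewrite subrr.
by rewrite subr_eq0 => /eqP.
Qed.

Lemma eigenvalue_det z : rho0 z ->
  ((exists2 x, x != 0 & A (x, z *: x)) <-> \det (krein_mx (m z)) = 0).
Proof.
move=> hz; split=> [[x x0 hx]|/eqP].
  have hS : Ss (x, z *: x) by case/matrix_extensionP: hx.
  have /eigenvectorP := hx => /(_ hz hS) hk.
  apply/eqP; rewrite -det_tr; apply/det0P; exists ((coord (Gamma0 x))^T).
    rewrite -trmx0; apply: contraNneq x0 => /trmx_inj h0.
    apply/eqP/(ker_rho0_inj hz hS).
    by apply: coord_inj; rewrite h0 coord0.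
  by rewrite -trmx_mul hk trmx0.
rewrite -det_tr => /det0P[v v0 hv].
have [f [hf f0]] := ker_rho0_surj (of_coord v^T) hz.
exists f.
  apply: contraNneq v0 => ff.
  rewrite -[v]trmxK -(of_coordK v^T) -f0 ff Gamma00 coord0.
  by rewrite trmx0.
apply/eigenvectorP => //; rewrite f0 of_coordK; apply: trmx_inj.
by rewrite trmx_mul trmxK hv trmx0.
Qed.

Lemma ker_expand z (f : 'I_2 -> H) x : rho0 z ->
  (forall i, Ss (f i, z *: f i) /\ Gamma0 (f i) = e i) -> Ss (x, z *: x) ->
  x = \sum_i coord (Gamma0 x) i 0 *: f i.
Proof.
move=> hz hf hx; apply/eqP; rewrite -subr_eq0; apply/eqP.
have hs (c : 'I_2 -> R[i]) :
    Ss (\sum_i c i *: f i, z *: \sum_i c i *: f i) /\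
    Gamma0 (\sum_i c i *: f i) = \sum_i c i *: e i.
  split.
    have := operator_sum c oSs (fun i => (hf i).1).
    congr (Ss (_, _)); rewrite scaler_sumr; apply: eq_bigr => i _.
    by rewrite !scalerA mulrC.
  have h i : Ss (c i *: f i, c i *: (z *: f i)).
    exact: operator_scale oSs (hf i).1.
  rewrite !big_ord_recl !big_ord0 !addr0 (Gamma0D (h _) (h _)).
  by rewrite !(Gamma0Z _ (hf _).1) !(hf _).2.
have [h1 h2] := hs (fun i => coord (Gamma0 x) i 0).
apply: (ker_rho0_inj hz).
  by rewrite scalerBr; exact: operator_sub oSs hx h1.
by rewrite (Gamma0B hx h1) h2 -[X in X - _]coordK subrr.
Qed.

Hypothesis oA : is_operator A.

(* Krein's formula: the resolvent is that of [A0] plus a finite rank term. *)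
Lemma krein_resolvent z : rho0 z -> \det (krein_mx (m z)) != 0 ->
  resolvent_set A z.
Proof.
move=> hz hd; apply/(resolvent_setP _ oA).
have hzc := rho0_conj hz.
have := hz; move=> /(resolvent_setP _ A0_operator).
move=> [T [/bounded_nrm bT hT _]].
have /choice[f hf] := fun i => ker_rho0_surj (e i) hz.
have /choice[g hg] := fun i => ker_rho0_surj (e i) hzc.
pose D := krein_mx (m z).
have uD : D \in unitmx by rewrite unitmxE unitfE.
(* [T h] has boundary values [(0, be)]; adding a kernel element with boundary values [(al, m z al)]
   satisfies the condition of [A] exactly when [D al = (1 - X) be]. *)
pose Y := invmx D *m (1%:M - X).
pose F h := T h + \sum_i (\sum_j Y i j * ip h (g j)) *: f i.
have lF a x y : F (a *: x + y) = a *: F x + F y.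
  rewrite /F !big_ord_recl !big_ord0 linearD linearZ.
  by rewrite !(ipDl, ipZl); vec ip.
have [L hL] := linear_map_of lF; exists L; split.
- apply/bounded_nrm.
  suff [c hc] : bounded_map F by exists c => x; rewrite hL.
  apply: bounded_mapD => //.
  rewrite (_ : (fun x => _) = fun x =>
     (Y 0 0 *: (ip x (g 0) *: f 0) + Y 0 1 *: (ip x (g 1) *: f 0)) +
     (Y 1 0 *: (ip x (g 0) *: f 1) + Y 1 1 *: (ip x (g 1) *: f 1))).
    by do 3?apply: bounded_mapD; apply: bounded_mapZ; exact: bounded_map_rank1.
  apply/funext => x; rewrite !big_ord_recl !big_ord0 !addr0.
  rewrite (_ : lift ord0 ord0 = 1); last exact/val_inj.
  by rewrite !scalerDl !scalerA.
- move=> h; rewrite hL.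
  have [hT1 hT0] : Ss (T h, h + z *: T h) /\ Gamma0 (T h) = 0 by exact: hT.
  set be := coord (Gamma1 (T h)).
  (* Green's identity with the kernel at the conjugate point expresses [Gamma1 (T h)] by inner
     products of [h], which makes the correction bounded. *)
  have beE j : be j 0 = ip h (g j).
    have [hg1 hg0] := hg j.
    rewrite mxE -hg0; have := green hT1 hg1.
    rewrite hT0 ip0l subr0 => <-.
    by rewrite ipDl ipZl ipZr conjK addrK.
  have al : \sum_i (\sum_j Y i j * ip h (g j)) *: f i =
      \sum_i (Y *m be) i 0 *: f i.
    by apply: eq_bigr => i _; rewrite mxE; congr (_ *: _); apply: eq_bigr => j _; rewrite beE.
  rewrite /F al.
  have [k [hk k0]] := ker_rho0_surj (of_coord (Y *m be)) hz.
  have kE : k = \sum_i (Y *m be) i 0 *: f i.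
    by rewrite [LHS](ker_expand hz hf hk) k0 of_coordK.
  rewrite -kE.
  apply/matrix_extensionP; split.
    by have := operator_add oSs hT1 hk; congr (Ss (_, _)); vec ip.
  rewrite (Gamma0D hT1 hk) (Gamma1D hT1 hk) hT0 add0r (hm hz hk).
  rewrite k0 coordD coordZ -/be of_coordK.
  set al' := Y *m be.
  have hD : D *m al' = be - X *m be.
    by rewrite /al' /Y !mulmxA mulmxV // mul1mx mulmxBl mul1mx.
  move: hD; rewrite /D /krein_mx mulmxBl -scalemxAl mul_scalar_mx => hD.
  rewrite -addrA -addrA -scalerDl -scalerBl mulmxDr -scalemxAr.
  apply/eqP; rewrite -subr_eq0; move/eqP: hD; rewrite -subr_eq0 => /eqP <-.
  apply/eqP; move: (X *m be) (X *m al') => P Q.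
  by apply/matrixP => i j; rewrite !mxE; ring.
move=> x hx; apply/eqP; apply: contraNT hd => x0; apply/eqP.
by apply/(eigenvalue_det hz); exists x.
Qed.

Lemma det_krein_mx w : \det (krein_mx w) =
  (\det X - \tr X + 1) * w ^+ 2 + (2 * 'i%C * (\det X - 1)) * w
  + (- \det X - \tr X - 1).
Proof.
have i2 : 'i%C * 'i%C = -1 :> R[i] by rewrite -expr2 sqr_i.
rewrite !det_mx2 /mxtrace !big_ord_recl big_ord0 !mxE /=.
rewrite (_ : lift ord0 ord0 = 1); last exact/val_inj.
rewrite (_ : ord0 = 0); last exact/val_inj.
by rewrite mulr0n mulr1n; ring: i2.
Qed.

Lemma weyl_locally_injective (r : R) : rho0 r%:C -> exists d C : R,
  [/\ 0 < d, 0 < C & forall p : R, `|p - r| < d -> p != r ->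
    [/\ rho0 p%:C, m p%:C != m r%:C & Re `|m p%:C - m r%:C| <= C * `|p - r|]].
Proof.
move=> hr; have [d [c [d0 c0 hd]]] := rho0_open hr.
have [f [hf f0]] := ker_rho0_surj (e 0) hr.
have e0 : ipK (e 0) (e 0) = 1 by rewrite he.1.
have fn0 : f != 0.
  apply/eqP => ff; have := oner_eq0 R[i].
  by rewrite -e0 -f0 ff Gamma00 ip0l eqxx.
have nf := nrm_gt0 fn0.
have mr : ((m r%:C)^*)%R = m r%:C.
  have := weyl_green hr hr hf hf; rewrite conj_realE subrr mul0r f0 e0 mulr1.
  by move=> /esym/eqP; rewrite subr_eq0 => /eqP.
(* Within [1 / (2 c)] the term [(p - r) (T f, f)] is at most [|f| ^ 2 / 2] in modulus, so [(fp, f)]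
   is nonzero and bounded by [2 |f| ^ 2]. *)
exists (Num.min d (2 * c)^-1), (2 * nrm f ^+ 2); split.
- by rewrite lt_min d0 invr_gt0 mulr_gt0.
- by rewrite mulr_gt0 // exprn_gt0.
move=> p; rewrite lt_min => /andP[pd pc] pr.
have [T [T1 T2 T3]] := hd p pd.
have hp : rho0 p%:C.
  apply/(resolvent_setP _ A0_operator); exists T; split=> //.
  by apply/bounded_nrm; exists c.
have [hT1 hT0] : Ss (T f, f + p%:C *: T f) /\ Gamma0 (T f) = 0 by exact: T2.
pose fp := f + (p - r)%:C *: T f.
have hcT := operator_scale (p - r)%:C oSs hT1.
have hfp : Ss (fp, p%:C *: fp).
  have := operator_add oSs hf hcT; congr (Ss (_, _)).
  by rewrite /fp rmorphB; vec ip.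
have fp0 : Gamma0 fp = e 0.
  by rewrite (Gamma0D hf hcT) (Gamma0Z _ hT1) hT0 scaler0 addr0.
have := weyl_green hp hr hfp hf.
rewrite conj_realE mr f0 fp0 e0 mulr1 -rmorphB /= => hmm.
have ipE : ip fp f = (nrm f ^+ 2)%:C + (p - r)%:C * ip (T f) f.
  by rewrite ipDl ipZl (ip_nrm hip).
have small : Re `|(p - r)%:C * ip (T f) f| < nrm f ^+ 2.
  rewrite Re_normM.
  have -> : Re `|(p - r)%:C| = `|p - r|.
    by rewrite normc_def /= expr0n addr0 sqrtr_sqr.
  have h1 := CauchySchwarz_Re hip (T f) f.
  have h2 : nrm (T f) * nrm f <= c * nrm f * nrm f by rewrite ler_wpM2r ?nrm_ge0.
  have h3 : `|p - r| * Re `|ip (T f) f| <= (2 * c)^-1 * (c * nrm f * nrm f).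
    by apply: ler_pM; rewrite ?Re_norm_ge0 ?(ltW pc) // (le_trans h1).
  apply: (le_lt_trans h3).
  have -> : (2 * c)^-1 * (c * nrm f * nrm f) = nrm f ^+ 2 / 2.
    by field; rewrite gt_eqF.
  by rewrite ltr_pdivrMr // ltr_pMr ?exprn_gt0 // ltr1n.
split; [exact: hp| |].
  rewrite -subr_eq0 -hmm mulf_neq0 //.
    by rewrite -(rmorph0 (real_complex R)) (inj_eq (@complexI R)) subr_eq0.
  apply/eqP; rewrite ipE => /eqP; rewrite addr_eq0 => /eqP h.
  move: small; rewrite -Re_normN -h normc_def /= expr0n addr0 sqrtr_sqr.
  by rewrite ger0_norm ?sqr_ge0 // ltxx.
rewrite [leLHS](_ : _ = Re `|(p - r)%:C * ip fp f|); last by rewrite hmm.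
rewrite Re_normM mulrC.
have -> : Re `|(p - r)%:C| = `|p - r|.
  by rewrite normc_def /= expr0n addr0 sqrtr_sqr.
rewrite ler_wpM2r // ipE; apply: le_trans (Re_normD _ _) _.
have -> : Re `|(nrm f ^+ 2)%:C| = nrm f ^+ 2.
  by rewrite normc_def /= expr0n addr0 sqrtr_sqr ger0_norm ?sqr_ge0.
by rewrite mulr_natl mulr2n lerD2l ltW.
Qed.

(** * Spectral consequences of the positive form [G], which stands for [J C] *)

Hypothesis detX : \det X != 0.
Variable G : {linear H -> H}.
Hypothesis Gpos : forall x, x != 0 -> 0 < ip (G x) x.
Hypothesis Gsym : forall x y x' y', A (x, y) -> A (x', y') ->
  ip y (G x') = ip x (G y').

Lemma G_eigenvalue_real z x : A (x, z *: x) -> x != 0 -> z \is Num.real.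
Proof.
move=> hx x0; have := Gsym hx hx.
rewrite linearZ ipZl ipZr => /eqP; rewrite -subr_eq0 -mulrBl mulf_eq0 => /orP[].
  by rewrite subr_eq0 => /eqP/esym/conj_eq_real.
by move=> /eqP/ip_orthC h; have := Gpos x0; rewrite h ltxx.
Qed.

Lemma spectrum_matrix_extension_real z : spectrum A z -> z \is Num.real.
Proof.
move=> hz; rewrite real_ImE; apply/negP => /negP z0; apply: hz.
have hz := nonreal_rho0 z0.
apply: krein_resolvent => //; apply/eqP => /(eigenvalue_det hz)[x x0 hx].
by have := G_eigenvalue_real hx x0; rewrite real_ImE (negPf z0).
Qed.

(** If [(A - r) a = b] and [(A - r) b = 0], symmetry gives [(b, G b) = 0]: there are no Jordan
    chains of length two. *)
Lemma G_root_subspace (r : R[i]) : (r^*)%R = r ->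
  root_subspace A r = [set x | A (x, r *: x)].
Proof.
move=> rr; apply/seteqP; split=> x /=; last first.
  move=> hx; exists 1%N; exists x; split=> //=.
  by rewrite /op_shift /= add0r.
have key (a b : H) : A (a, b + r *: a) -> A (b, r *: b) -> b = 0.
  move=> hab hb; have := Gsym hb hab.
  rewrite linearD linearZ ipDr ipZl ipZr rr => /eqP.
  rewrite -subr_eq0 opprD addrCA subrr addr0 oppr_eq0 => /eqP/ip_orthC h.
  by apply/eqP; apply: contra_eqT h => /Gpos; rewrite lt_def => /andP[].
move=> [n]; rewrite /op_kernel /=.
have A00 : A (0, r *: 0) by rewrite scaler0; case: oA.
elim: n => [|[|n] IH].
- by rewrite /op_graph /= => <-.
- move=> [z []]; rewrite /op_graph /op_shift /= => ->.
  by rewrite add0r.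
- move=> [z [[z' [h1 h2]] h3]]; apply: IH.
  move: h2 h3; rewrite /op_shift /= add0r => h2 h3.
  by exists z'; split=> //; rewrite /op_shift /= -(key _ _ h2 h3).
Qed.

Lemma eigenspace_has_dim (r : R[i]) : rho0 r ->
  exists n, has_dim n [set x | A (x, r *: x)].
Proof.
move=> hr.
have /choice[f hf] := fun i => ker_rho0_surj (e i) hr.
pose D := krein_mx (m r).
(* In the coordinates of [Gamma0] the eigenspace is the kernel of [D]; transposing presents it by
   row vectors. *)
pose N := row_base (kermx D^T).
exists (\rank (kermx D^T)), (fun i => \sum_j N i j *: f j).
have fsum (c : 'I_2 -> R[i]) : Ss (\sum_j c j *: f j, r *: \sum_j c j *: f j) /\
    coord (Gamma0 (\sum_j c j *: f j)) = \col_j c j.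
  have h i : Ss (c i *: f i, c i *: (r *: f i)).
    exact: operator_scale oSs (hf i).1.
  split.
    have := operator_sum c oSs (fun i => (hf i).1); congr (Ss (_, _)).
    rewrite scaler_sumr; apply: eq_bigr => i _; by rewrite !scalerA mulrC.
  rewrite -[RHS]of_coordK; congr coord; rewrite /of_coord.
  rewrite !big_ord_recl !big_ord0 !addr0 (Gamma0D (h _) (h _)).
  by rewrite !(Gamma0Z _ (hf _).1) !(hf _).2 !mxE.
have comb k (c : 'I_k -> R[i]) (P : 'M[R[i]]_(k, 2)) :
    \sum_i c i *: (\sum_j P i j *: f j) =
    \sum_j ((\row_i c i) *m P) 0 j *: f j.
  under eq_bigr do rewrite scaler_sumr.
  rewrite exchange_big /=; apply: eq_bigr => j _; rewrite mxE scaler_suml.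
  by apply: eq_bigr => i _; rewrite mxE scalerA.
have frow (c : 'rV[R[i]]_2) : \sum_j c 0 j *: f j = 0 -> c = 0.
  move=> h; have [_] := fsum (fun j => c 0 j); rewrite h Gamma00 coord0.
  by move=> h'; apply/rowP => j; have /colP/(_ j) := h'; rewrite !mxE => <-.
have Efree : row_free N by exact: row_base_free.
split.
  move=> c; rewrite comb => /frow h i.
  have /rowP/(_ i) : \row_i c i = 0.
    by apply: (row_free_inj Efree); rewrite h mul0mx.
  by rewrite !mxE.
have mem (c : 'rV[R[i]]_2) : A (\sum_j c 0 j *: f j, r *: \sum_j c 0 j *: f j) <->
    (c <= kermx D^T)%MS.
  have [h1 h2] := fsum (fun j => c 0 j).
  rewrite (eigenvectorP hr h1) h2 sub_kermx.
  have -> : \col_j c 0 j = c^T by apply/colP => j; rewrite !mxE.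
  rewrite (_ : c *m D^T = (D *m c^T)^T); last by rewrite trmx_mul trmxK.
  split=> [->|/eqP]; first by rewrite trmx0.
  by rewrite -trmx0 => /trmx_inj.
apply/seteqP; split=> x /=.
  move=> [k [c [v [hv ->]]]].
  have [/= A00 lA _] := oA.
  have sub : forall k (c : 'I_k -> R[i]) (v : 'I_k -> H),
     (forall i, A (v i, r *: v i)) -> A (\sum_i c i *: v i, r *: \sum_i c i *: v i).
    move=> k' c' v' hv'; have := operator_sum c' oA hv'; congr (A (_, _)).
    by rewrite scaler_sumr; apply: eq_bigr => i _; rewrite !scalerA mulrC.
  apply: sub => i; have [i' _ <-] := hv i.
  have -> : \sum_j N i' j *: f j = \sum_j (row i' N) 0 j *: f j.
    by apply: eq_bigr => j _; rewrite [row _ _ _ _]mxE.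
  by apply/mem; rewrite (submx_trans (row_sub _ _)) // eq_row_base.
move=> hx; have hS : Ss (x, r *: x) by case/matrix_extensionP: hx.
have xE := ker_expand hr hf hS.
have xE' : x = \sum_j (coord (Gamma0 x))^T 0 j *: f j.
  by rewrite [LHS]xE; apply: eq_bigr => j _; rewrite [_^T _ _]mxE.
have /mem : A (\sum_j (coord (Gamma0 x))^T 0 j *: f j,
               r *: \sum_j (coord (Gamma0 x))^T 0 j *: f j) by rewrite -xE'.
rewrite -(eq_row_base (kermx D^T)) => /submxP[c hc].
exists (\rank (kermx D^T)), (fun i => c 0 i), (fun i => \sum_j N i j *: f j).
split; first by move=> i; exists i.
rewrite comb [LHS]xE' hc (_ : \row_i c 0 i = c) //.
by apply/rowP => i; rewrite mxE.
Qed.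

Lemma discrete_spectrum_det (r : R[i]) : rho0 r ->
  (discrete_spectrum A r <-> \det (krein_mx (m r)) = 0).
Proof.
move=> hr.
have evP : (exists2 x, x != 0 & A (x, r *: x)) <-> Defs.eigenvalue A r.
  split=> [[x x0 hx]|[x [x0]]]; exists x => //.
    by split=> //; apply/op_kernel_shift.
  exact/op_kernel_shift.
split=> [[_ /evP/(eigenvalue_det hr) //]|hdet].
have [x x0 hx] := (eigenvalue_det hr).2 hdet.
have rreal := G_eigenvalue_real hx x0.
have [r' rE] : exists r' : R, r = r'%:C by exists (Re r); rewrite RRe_real.
have inspec : spectrum A r.
  move=> /(resolvent_setP _ oA)[_ [_ _ h]].
  by move: x0; rewrite (h _ hx) eqxx.
split; [|by apply/evP; exists x|]; last first.
  rewrite G_root_subspace; first exact: eigenspace_has_dim.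
  by rewrite rE conj_realE.
rewrite rE in hr hdet inspec *.
split; first exact/mem_set.
have [d [C [d0 C0 hd]]] := weyl_locally_injective hr.
have nz : exists w, (\det X - \tr X + 1) * w ^+ 2 + (2 * 'i%C * (\det X - 1)) * w
    + (- \det X - \tr X - 1) != 0.
  (* At [w = i] the matrix is [2 i X], which is invertible, so the quadratic is not identically
     zero. *)
  exists 'i%C; rewrite -det_krein_mx /krein_mx subrr raddf0 subr0 detZ.
  rewrite mulf_neq0 // expf_neq0 // -mulr2n mulrn_eq0 /=.
  by rewrite eq_complex /= oner_eq0 andbF.
rewrite det_krein_mx in hdet.
have [d' d'0 hd'] := quadratic_root_isolated nz hdet.
pose D := Num.min d (d' / C).
have D0 : 0 < D by rewrite lt_min d0 divr_gt0.
exists [set z : R[i]^o | `|z - r'%:C| < D%:C].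
  apply/nbhs_ballP; exists D%:C => /=; first by rewrite ltcR.
  by move=> z; rewrite -ball_normE /= distrC.
apply/seteqP; split=> z /=; last first.
  move=> ->; split=> //; rewrite subrr normr0 ltcR //.
(* The spectrum being real, only real neighbours have to be excluded, and there the Lipschitz bound
   keeps [m p] within [d'] of [m r']. *)
move=> [zD hz]; have /complex_realP[p pE] := spectrum_matrix_extension_real hz.
rewrite pE in zD hz *; congr (_%:C).
apply/eqP; apply: contra_notT hz => pr.
move: zD; rewrite -rmorphB /= normc_def /= expr0n addr0 sqrtr_sqr ltcR lt_min.
move=> /andP[pd pd'].
have [hp mp mC] := hd p pd pr.
apply: krein_resolvent => //; rewrite det_krein_mx; apply: hd' => //.
by apply: (le_lt_trans mC); rewrite mulrC -ltr_pdivlMr.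
Qed.

(** * Operators acting on boundary values *)

Definition boundary_operator (T : H -> H) (Tc : K -> K) : Prop :=
  forall x x', Ss (x, x') -> Gamma0 (T x) = Tc (Gamma0 x) /\ Gamma1 (T x) = Tc (Gamma1 x).

(** Every [w] equals [Gamma1 x + i Gamma0 x] for some [x] in the domain of [A], by surjectivity of
    the triplet; the boundary conditions of [x] and [T x] are then compared. *)
Lemma matrix_extension_commute (T : H -> H) (Tc : K -> K) (Y : 'M[R[i]]_2) :
  boundary_operator T Tc -> (forall u, coord (Tc u) = Y *m coord u) ->
  intertwines A T -> X *m Y = Y *m X.
Proof.
move=> hT hY hA.
have key (w : 'cV[R[i]]_2) : X *m (Y *m w) = Y *m (X *m w).
  have i0 : 'i%C != 0 :> R[i] by rewrite eq_complex /= oner_eq0 andbF.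
  have n2 : 2 != 0 :> R[i] by rewrite pnatr_eq0.
  have [a [b [e1 e2]]] : exists a b : 'cV[R[i]]_2,
      b + 'i%C *: a = w /\ b - 'i%C *: a = X *m w.
    exists ((2 * 'i%C)^-1 *: (w - X *m w)), (2^-1 *: (w + X *m w)).
    by move: (X *m w) => q; split; apply/matrixP => i j; rewrite !mxE; field.
  have [x [x' [hx x0 x1]]] := Gamma_surj (of_coord a) (of_coord b).
  have Ax : A (x, x').
    by apply/matrix_extensionP; split=> //; rewrite x0 x1 !of_coordK e1 e2.
  have /matrix_extensionP[_] := hA _ _ Ax.
  have [-> ->] := hT _ _ hx; rewrite !hY x0 x1 !of_coordK.
  by rewrite scalemxAr -mulmxDr -mulmxBr e1 e2.
apply/trmx_inj/row_matrixP => i; rewrite !rowE !trmx_mul.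
have := congr1 trmx (key (delta_mx 0 i)^T).
by rewrite !trmx_mul trmxK !mulmxA.
Qed.

Lemma weyl_conj z : Im z != 0 -> m (z^*)%R = ((m z)^*)%R.
Proof.
move=> z0; have hz := nonreal_rho0 z0; have hzc := rho0_conj hz.
have [f [hf f0]] := ker_rho0_surj (e 0) hz.
have [g [hg g0]] := ker_rho0_surj (e 0) hzc.
have := weyl_green hz hzc hf hg.
rewrite conjK subrr mul0r f0 g0 he.1 eqxx mulr1 => /esym/eqP.
by rewrite subr_eq0 => /eqP ->; rewrite conjK.
Qed.

(** At [w = z] and for [Gamma0 f] a unit vector, [weyl_green] reads [Im z |f| ^ 2 = Im (m z)]. *)
Lemma weyl_Im z : 0 < Im z -> 0 < Im (m z).
Proof.
move=> z0; have hz : rho0 z by apply: nonreal_rho0; rewrite gt_eqF.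
have [f [hf f0]] := ker_rho0_surj (e 0) hz.
have e0 : ipK (e 0) (e 0) = 1 by rewrite he.1.
have fn0 : f != 0.
  apply/eqP => ff; have := oner_eq0 R[i].
  by rewrite -e0 -f0 ff Gamma00 ip0l eqxx.
have := weyl_green hz hz hf hf; rewrite f0 e0 mulr1 (ip_nrm hip).
have sub w : w - (w^*)%R = 0 +i* (2 * Im w).
  by case: w => a b; apply/eqP; rewrite eq_complex /= subrr opprK eqxx mulr_natl mulr2n eqxx.
rewrite !sub => -[_]; rewrite mul0r add0r -mulrA.
have n2 : 2 != 0 :> R by rewrite pnatr_eq0.
move=> /(mulfI n2) <-; rewrite mulr_gt0 // exprn_gt0 // nrm_gt0 //.
Qed.

Section NonConstant.
Variables (z1 z2 : R[i]).
Hypotheses (z1p : 0 < Im z1) (z2p : 0 < Im z2) (mz : m z1 != m z2).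

(* The kernels of [S^* - z] for three points with distinct values of [m] have
   linearly dependent boundary values, which forces [C] to act on them in the
   same way. *)
Lemma boundary_operator_exists (C : {linear H -> H}) :
  intertwines S C -> intertwines Ss C ->
  exists Cc : {linear K -> K}, boundary_operator C Cc.
Proof.
move=> SC SsC.
have n1 : Im z1 != 0 by rewrite gt_eqF.
have n2 : Im z2 != 0 by rewrite gt_eqF.
have h1 := nonreal_rho0 n1; have h2 := nonreal_rho0 n2.
(* The third point lies in the lower half plane, where [m] has negative imaginary part; its value
   thus differs from the other two. *)
have h3 := rho0_conj h1.
have /choice[f1 hf1] := fun u => ker_rho0_surj u h1.
have /choice[f2 hf2] := fun u => ker_rho0_surj u h2.
have /choice[f3 hf3] := fun u => ker_rho0_surj u h3.
pose m1 := m z1; pose m2 := m z2; pose m3 := m (z1^*)%R.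
have m3E : m3 = (m1^*)%R by exact: weyl_conj.
have i1 : 0 < Im m1 := weyl_Im z1p.
have i2 : 0 < Im m2 := weyl_Im z2p.
have i3 : Im m3 < 0 by rewrite m3E conjE /= oppr_lt0.
have m13 : m1 - m3 != 0.
  by rewrite subr_eq0; apply/eqP => h; move: i1; rewrite h ltNge (ltW i3).
have m23 : m2 - m3 != 0.
  by rewrite subr_eq0; apply/eqP => h; move: i2; rewrite h ltNge (ltW i3).
pose Cc u := Gamma0 (C (f1 u)).
have Cker z f : Ss (f, z *: f) -> Ss (C f, z *: C f).
  by move=> hf; have := SsC _ _ hf; rewrite linearZ.
have eqC u : Gamma0 (C (f2 u)) = Cc u.
  have [g1 e1] := hf1 u; have [g2 e2] := hf2 u; have [g3 e3] := hf3 u.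
  (* The coefficients have sum zero, also when weighted by [m1], [m2], [m3]; hence both boundary
     values of [s] vanish and [s] is in the domain of [S]. *)
  pose s := (m2 - m3) *: f1 u + ((m3 - m1) *: f2 u + (m1 - m2) *: f3 u).
  pose s' := (m2 - m3) *: (z1 *: f1 u) +
    ((m3 - m1) *: (z2 *: f2 u) + (m1 - m2) *: ((z1^*)%R *: f3 u)).
  have k1 := operator_scale (m2 - m3) oSs g1.
  have k2 := operator_scale (m3 - m1) oSs g2.
  have k3 := operator_scale (m1 - m2) oSs g3.
  have k23 := operator_add oSs k2 k3.
  have k123 := operator_add oSs k1 k23.
  have Ss0 : S (s, s').
    apply/S_GammaP; split=> //.
      rewrite (Gamma0D k1 k23) (Gamma0D k2 k3) (Gamma0Z _ g1) (Gamma0Z _ g2) (Gamma0Z _ g3).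
      by rewrite e1 e2 e3; vec ipK.
    rewrite (Gamma1D k1 k23) (Gamma1D k2 k3) (Gamma1Z _ g1) (Gamma1Z _ g2) (Gamma1Z _ g3).
    rewrite (hm h1 g1) (hm h2 g2) (hm h3 g3) e1 e2 e3 -/m1 -/m2 -/m3.
    by vec ipK.
  have [] := S_Gamma_eq0 (SC _ _ Ss0).
  have q1 := Cker _ _ g1; have q2 := Cker _ _ g2; have q3 := Cker _ _ g3.
  have l1 := operator_scale (m2 - m3) oSs q1.
  have l2 := operator_scale (m3 - m1) oSs q2.
  have l3 := operator_scale (m1 - m2) oSs q3.
  have l23 := operator_add oSs l2 l3.
  have Cs : C s = (m2 - m3) *: C (f1 u) + ((m3 - m1) *: C (f2 u) + (m1 - m2) *: C (f3 u)).
    by rewrite !linearD !linearZ.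
  rewrite Cs (Gamma0D l1 l23) (Gamma0D l2 l3) (Gamma0Z _ q1) (Gamma0Z _ q2) (Gamma0Z _ q3).
  rewrite (Gamma1D l1 l23) (Gamma1D l2 l3) (Gamma1Z _ q1) (Gamma1Z _ q2) (Gamma1Z _ q3).
  rewrite (hm h1 q1) (hm h2 q2) (hm h3 q3) -/m1 -/m2 -/m3.
  rewrite -/(Cc u); move: (Cc u) (Gamma0 (C (f2 u))) (Gamma0 (C (f3 u))) => a b c E0 E1.
  apply/eqP; rewrite -subr_eq0; apply/eqP.
  (* [m3] times the first relation minus the second eliminates [c]. *)
  have : ((m2 - m3) * (m1 - m3)) *: (b - a) = 0.
    rewrite (_ : _ *: _ =
      m3 *: ((m2 - m3) *: a + ((m3 - m1) *: b + (m1 - m2) *: c)) -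
      ((m2 - m3) *: (m1 *: a) + ((m3 - m1) *: (m2 *: b) + (m1 - m2) *: (m3 *: c)))).
      by rewrite E0 E1 scaler0 subrr.
    by clear E0 E1; vec ipK.
  by move=> /eqP; rewrite scaler_eq0 mulf_eq0 (negPf m13) (negPf m23) => /eqP.
have Clin a u v : Cc (a *: u + v) = a *: Cc u + Cc v.
  have [g1 e1] := hf1 u; have [g2 e2] := hf1 v; have [g3 e3] := hf1 (a *: u + v).
  have k1 := operator_scale a oSs g1.
  have k := operator_add oSs k1 g2.
  have fE : f1 (a *: u + v) = a *: f1 u + f1 v.
    apply/eqP; rewrite -subr_eq0; apply/eqP; apply: (ker_rho0_inj h1).
      by have := operator_sub oSs g3 k; congr (Ss (_, _)); vec ip.
    by rewrite (Gamma0B g3 k) (Gamma0D k1 g2) (Gamma0Z _ g1) e1 e2 e3 subrr.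
  rewrite /Cc fE linearD linearZ.
  have q1 := Cker _ _ g1; have q2 := Cker _ _ g2.
  by rewrite (Gamma0D (operator_scale a oSs q1) q2) (Gamma0Z _ q1).
have [L hL] := linear_map_of Clin; exists L => x x' hx.
have [w1 [w2 [uE vE]]] := two_point_decomposition (Gamma0 x) (Gamma1 x) mz.
have [g1 e1] := hf1 w1; have [g2 e2] := hf2 w2.
have g12 := operator_add oSs g1 g2.
have hd := operator_sub oSs hx g12.
have Sd : S (x - (f1 w1 + f2 w2), x' - (z1 *: f1 w1 + z2 *: f2 w2)).
  apply/S_GammaP; split=> //.
    by rewrite (Gamma0B hx g12) (Gamma0D g1 g2) e1 e2 -uE subrr.
  rewrite (Gamma1B hx g12) (Gamma1D g1 g2) (hm h1 g1) (hm h2 g2) e1 e2.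
  by rewrite -vE subrr.
have [] := S_Gamma_eq0 (SC _ _ Sd).
have q1 := Cker _ _ g1; have q2 := Cker _ _ g2; have q12 := operator_add oSs q1 q2.
have qx := SsC _ _ hx.
rewrite linearB linearD (Gamma0B qx q12) (Gamma1B qx q12) (Gamma0D q1 q2) (Gamma1D q1 q2).
rewrite (hm h1 q1) (hm h2 q2) eqC -/(Cc w1).
move=> /eqP; rewrite subr_eq0 => /eqP -> /eqP; rewrite subr_eq0 => /eqP ->.
by rewrite uE vE -!hL !linearD !linearZ.
Qed.

End NonConstant.

(** * The case of a Weyl function constant on the upper half plane *)

Variables (J Rs : {linear H -> H}).
Hypotheses (hJ : fundamental_symmetry ip J) (hRs : fundamental_symmetry ip Rs).
Hypotheses (hJRs : anticommute J Rs).
Hypotheses (SJ : intertwines S J) (SR : intertwines S Rs).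
Hypothesis hSsimple : simple_operator ip S.

Lemma symmetry_adjoint (T : {linear H -> H}) : fundamental_symmetry ip T ->
  intertwines S T -> intertwines Ss T.
Proof.
move=> hT; apply: intertwines_adjoint => x y; exact: symmetry_sym.
Qed.

Lemma simple_orth x :
  (forall z f, Im z != 0 -> Ss (f, z *: f) -> ip f x = 0) -> x = 0.
Proof.
move=> h; apply: (dense_span_orth hip hSsimple) => f [z /= hz] /op_kernel_shift.
by apply: h; rewrite -real_ImE.
Qed.

(* The kernel of [S^* - z0] is approached by the kernels of [S^* - (z0 + p)]. *)
Lemma ker_orth_limit z0 x : Im z0 != 0 ->
  (forall p : R, 0 < p -> forall f, Ss (f, (z0 + p%:C) *: f) -> ip x f = 0) ->
  forall f, Ss (f, z0 *: f) -> ip x f = 0.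
Proof.
move=> z00 h f hf; apply: eq0_approx => d d0.
pose c := nrm x * (`|Im z0|^-1 * nrm f) + 1.
have c0 : 0 < c.
  by rewrite ltr_wpDl // !mulr_ge0 ?nrm_ge0 // invr_ge0.
pose p := d / c; have p0 : 0 < p by exact: divr_gt0.
have Imp : Im (z0 + p%:C) = Im z0 by rewrite ImD /= addr0.
have [|T [T1 T2 _]] := A0_nonreal (z := z0 + p%:C); first by rewrite Imp.
have [hT1 hT0] : Ss (T f, f + (z0 + p%:C) *: T f) /\ Gamma0 (T f) = 0 by exact: T2.
have hs := operator_scale p%:C oSs hT1.
have := operator_add oSs hf hs.
have -> : z0 *: f + p%:C *: (f + (z0 + p%:C) *: T f) =
   (z0 + p%:C) *: (f + p%:C *: T f) by vec ip.
move=> /(h _ p0); rewrite ipDr ipZr conj_realE => /eqP.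
rewrite addr_eq0 => /eqP ->; rewrite Re_normN Re_normM.
have -> : Re `|p%:C| = p.
  by rewrite normc_def /= expr0n addr0 sqrtr_sqr gtr0_norm.
have h1 := CauchySchwarz_Re hip x (T f).
have h2 := T1 f; rewrite Imp in h2.
have h3 : nrm x * nrm (T f) <= c.
  apply: (@le_trans _ _ (nrm x * (`|Im z0|^-1 * nrm f))); last by rewrite lerDl.
  by rewrite ler_wpM2l ?nrm_ge0.
apply: (@le_trans _ _ (p * c)).
  by rewrite ler_wpM2l ?(ltW p0) // (le_trans h1).
by rewrite /p divfK // gt_eqF.
Qed.

(** [J] is itself one of the symmetries [C], so [A'] commutes with it and [A'^* J = J A'] turns into
    [A'^* = A']. *)
Lemma Upsilon_selfadjoint A' : Upsilon ip J S A' -> selfadjoint ip A'.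
Proof.
move=> UA'.
have [AJ _ _] := Upsilon_intertwines hJ hRs hJRs hSop SJ SR UA'.
have [[_ _ [_ hA']] _] := UA'.
have JJ x := symmetry_invol x hJ.
apply/seteqP; split=> [[x y] Axy|[x y] Axy].
  have : opcomp (adjoint ip A') (op_graph J) (J x, y) by exists x; split=> //; rewrite /op_graph /= JJ.
  by rewrite hA' => -[z []]; rewrite /op_graph /= => /AJ; rewrite JJ => h ->.
have : opcomp (op_graph J) A' (J x, y) by exists (J y); split; [exact: AJ|rewrite /op_graph /= JJ].
by rewrite -hA' => -[z []]; rewrite /op_graph /= JJ => ->.
Qed.

(* If [m] is constant on the upper half plane, the kernels of [S^* - z] over the
   two half planes are orthogonal. The projection [P] onto the part of the space
   carried by the upper one then commutes with [S], which yields a symmetry [C]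
   mixing [P]; an operator in Upsilon commutes with [P], and then it has no
   room to be larger than [S], although [S] is not self-adjoint. *)
Lemma weyl_constant_Upsilon_empty A' : Upsilon ip J S A' ->
  ~ (forall z1 z2, 0 < Im z1 -> 0 < Im z2 -> m z1 = m z2).
Proof.
move=> UA' const.
have o1 : 0 < Im ('i%C : R[i]) by rewrite /= ltr01.
have ni : Im (- 'i%C : R[i]) < 0 by rewrite /= oppr_lt0 ltr01.
have Nker z w f g : 0 < Im z -> Im w < 0 -> Ss (f, z *: f) -> Ss (g, w *: g) ->
    ip f g = 0.
  move=> z0 w0 hf hg.
  have wn : Im w != 0 by rewrite lt_eqF.
  have key z' f' : 0 < Im z' -> z' != (w^*)%R -> Ss (f', z' *: f') -> ip f' g = 0.
    move=> z'0 zw hf'; have z'n : Im z' != 0 by rewrite gt_eqF.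
    have := weyl_green (nonreal_rho0 z'n) (nonreal_rho0 wn) hf' hg.
    rewrite -weyl_conj //.
    rewrite (const z' (w^*)%R) //; last by rewrite conjE /= oppr_gt0.
    rewrite subrr mul0r => /eqP; rewrite mulf_eq0 subr_eq0 (negPf zw) /=.
    by move=> /eqP.
  (* At [z = w^*] the factor [z - w^*] vanishes and Green's identity says nothing; the kernels at
     [z + p] replace it. *)
  have [zw|zw] := eqVneq z (w^*)%R; last exact: key zw hf.
  apply: ip_orthC; have zn : Im z != 0 by rewrite gt_eqF.
  apply: (ker_orth_limit zn) hf => p p0 f' hf'; apply: ip_orthC.
  apply: key hf'; first by rewrite ImD /= addr0.
  rewrite zw addrC -subr_eq0 addrK.
  by rewrite -(rmorph0 (real_complex R)) (inj_eq (@complexI R)) gt_eqF.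
pose N := [set x : H | forall z f, Im z < 0 -> Ss (f, z *: f) -> ip x f = 0].
have Ns : linear_subspace N.
  split=> [z f _ _|a x y hx hy z f z0 hf]; first by rewrite ip0l.
  by rewrite ipDl ipZl (hx _ _ z0 hf) (hy _ _ z0 hf) mulr0 addr0.
have Nc : seq_closed N.
  move=> u l hu hl z f z0 hf; apply: ip_orthC.
  rewrite -[RHS](ip0l ip l); apply: (ip_lim_eq hip (u := u) (v := u)) => // n.
  by rewrite ip0l; apply: ip_orthC; exact: hu z0 hf.
have [P [Pb PN Po Ps Pi]] := orthogonal_projection hip Ns Nc.
have kerN z f : 0 < Im z -> Ss (f, z *: f) -> N f.
  by move=> z0 hf w g w0 hg; exact: Nker hf hg.
(* By simplicity a vector is determined by its products with the kernels over the two half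
   planes. *)
have Pchar x (a : H) : N a ->
    (forall z f, 0 < Im z -> Ss (f, z *: f) -> ip (x - a) f = 0) -> P x = a.
  move=> Na hb; apply/eqP; rewrite -subr_eq0; apply/eqP/simple_orth => z f z0 hf.
  apply: ip_orthC; have [zp|zn] := ltP 0 (Im z).
    rewrite (_ : P x - a = (x - a) - (x - P x)); last by vec ip.
    by rewrite ipBl (hb _ _ zp hf) (Po _ _ (kerN _ _ zp hf)) subrr.
  have {}zn : Im z < 0 by rewrite lt_neqAle z0.
  by rewrite ipBl (PN x _ _ zn hf) (Na _ _ zn hf) subrr.
have Pcomm (T : {linear H -> H}) : fundamental_symmetry ip T -> intertwines S T ->
    forall x, P (T x) = T (P x).
  move=> hT ST x; have SsT := symmetry_adjoint hT ST.
  have Tker z f : Ss (f, z *: f) -> Ss (T f, z *: T f).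
    by move=> /SsT; rewrite linearZ.
  apply: Pchar => [z f z0 hf|z f z0 hf].
    by rewrite (symmetry_sym _ _ hT); exact: (PN x) z0 (Tker _ _ hf).
  rewrite -linearB (symmetry_sym _ _ hT); apply: Po; exact: kerN z0 (Tker _ _ hf).
(* Write [h = (S - i) x]. Both [P h] and [h - P h] are orthogonal to the kernel of [S^* + i], hence
   equal [(S - i) s] and [(S - i) t]; then [x = s + t] and [P x = s]. *)
have SP : intertwines S P.
  move=> x y Sxy.
  pose h := y - 'i%C *: x.
  have ci : ((- 'i%C : R[i])^*)%R = 'i%C.
    by apply/eqP; rewrite eq_complex /= oppr0 opprK !eqxx.
  have ho f : Ss (f, - 'i%C *: f) -> ip h f = 0.
    move=> hf; rewrite /h ipBl ipZl (adjoint_graph hf Sxy) ipZr ci subrr //.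
  have hp f : Ss (f, - 'i%C *: f) -> ip (P h) f = 0.
    by move=> hf; exact: (PN h) ni hf.
  have [s hs] := shift_range_orth hp.
  have hm' f : Ss (f, - 'i%C *: f) -> ip (h - P h) f = 0.
    by move=> hf; rewrite ipBl ho // hp // subrr.
  have [t ht] := shift_range_orth hm'.
  have st : x = s + t.
    apply/eqP; rewrite -subr_eq0; apply/eqP.
    have hd : S (x - (s + t), 'i%C *: (x - (s + t))).
      have := operator_sub hSop Sxy (operator_add hSop hs ht).
      by congr (S (_, _)); rewrite /h; vec ip.
    have := symmetric_nonreal_bound hip 'i%C hSsym hd.
    rewrite subrr nrm0 /= normr1 mul1r => h0.
    by apply: nrm_eq0; apply/eqP; rewrite eq_le h0 nrm_ge0.
  (* Orthogonality to an eigenvector passes from [(S - i) q] to [q] because [z^*] differs from [i];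
     the point [- i] is reached by a limit. *)
  have shift q k z f : S (q, k + 'i%C *: q) -> ip k f = 0 -> z != - 'i%C ->
      Ss (f, z *: f) -> ip q f = 0.
    move=> hq kf zi hf; have := adjoint_graph hf hq.
    rewrite ipDl kf add0r ipZl ipZr => /eqP.
    rewrite -subr_eq0 -mulrBl mulf_eq0 subr_eq0 => /orP[/eqP h1|/eqP //].
    have zE : z = - 'i%C by apply: (can_inj (@conjK R)); rewrite ci.
    by rewrite zE eqxx in zi.
  have Ns' : N s.
    move=> z f z0 hf.
    have [zi|zi] := eqVneq z (- 'i%C); last exact: shift hs (PN h _ _ z0 hf) zi hf.
    have zn : Im z != 0 by rewrite lt_eqF.
    apply: (ker_orth_limit zn) hf => p p0 f' hf'.
    apply: (shift _ _ _ _ hs _ _ hf').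
      by apply: (PN h _ _ _ hf'); rewrite ImD /= addr0.
    rewrite zi addrC -subr_eq0 addrK.
    by rewrite -(rmorph0 (real_complex R)) (inj_eq (@complexI R)) gt_eqF.
  have Px : P x = s.
    apply: Pchar => // z f z0 hf; rewrite (_ : x - s = t); last by rewrite st; vec ip.
    apply: (shift _ _ _ _ ht _ _ hf); first exact: Po (kerN _ _ z0 hf).
    by apply: contraTneq z0 => ->; rewrite /= oppr_gt0 ltr10.
  have -> : P y = P h + 'i%C *: s.
    by rewrite /h linearB linearZ Px subrK.
  by rewrite Px.
have [AJ AR AP] := Upsilon_intertwines hJ hRs hJRs hSop SJ SR UA'.
have {}AP : intertwines A' P by apply: AP => // x; exact: Pcomm.
have [[oA' SA' _] _] := UA'.
have saA' := Upsilon_selfadjoint UA'.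
have AJ' x y : A' (x, y) <-> adjoint ip A' (x, y) by rewrite saA'.
have A'Ss x y : A' (x, y) -> Ss (x, y).
  by move=> /AJ' h; apply/adjointE => s t /SA' hst; exact: (adjoint_graph h hst).
have A'sym : A' `<=` adjoint ip A' by move=> [x y] /AJ'.
have A'inj z f : Im z != 0 -> A' (f, z *: f) -> f = 0.
  move=> z0 /(symmetric_nonreal_bound hip z A'sym); rewrite subrr nrm0.
  rewrite pmulr_rle0 ?normr_gt0 // => h.
  by apply: nrm_eq0; apply/eqP; rewrite eq_le h nrm_ge0.
(* Modulo the domain of [S], [x] splits along the kernels of [S^* - i] and [S^* + i], where [P] is 1
   and 0. Commuting with [P] puts both components into [A'], which has no non-real eigenvalue. *)
have A'S x y : A' (x, y) -> S (x, y).
  move=> Axy; have hx := A'Ss _ _ Axy.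
  have in0 : Im ('i%C : R[i]) != 0 by rewrite gt_eqF.
  have nin0 : Im (- 'i%C : R[i]) != 0 by rewrite lt_eqF.
  have ci : (('i%C : R[i])^*)%R = - 'i%C.
    by apply/eqP; rewrite eq_complex /= oppr0 !eqxx.
  have r1 := nonreal_rho0 in0; have r2 := nonreal_rho0 nin0.
  have mm : m 'i%C != m (- 'i%C).
    rewrite -ci weyl_conj //; apply/eqP => h.
    have := weyl_Im o1; rewrite h conjE /= => h1.
    by have := weyl_Im o1; move: h1; rewrite oppr_gt0 => h1; rewrite ltNge (ltW h1).
  have [w1 [w2 [uE vE]]] := two_point_decomposition (Gamma0 x) (Gamma1 x) mm.
  have [f1 [hf1 e1]] := ker_rho0_surj w1 r1.
  have [f2 [hf2 e2]] := ker_rho0_surj w2 r2.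
  have f12 := operator_add oSs hf1 hf2.
  have Sd : S (x - (f1 + f2), y - ('i%C *: f1 + - 'i%C *: f2)).
    apply/S_GammaP; split; first exact: operator_sub oSs hx f12.
      by rewrite (Gamma0B hx f12) (Gamma0D hf1 hf2) e1 e2 -uE subrr.
    rewrite (Gamma1B hx f12) (Gamma1D hf1 hf2) (hm r1 hf1) (hm r2 hf2) e1 e2.
    by rewrite -vE subrr.
  have Pf1 : P f1 = f1.
    apply: Pchar; first exact: kerN hf1.
    by move=> *; rewrite subrr ip0l.
  have Pf2 : P f2 = 0.
    apply: Pchar; first by case: Ns.
    move=> z f z0 hf; rewrite subr0; apply: ip_orthC; exact: Nker hf hf2.
  have h1 := operator_sub oA' (AP _ _ Axy) (SA' _ (SP _ _ Sd)).
  have k1 : P x - P (x - (f1 + f2)) = f1.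
    by rewrite !(linearB P, linearD P) Pf1 Pf2; vec ip.
  have h2 := operator_sub oA' (operator_sub oA' Axy (SA' _ Sd)) h1.
  have k2 : x - (x - (f1 + f2)) - (P x - P (x - (f1 + f2))) = f2.
    by rewrite k1; vec ip.
  rewrite k2 in h2; rewrite k1 in h1.
  have [_ _ fS] := oSs.
  have f10 : f1 = 0.
    by apply: (A'inj _ _ in0); rewrite -(fS _ _ _ (A'Ss _ _ h1) hf1).
  have f20 : f2 = 0.
    by apply: (A'inj _ _ nin0); rewrite -(fS _ _ _ (A'Ss _ _ h2) hf2).
  by move: Sd; rewrite f10 f20 !scaler0 addr0 !subr0.
have in0 : Im ('i%C : R[i]) != 0 by rewrite gt_eqF.
(* Now [A'] is contained in [S], so its adjoint, again [A'], contains [S^*]; but the kernel of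
   [S^* - i] has nonzero boundary values. *)
have [f [hf f0]] := ker_rho0_surj (e 0) (nonreal_rho0 in0).
have A'f : A' (f, 'i%C *: f).
  apply/AJ'/adjointE => s t /A'S Sst; exact: (adjoint_graph hf Sst).
have [g0 _] := S_Gamma_eq0 (A'S _ _ A'f).
by have := he.1 0 0; rewrite -f0 g0 ip0l eqxx => /esym/eqP; rewrite oner_eq0.
Qed.

Lemma has_matrix_coord (T : {linear K -> K}) Y u : has_matrix e T Y ->
  coord (T u) = Y *m coord u.
Proof.
move=> h; rewrite -{1}(coordK u) /of_coord linear_sum.
apply/colP => i; rewrite [LHS]mxE ip_suml mxE; apply: eq_bigr => j _.
rewrite linearZ ipZl h ip_suml (bigD1 i) //= big1 ?addr0.
  by rewrite ipZl he.1 eqxx mulr1 mulrC.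
by move=> k ki; rewrite ipZl he.1 (negPf ki) mulr0.
Qed.

Lemma matrix_coord_ext (Y Y' : 'M[R[i]]_2) :
  (forall u, Y *m coord u = Y' *m coord u) -> Y = Y'.
Proof.
move=> h; apply/trmx_inj/row_matrixP => i; rewrite !rowE.
have := congr1 trmx (h (of_coord (delta_mx 0 i)^T)).
by rewrite of_coordK !trmx_mul trmxK.
Qed.

(** * Matrices of the symmetries and the extensions [A_r] *)

Variables (JK RK : {linear K -> K}).
Hypotheses (hJK : boundary_operator J JK) (hRK : boundary_operator Rs RK).
Hypotheses (hJe : has_matrix e JK (sigma3 R)) (hRe : has_matrix e RK (sigma1 R)).

(** [Y] is the matrix of [C] on boundary values: it inherits [Y ^ 2 = 1], and Green's identity at
    [z1] transfers symmetry and positivity from [J C] to [sigma3 Y]. *)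
Lemma stable_C_matrix z1 z2 (C : {linear H -> H}) :
  0 < Im z1 -> 0 < Im z2 -> m z1 != m z2 ->
  stable_C_symmetry ip J S C -> intertwines A C ->
  exists (a : R) (b : R[i]) (Y : 'M[R[i]]_2), [/\ X *m Y = Y *m X,
    0 < a, a ^+ 2 = 1 + (Re b ^+ 2 + Im b ^+ 2) &
    [/\ Y 0 0 = a%:C, Y 0 1 = b, Y 1 0 = - (b^*)%R & Y 1 1 = - a%:C]].
Proof.
move=> z1p z2p mz /(stable_C_symmetryP hJ SJ)[CC JCs Cp SC SsC] AC.
have SsJ := symmetry_adjoint hJ SJ.
have [Cc hCc] := boundary_operator_exists z1p z2p mz SC SsC.
pose Y := \matrix_(i, j) coord (Cc (e j)) i 0.
have hY u : coord (Cc u) = Y *m coord u.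
  apply: has_matrix_coord => j; rewrite -[LHS]coordK.
  by apply: eq_bigr => i _; rewrite [Y _ _]mxE.
have comm : X *m Y = Y *m X by exact: matrix_extension_commute hCc hY AC.
have YY : Y *m Y = 1%:M.
  apply: matrix_coord_ext => u; rewrite mul1mx -mulmxA -!hY; congr coord.
  have [x [x' [hx x0 _]]] := Gamma_surj u 0.
  by rewrite -x0 -(hCc _ _ hx).1 -(hCc _ _ (SsC _ _ hx)).1 CC.
have z1n : Im z1 != 0 by rewrite gt_eqF.
have hz := nonreal_rho0 z1n.
have /choice[f hf] := fun u => ker_rho0_surj u hz.
pose k := Im z1 / Im (m z1).
have mp := weyl_Im z1p.
have k0 : 0 < k by exact: divr_gt0.
have sub w : w - (w^*)%R = 2 * 'i%C * (Im w)%:C.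
  case: w => a b; apply/eqP; rewrite eq_complex /=.
  by apply/andP; split; apply/eqP; ring.
have i20 : 2 * 'i%C != 0 :> R[i].
  by rewrite mulf_neq0 ?pnatr_eq0 // eq_complex /= oner_eq0 andbF.
have form u v : ipK (JK (Cc u)) v = k%:C * ip (J (C (f u))) (f v).
  have [hu u0] := hf u; have [hv v0] := hf v.
  have hJC : Ss (J (C (f u)), z1 *: J (C (f u))).
    by have := SsJ _ _ (SsC _ _ hu); rewrite !linearZ.
  have := weyl_green hz hz hJC hv.
  rewrite (hJK (SsC _ _ hu)).1 (hCc _ _ hu).1 u0 v0 !sub -!(mulrA (2 * 'i%C)).
  move=> /(mulfI i20) h.
  have mn : (Im (m z1))%:C != 0 :> R[i].
    by rewrite -(rmorph0 (real_complex R)) (inj_eq (@complexI R)) gt_eqF.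
  apply: (mulfI mn); rewrite -h /k rmorphM fmorphV /= mulrA; congr (_ * _).
  by rewrite mulrCA mulfV // mulr1.
have herm u v : ipK (JK (Cc u)) v = ((ipK (JK (Cc v)) u)^*)%R.
  by rewrite !form conjM conj_realE -ipC JCs.
have pos u : u != 0 -> 0 < ipK (JK (Cc u)) u.
  move=> u0; rewrite form mulr_gt0 //; first by rewrite ltcR.
  apply: Cp; apply: contraNneq u0 => fu.
  by rewrite -(hf u).2 fu Gamma00.
have ent i j : ipK (JK (Cc (e j))) (e i) = (sigma3 R *m Y) i j.
  have -> : ipK (JK (Cc (e j))) (e i) = coord (JK (Cc (e j))) i 0 by rewrite mxE.
  rewrite (has_matrix_coord _ hJe) !mxE; apply: eq_bigr => l _.
  by rewrite [Y _ _]mxE.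
have ent0 j : (sigma3 R *m Y) 0 j = Y 0 j.
  by rewrite mxE !big_ord_recl big_ord0 !mxE /= mul1r mul0r !addr0.
have ent1 j : (sigma3 R *m Y) 1 j = - Y 1 j.
  rewrite mxE !big_ord_recl big_ord0 (_ : lift ord0 ord0 = 1); last exact/val_inj.
  by rewrite [X in X * _ + _]mxE [X in _ + (X * _ + _)]mxE /= mul0r add0r addr0 mulN1r.
have en0 i : e i != 0.
  apply/eqP => ei; have := he.1 i i; rewrite ei ip0l eqxx => /esym/eqP.
  by rewrite oner_eq0.
have p0 := pos _ (en0 0); have p1 := pos _ (en0 1).
rewrite ent ent0 in p0; rewrite ent ent1 in p1.
have h01 := herm (e 0) (e 1); rewrite !ent ent0 ent1 in h01.
move: p0 p1; rewrite !gt0_complexE => /andP[/eqP i0 r0] /andP[/eqP i1 r1].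
set a := Re (Y 0 0) in r0; set b := Y 0 1 in h01.
set d := Re (- Y 1 1) in r1.
have Y00 : Y 0 0 = a%:C by rewrite RRe_real // real_ImE i0.
have Y11 : Y 1 1 = - d%:C by rewrite /d RRe_real ?opprK // real_ImE i1.
have Y10 : Y 1 0 = - (b^*)%R by rewrite -h01 opprK.
have bb : b * (b^*)%R = (Re b ^+ 2 + Im b ^+ 2)%:C.
  by rewrite -sqr_normc -add_Re2_Im2.
have yy i j : (Y *m Y) i j = Y i 0 * Y 0 j + Y i 1 * Y 1 j.
  rewrite mxE !big_ord_recl big_ord0 addr0 (_ : lift ord0 ord0 = 1); last exact/val_inj.
  by rewrite (_ : ord0 = 0); last exact/val_inj.
have q0 : a ^+ 2 - (Re b ^+ 2 + Im b ^+ 2) = 1.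
  apply: complexI; rewrite rmorphB rmorphXn /= -bb [RHS](rmorph1 (real_complex R)).
  have := yy 0 0; rewrite YY mxE /= Y00 Y10 -/b => h.
  by apply: etrans (esym h); rewrite mulrN expr2.
have q1 : d ^+ 2 - (Re b ^+ 2 + Im b ^+ 2) = 1.
  apply: complexI; rewrite rmorphB rmorphXn /= -bb [RHS](rmorph1 (real_complex R)).
  have := yy 1 1; rewrite YY mxE /= Y11 Y10 -/b => h.
  by apply: etrans (esym h); rewrite mulrN !mulNr opprK expr2 [RHS]addrC (mulrC b).
(* Both are positive, and the diagonal of [Y ^ 2 = 1] gives them the same square. *)
have ad : a = d.
  by apply/eqP; rewrite -(@eqrXn2 _ 2) ?(ltW r0) ?(ltW r1) //; apply/eqP; lra.
exists a, b, Y; split=> //; first by lra.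
by split=> //; rewrite ad.
Qed.

Lemma Upsilon_matrix : Upsilon ip J S A ->
  X *m sigma3 R = sigma3 R *m X /\ X *m sigma1 R = sigma1 R *m X.
Proof.
move=> /(Upsilon_intertwines hJ hRs hJRs hSop SJ SR)[AJ AR _]; split.
  by apply: (matrix_extension_commute hJK _ AJ) => u; exact: has_matrix_coord.
by apply: (matrix_extension_commute hRK _ AR) => u; exact: has_matrix_coord.
Qed.

(** Subtracting from [x] the kernel element with the same [Gamma0] leaves zero boundary values,
    hence an element of the domain of [S]. *)
Lemma eigen_extensionE (r : R[i]) : rho0 r ->
  eigen_extension ip S r = [set p | Ss p /\ Gamma1 p.1 = m r *: Gamma0 p.1].
Proof.
move=> hr; apply/seteqP; split=> [[x y] [/= hx [s [k [[s' hs] /op_kernel_shift hk xE]]]]|].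
  split=> //=; have [s0 s1] := S_Gamma_eq0 hs; have hS := S_adjoint hs.
  by rewrite xE (Gamma0D hS hk) (Gamma1D hS hk) s0 s1 !add0r (hm hr hk).
move=> [x y] /= [hx x1]; split=> //=.
have [k [hk k0]] := ker_rho0_surj (Gamma0 x) hr.
exists (x - k), k; split; [|exact/op_kernel_shift|by rewrite subrK].
exists (y - r *: k); apply/S_GammaP; split; first exact: operator_sub oSs hx hk.
  by rewrite (Gamma0B hx hk) k0 subrr.
by rewrite (Gamma1B hx hk) (hm hr hk) k0 x1 subrr.
Qed.

Lemma S_domain_ker_trivial (r : R[i]) : rho0 r ->
  op_domain S `&` op_kernel (op_shift Ss r) = [set 0].
Proof.
move=> hr; apply/seteqP; split=> [x [[x' hx] /op_kernel_shift hk]|x ->].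
  have [x0 _] := S_Gamma_eq0 hx; exact: ker_rho0_inj hr hk x0.
split; first by exists 0; case: hSop.
by apply/op_kernel_shift; rewrite scaler0; exact: Ss00.
Qed.

End BoundaryTriplet.

Theorem theorem4p4 (R : realType) (H : completeNormedModType R[i])
    (ip : {dot H for (@Num.conj R[i])}) (hip : inner_product ip)
    (J Rs : {linear H -> H})
    (hJ : fundamental_symmetry ip J) (hRs : fundamental_symmetry ip Rs)
    (hJRs : anticommute J Rs)
    (S : set (H * H)) (hSop : is_operator S) (hSclosed : closed S)
    (hSsimple : simple_operator ip S) (hSdense : densely_defined S)
    (hSsym : symmetric_operator ip S) (hSdefect : defect_numbers_2_2 ip S)
    (hSJ : commutes S J) (hSRs : commutes S Rs)
    (hUpsilon : Upsilon ip J S !=set0)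
    (K : completeNormedModType R[i])
    (ipK : {dot K for (@Num.conj R[i])}) (hipK : inner_product ipK)
    (Gamma0 Gamma1 : H -> K) (hGamma : boundary_triplet ip ipK S Gamma0 Gamma1)
    (JK RK : {linear K -> K})
    (hJ0 : boundary_image ip S Gamma0 J JK)
    (hJ1 : boundary_image ip S Gamma1 J JK)
    (hR0 : boundary_image ip S Gamma0 Rs RK)
    (hR1 : boundary_image ip S Gamma1 Rs RK)
    (e : 'I_2 -> K) (he : orthonormal_basis ipK e)
    (hJe : has_matrix e JK (sigma3 R)) (hRe : has_matrix e RK (sigma1 R))
    (hRJe : has_matrix e (fun u => 'i%C *: RK (JK u)) (sigma2 R))
    (M : R[i] -> {linear K -> K}) (hM : weyl_function ip S Gamma0 Gamma1 M)
    (m : R[i] -> R[i])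
    (hm : forall mu, resolvent_set (A0 ip S Gamma0) mu ->
            forall u, M mu u = m mu *: u)
    (zeta phi xi omega : R) (hphi : 0 <= phi <= pi)
    (hxi : 0 <= xi < 2 * pi) (homega : 0 <= omega < 2 * pi)
    (hst : Sigma_st ip J S (A_K ip ipK S Gamma0 Gamma1 e zeta phi xi omega)) :
  let A := A_K ip ipK S Gamma0 Gamma1 e zeta phi xi omega in
  let rho0 := resolvent_set (A0 ip S Gamma0) in
  [/\ forall z, spectrum A z -> z \is Num.real,
      exists! t : R, is_angle ip J S A zeta phi t,
      forall t : R, is_angle ip J S A zeta phi t ->
        forall r, rho0 r ->
          (discrete_spectrum A r <->
           tan_factor ((xi + t) / 2) (m r) * cot_factor ((xi - t) / 2) (m r) = 0)
    & A = A_K ip ipK S Gamma0 Gamma1 e 0 (pi / 2) xi omega ->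
      Upsilon ip J S A -> xi != pi / 2 ->
        forall r, rho0 r ->
          (discrete_spectrum A r <-> (tan ((xi + pi / 2) / 2))%:C + m r = 0) /\
          (discrete_spectrum A r ->
             [/\ op_domain S `&` op_kernel (op_shift (adjoint ip S) r) = [set 0],
                 selfadjoint ip (eigen_extension ip S r)
               & A = eigen_extension ip S r])].
Proof.
move=> A rho0.
have SJ := commutes_intertwines hSJ; have SR := commutes_intertwines hSRs.
have hm' z f : rho0 z -> adjoint ip S (f, z *: f) -> Gamma1 f = m z *: Gamma0 f.
  move=> hz hf; have [_ h] := hM _ hz.
  by rewrite -hm // h //; apply/op_kernel_shift.
have hJK : boundary_operator ip S Gamma0 Gamma1 J JK.
  by move=> x x' hx; have dx : op_domain (adjoint ip S) x by [exists x'];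
    rewrite -hJ0 // -hJ1.
have hRK : boundary_operator ip S Gamma0 Gamma1 Rs RK.
  by move=> x x' hx; have dx : op_domain (adjoint ip S) x by [exists x'];
    rewrite -hR0 // -hR1.
have dX zeta' phi' : \det (calK zeta' phi' xi omega) != 0.
  by rewrite det_calK oppr_eq0 expf_neq0 // expi_neq0.
have oA : is_operator A by case: hst => -[].
have [C [hC AC]] := hst.2.
have [CC JCs Cp SC SsC] := stable_C_symmetryP hJ SJ hC.
have [G hG] : exists G : {linear H -> H}, forall x, G x = J (C x).
  by apply: linear_map_of => a x y; rewrite !linearP.
have Gpos x : x != 0 -> 0 < ip (G x) x by rewrite hG; exact: Cp.
have Gsym x y x' y' : A (x, y) -> A (x', y') -> ip y (G x') = ip x (G y').
  by rewrite !hG; exact: (Sigma_C_symmetric hJ hst.1 AC).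
(* Stated for arbitrary parameters, since the last claim uses the presentation by [0] and [pi / 2]
   instead of [zeta] and [phi]. *)
have discrete zeta' phi' t r :
    A = A_K ip ipK S Gamma0 Gamma1 e zeta' phi' xi omega ->
    cosh zeta' * sin phi' = sin t -> rho0 r ->
    (discrete_spectrum A r <->
     tan_factor ((xi + t) / 2) (m r) * cot_factor ((xi - t) / 2) (m r) = 0).
  move=> eA ht hr; rewrite -(calK_quadratic_eq0 xi omega (m r) ht) -det_krein_mx.
  rewrite eA; rewrite eA in oA Gsym.
  exact: (discrete_spectrum_det (X := calK zeta' phi' xi omega) hip hSop hSclosed
    hSdense hSsym hGamma hm' he oA (dX zeta' phi') Gpos Gsym hr).
have UA : Upsilon ip J S A -> sinh zeta = 0 /\ cos phi = 0.
  move=> /(Upsilon_matrix (X := calK zeta phi xi omega) hSop hGamma he hJ hRs hJRs SJ SR hJK hRK hJe hRe)[h3 h1].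
  exact: calK_commute_sigma h3 h1.
have angle_sin t : is_angle ip J S A zeta phi t -> cosh zeta * sin phi = sin t.
  move=> [h1 h2]; have [U|nU] := pselect (Upsilon ip J S A).
    have [s0 c0] := UA U.
    by rewrite (h2 U) sin_pihalf (cosh_eq1 s0) mul1r sin_eq1.
  have [_ [chi [hchi et]]] := h1 (conj hst nU).
  by have [_ ->] := etrans et (angle_direction hchi); rewrite mulrC.
split.
- exact: (spectrum_matrix_extension_real (X := calK zeta phi xi omega) hip hSop
    hSclosed hSdense hSsym hGamma hm' he oA Gpos Gsym).
- have [U|nU] := pselect (Upsilon ip J S A).
    exists (pi / 2); split; last by move=> t [_ /(_ U)].
    by split=> // -[].
  (* A constant [m] is excluded by some member of Upsilon, which is not [A] here; two values make
     the boundary matrix of [C] available. *)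
  have [z1 [z2 [z1p z2p mz]]] : exists z1 z2, [/\ 0 < Im z1, 0 < Im z2 & m z1 != m z2].
    apply: contrapT => h; have [A' UA'] := hUpsilon.
    apply: (weyl_constant_Upsilon_empty hip hSop hSclosed hSdense hSsym hGamma hm'
      he hJ hRs hJRs SJ SR hSsimple UA') => z1 z2 z1p z2p.
    by apply: contrapT => /eqP mz; apply: h; exists z1, z2.
  have [a [b [Y [XY a0 a2 [Y0 Y1 _ Y3]]]]] :=
    stable_C_matrix (X := calK zeta phi xi omega) hip hSop hSclosed hSdense hSsym hGamma hm' he hJ SJ hJK hJe
      z1p z2p mz hC (commutes_intertwines AC).
  have dich := calK_commute_dichotomy XY a0 a2 Y0 Y1 Y3.
  have [chi hchi] := tanh_dichotomy_chi dich.
  have [t ht et] := direction_angle hphi hchi.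
  have ang : is_angle ip J S A zeta phi t.
    by split=> // _; split=> //; exists chi.
  exists t; split=> // t' [/(_ (conj hst nU))[ht' [chi' [hchi' et']]] _].
  exact: direction_angle_unique hphi hchi hchi' ht ht' et et'.
- by move=> t /angle_sin ht r hr; exact: (discrete zeta phi).
move=> eA U xi2 r hr.
have c0 := cos_half_neq0 hxi xi2.
have dE : discrete_spectrum A r <-> (tan ((xi + pi / 2) / 2))%:C + m r = 0.
  rewrite -(half_angle_factors (m r) c0); apply: (discrete 0 (pi / 2) _ _ eA _ hr).
  by rewrite (cosh_eq1 (sinh0 R)) mul1r.
split; [exact: dE | move=> /dE/eqP; rewrite addrC addr_eq0 => /eqP mr].
have AP := matrix_extensionP ip S Gamma0 Gamma1 he (calK 0 (pi / 2) xi omega).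
have eA' : A = matrix_extension ip ipK S Gamma0 Gamma1 e (calK 0 (pi / 2) xi omega) := eA.
(* The matrix is scalar, so the condition reads [Gamma1 = - tan ps Gamma0] with
   [ps = (xi + pi / 2) / 2], and [- tan ps = m r]. *)
have AE : A = eigen_extension ip S r.
  rewrite (eigen_extensionE hip hSop hSclosed hSdense hSsym hGamma hm' hr) eA'.
  apply/seteqP; split=> -[x y].
    move=> /AP[hx] /(calK_scalar_boundary omega _ _ c0) h.
    by split; [exact: hx | apply: (coord_inj he); rewrite coordZ mr].
  move=> [/= hx x1]; apply/AP; split; first exact: hx.
  by apply/(calK_scalar_boundary omega _ _ c0); rewrite x1 coordZ mr.
split; [exact: (S_domain_ker_trivial hip hSop hSdense hSsym hGamma hr) | | exact: AE].
by rewrite -AE; exact: (Upsilon_selfadjoint hSop hJ hRs hJRs SJ SR U).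
Qed.
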